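(* Let $n\ge2$, let $k_1,\dots,k_t\ge1$ be integers with $k_1+\cdots+k_t=n$, and set $N_0=0$, $N_s=\sum_{r=1}^sk_r$ and $I_s=\{N_{s-1}+1,N_{s-1}+2,\dots,N_s\}$ for $s=1,\dots,t$. Let $\Theta=\{1,\dots,n-1\}\setminus\{N_1,\dots,N_{t-1}\}$ (every subset of $\{1,\dots,n-1\}$ arises in this way), so that $i\in\Theta$ exactly when $N_{s-1}<i<N_s$ for some $s$. Let $U_q(\mathfrak{k})\subseteq U_q(\mathfrak{sl}_n)$ be the subalgebra generated by $\{E_i,F_i\mid i\in\Theta\}\cup\{K_j^{\pm1}\mid j=1,\dots,n-1\}$, and let $$\mathcal{O}_q(K\backslash G)=\{f\in\mathcal{O}_q(SL(n))\mid L_x(f)=\epsilon(x)f\ \ \forall x\in U_q(\mathfrak{k})\}.$$ Then the subalgebra $\mathcal{O}_q(K\backslash G)$ of invariants is generated by quantum minors of the form $T(\det_q(I_s,J(s)))$, $s=1,2,\dots,t$, where $J(s)$ is any subset of $\{1,2,\dots,n\}$ of cardinality $k_s$.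
   Context: The base field is $\mathbb{Q}(q)$, $q$ an indeterminate. Quantum matrices. $\mathcal{O}_q(M(n))$ is the associative algebra generated by $x_{ij}$ ($1\le i,j\le n$) with relations: $x_{ij}x_{ik}=q^2x_{ik}x_{ij}$ if $j<k$; $x_{ij}x_{kj}=q^2x_{kj}x_{ij}$ if $i<k$; $x_{ij}x_{st}=x_{st}x_{ij}$ if $i>s,\ j<t$; $x_{ij}x_{st}=x_{st}x_{ij}+(q^2-q^{-2})x_{it}x_{sj}$ if $i<s,\ j<t$. For subsets $I=\{i_1<\cdots<i_m\}$ and $J=\{j_1<\cdots<j_m\}$ of $\{1,\dots,n\}$ the quantum minor is $\det_q(I,J)=\sum_{\sigma\in S_m}(-q^2)^{l(\sigma)}x_{i_1j_{\sigma(1)}}\cdots x_{i_mj_{\sigma(m)}}$, where $l(\sigma)$ is the length of $\sigma$; the quantum determinant $\det_q=\det_q(\{1,\dots,n\},\{1,\dots,n\})$ is central. Put $\mathcal{O}_q(SL(n))=\mathcal{O}_q(M(n))/\langle\det_q-1\rangle$ with canonical map $T:\mathcal{O}_q(M(n))\to\mathcal{O}_q(SL(n))$; it is a Hopf algebra with $\Delta(x_{ij})=\sum_k x_{ik}\otimes x_{kj}$. Quantized enveloping algebra. With $(a_{ij})$ the Cartan matrix of type $A_{n-1}$, $U_q(\mathfrak{sl}_n)=U_q(A_{n-1})$ is generated by $E_i,F_i,K_i^{\pm1}$ ($1\le i\le n-1$) with relations: the $K_i$ commute, $K_iK_i^{-1}=K_i^{-1}K_i=1$; $E_iF_j-F_jE_i=\delta_{ij}\frac{K_i^2-K_i^{-2}}{q^2-q^{-2}}$;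 $K_iE_j=q^{a_{ij}}E_jK_i$; $K_iF_j=q^{-a_{ij}}F_jK_i$; and the quantum Serre relations with parameter $q^2$ (i.e. $E_i^2E_j-(q^2+q^{-2})E_iE_jE_i+E_jE_i^2=0$ if $|i-j|=1$, $E_iE_j=E_jE_i$ if $|i-j|>1$, and likewise for the $F_i$). Hopf structure: $\Delta(K_i)=K_i\otimes K_i$, $\Delta(E_i)=E_i\otimes1+K_i^2\otimes E_i$, $\Delta(F_i)=F_i\otimes K_i^{-2}+1\otimes F_i$, $\epsilon(K_i)=1$, $\epsilon(E_i)=\epsilon(F_i)=0$, antipode $S(K_i)=K_i^{-1}$, $S(E_i)=-K_i^{-2}E_i$, $S(F_i)=-F_iK_i^2$. Action. $\langle\cdot,\cdot\rangle$ is the standard Hopf pairing of $\mathcal{O}_q(SL(n))$ with $U_q(\mathfrak{sl}_n)$: $\langle x_{ij},u\rangle$ is the $(i,j)$ matrix entry of $u$ in the natural representation ($E_k\mapsto e_{k,k+1}$, $F_k\mapsto e_{k+1,k}$, where $e_{ab}$ are the matrix units, and $K_k\mapsto$ the diagonal matrix with entry $q$ at position $k$, $q^{-1}$ at position $k+1$, and $1$ elsewhere), and $\langle fg,u\rangle=\langle f\otimes g,\Delta(u)\rangle$. For $x\in U_q(\mathfrak{sl}_n)$, $f\in\mathcal{O}_q(SL(n))$, with $\Delta(f)=\sum f_{(1)}\otimes f_{(2)}$, the left action $L$ is $L_x(f)=\sum\langle f_{(1)},S(x)\rangle f_{(2)}$.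
   Formalization: For t≥2 the listed minors are not themselves invariant under the K_j (e.g. L_{K_1}x_{11}=q^{-1}x_{11} for n=2), so it is proved instead that the invariants are exactly the elements of the subalgebra generated by these minors that are fixed by all L_{K_j}. *)

(* Defs.v *)
From HB Require Import structures.
From mathcomp Require Import all_boot all_order perm all_algebra.
From mathcomp Require Import boolp.
From mathcomp Require finmap.
From mathcomp Require Import monalg.

Set Implicit Arguments.
Unset Strict Implicit.
Unset Printing Implicit Defensive.

Import GRing.Theory.
Local Open Scope ring_scope.
Local Open Scope quotient_scope.

Section GeneralAlgebra.
Variable F : fieldType.

Inductive gen_subalg (A : algType F) (S : A -> Prop) : A -> Prop :=
| gen_subalg_base x : S x -> gen_subalg S x
| gen_subalg_one : gen_subalg S 1
| gen_subalg_lin (a : F) x y :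
    gen_subalg S x -> gen_subalg S y -> gen_subalg S (a *: x + y)
| gen_subalg_mul x y :
    gen_subalg S x -> gen_subalg S y -> gen_subalg S (x * y).

Definition freeAlg (I : choiceType) := {malg F[{fmonom I}]}.

Section FreeAlgebra.
Variable I : choiceType.

HB.instance Definition _ := GRing.Lalgebra.on (freeAlg I).

Lemma freeAlg_scalerAr (a : F) (u v : freeAlg I) : a *: (u * v) = u * (a *: v).
Proof.
have ZU c d (m : {fmonom I}) :
    c *: << d *g m >> = << c * d *g m >> :> {malg F[{fmonom I}]}.
  by apply/malgP => k; rewrite mcoeffZ !mcoeffU mulrnAr.
rewrite [u * v]malgME [RHS](malgMEw (finmap.fsubset_refl _) (msuppZ_le _ _)).
rewrite scaler_sumr; apply: eq_bigr => k1 _; rewrite scaler_sumr.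
apply: eq_bigr => k2 _; rewrite (mcoeffZ a v k2).
by apply: etrans (ZU _ _ _) _; rewrite mulrCA.
Qed.

HB.instance Definition _ :=
  GRing.Lalgebra_isAlgebra.Build F (freeAlg I) freeAlg_scalerAr.

Definition fgen (i : I) : freeAlg I := << fmu i >>.

Section Evaluation.
Variable v : I -> F.

Definition fprod (m : {fmonom I}) : F := \prod_(i <- m) v i.

Lemma fprod_mmorphism : mmorphism fprod.
Proof.
by split=> [m1 m2|]; rewrite /fprod ?fmM ?fm1 ?big_cat ?big_nil.
Qed.

HB.instance Definition _ := isMultiplicative.Build _ _ fprod fprod_mmorphism.

Definition feval : freeAlg I -> F := mmap idfun fprod.

HB.instance Definition _ := GRing.LRMorphism.on feval.

Lemma feval_gen i : feval (fgen i) = v i.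
Proof. by rewrite /feval mmapU mul1r /fprod fmU big_seq1. Qed.

Lemma feval_zmod_morphism : zmod_morphism feval.
Proof. exact: rmorphB. Qed.

Lemma feval_monoid_morphism : monoid_morphism feval.
Proof. by split; [exact: rmorph1|exact: rmorphM]. Qed.

Lemma fevalZ c u : feval (c *: u) = c * feval u.
Proof. exact: mmap_is_linear. Qed.

Lemma fevalD u w : feval (u + w) = feval u + feval w.
Proof. exact: rmorphD. Qed.

Lemma fevalM u w : feval (u * w) = feval u * feval w.
Proof. exact: rmorphM. Qed.

Lemma fevalX u m : feval (u ^+ m) = feval u ^+ m.
Proof. exact: rmorphXn. Qed.

Lemma feval1 : feval 1 = 1.
Proof. exact: rmorph1. Qed.

End Evaluation.

End FreeAlgebra.

Section Quotient.
Variables (A : algType F) (S : A -> Prop).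

Inductive gen_ideal : A -> Prop :=
| gen_ideal_base x : S x -> gen_ideal x
| gen_ideal0 : gen_ideal 0
| gen_idealD x y : gen_ideal x -> gen_ideal y -> gen_ideal (x + y)
| gen_idealMl a x : gen_ideal x -> gen_ideal (a * x)
| gen_idealMr a x : gen_ideal x -> gen_ideal (x * a).

Lemma gen_idealN x : gen_ideal x -> gen_ideal (- x).
Proof. by move=> Jx; rewrite -mulN1r; apply: gen_idealMl. Qed.

Lemma gen_idealZ (c : F) x : gen_ideal x -> gen_ideal (c *: x).
Proof.
by move=> Jx; rewrite -[x]mul1r scalerAl; apply: gen_idealMl.
Qed.

Definition ideal_rel : rel A := fun x y => `[< gen_ideal (x - y) >].

Lemma ideal_rel_refl : reflexive ideal_rel.
Proof. by move=> x; apply/asboolP; rewrite subrr; apply: gen_ideal0. Qed.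

Lemma ideal_rel_sym : symmetric ideal_rel.
Proof.
by move=> x y; apply/asboolP/asboolP => /gen_idealN; rewrite opprB.
Qed.

Lemma ideal_rel_trans : transitive ideal_rel.
Proof.
move=> y x z /asboolP Jxy /asboolP Jyz; apply/asboolP.
by rewrite -(subrK y x) -addrA; apply: gen_idealD.
Qed.

Definition ideal_equiv :=
  EquivRel ideal_rel ideal_rel_refl ideal_rel_sym ideal_rel_trans.

Definition quot := {eq_quot ideal_equiv}.
HB.instance Definition _ := Choice.on quot.

(* The operations are locked so that conversion does not unfold them. *)
Fact quot_key : unit. Proof. by []. Qed.

Definition quot_pi : A -> quot := locked_with quot_key (fun x => \pi x).

Lemma quot_piE x : quot_pi x = \pi x.
Proof. by rewrite /quot_pi unlock. Qed.

Lemma quot_piP x y : gen_ideal (x - y) <-> quot_pi x = quot_pi y.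
Proof.
rewrite !quot_piE; split=> [Jxy|/eqquotP /asboolP //].
by apply/eqquotP; apply/asboolP.
Qed.

Lemma quot_piK (u : quot) : quot_pi (repr u) = u.
Proof. by rewrite quot_piE reprK. Qed.

Lemma quot_reprP x : gen_ideal (repr (quot_pi x) - x).
Proof. by apply/quot_piP; rewrite quot_piK. Qed.

Definition quot_add : quot -> quot -> quot :=
  locked_with quot_key (fun u v => quot_pi (repr u + repr v)).
Definition quot_opp : quot -> quot :=
  locked_with quot_key (fun u => quot_pi (- repr u)).
Definition quot_mul : quot -> quot -> quot :=
  locked_with quot_key (fun u v => quot_pi (repr u * repr v)).
Definition quot_scale : F -> quot -> quot :=
  locked_with quot_key (fun c u => quot_pi (c *: repr u)).

Lemma quot_addE x y : quot_add (quot_pi x) (quot_pi y) = quot_pi (x + y).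
Proof.
rewrite /quot_add unlock.
apply/quot_piP; rewrite opprD addrACA.
by apply: gen_idealD; apply: quot_reprP.
Qed.

Lemma quot_oppE x : quot_opp (quot_pi x) = quot_pi (- x).
Proof.
rewrite /quot_opp unlock; apply/quot_piP; rewrite -opprD.
exact/gen_idealN/quot_reprP.
Qed.

Lemma quot_mulE x y : quot_mul (quot_pi x) (quot_pi y) = quot_pi (x * y).
Proof.
rewrite /quot_mul unlock.
apply/quot_piP; set x' := repr _; set y' := repr _.
have -> : x' * y' - x * y = x' * (y' - y) + (x' - x) * y.
  by rewrite mulrBr mulrBl addrA subrK.
apply: gen_idealD; first exact/gen_idealMl/quot_reprP.
exact/gen_idealMr/quot_reprP.
Qed.

Lemma quot_scaleE c x : quot_scale c (quot_pi x) = quot_pi (c *: x).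
Proof.
rewrite /quot_scale unlock; apply/quot_piP; rewrite -scalerBr.
exact/gen_idealZ/quot_reprP.
Qed.

Let quotE := (quot_addE, quot_oppE, quot_mulE, quot_scaleE).

Lemma quot_addA : associative quot_add.
Proof.
move=> u v w; rewrite -(quot_piK u) -(quot_piK v) -(quot_piK w).
by rewrite !quotE addrA.
Qed.

Lemma quot_addC : commutative quot_add.
Proof.
by move=> u v; rewrite -(quot_piK u) -(quot_piK v) !quotE addrC.
Qed.

Lemma quot_add0 : left_id (quot_pi 0) quot_add.
Proof. by move=> u; rewrite -(quot_piK u) !quotE add0r. Qed.

Lemma quot_addN : left_inverse (quot_pi 0) quot_opp quot_add.
Proof. by move=> u; rewrite -(quot_piK u) !quotE addNr. Qed.

HB.instance Definition _ :=
  GRing.isZmodule.Build quot quot_addA quot_addC quot_add0 quot_addN.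

Lemma quot_mulA : associative quot_mul.
Proof.
move=> u v w; rewrite -(quot_piK u) -(quot_piK v) -(quot_piK w).
by rewrite !quotE mulrA.
Qed.

Lemma quot_mul1l : left_id (quot_pi 1) quot_mul.
Proof. by move=> u; rewrite -(quot_piK u) !quotE mul1r. Qed.

Lemma quot_mul1r : right_id (quot_pi 1) quot_mul.
Proof. by move=> u; rewrite -(quot_piK u) !quotE mulr1. Qed.

Lemma quot_mulDl : left_distributive quot_mul quot_add.
Proof.
move=> u v w; rewrite -(quot_piK u) -(quot_piK v) -(quot_piK w).
by rewrite !quotE mulrDl.
Qed.

Lemma quot_mulDr : right_distributive quot_mul quot_add.
Proof.
move=> u v w; rewrite -(quot_piK u) -(quot_piK v) -(quot_piK w).
by rewrite !quotE mulrDr.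
Qed.

HB.instance Definition _ := GRing.Zmodule_isPzRing.Build quot
  quot_mulA quot_mul1l quot_mul1r quot_mulDl quot_mulDr.

Lemma quot_scaleA a b u : quot_scale a (quot_scale b u) = quot_scale (a * b) u.
Proof. by rewrite -(quot_piK u) !quotE scalerA. Qed.

Lemma quot_scale1 : left_id 1 quot_scale.
Proof. by move=> u; rewrite -(quot_piK u) !quotE scale1r. Qed.

Lemma quot_scaleDr : right_distributive quot_scale +%R.
Proof.
move=> a u v; rewrite -(quot_piK u) -(quot_piK v).
by rewrite /GRing.add /= !quotE scalerDr.
Qed.

Lemma quot_scaleDl u : {morph quot_scale^~ u : a b / a + b}.
Proof.
move=> a b; rewrite -(quot_piK u) [in RHS]/GRing.add /=.
by rewrite !quotE scalerDl.
Qed.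

HB.instance Definition _ := GRing.Zmodule_isLmodule.Build F quot
  quot_scaleA quot_scale1 quot_scaleDr quot_scaleDl.

Lemma quot_piB x y : quot_pi (x - y) = quot_pi x - quot_pi y.
Proof. by rewrite [RHS]/GRing.add /= [in RHS]/GRing.opp /= !quotE. Qed.

Lemma quot_piM x y : quot_pi (x * y) = quot_pi x * quot_pi y.
Proof. by rewrite [RHS]quot_mulE. Qed.

Lemma quot_piZ c x : quot_pi (c *: x) = c *: quot_pi x.
Proof. by rewrite [RHS]quot_scaleE. Qed.

Lemma quot_scaleAl (a : F) (u v : quot) : a *: (u * v) = (a *: u) * v.
Proof.
rewrite -(quot_piK u) -(quot_piK v) /GRing.scale /GRing.mul /=.
by rewrite !quotE scalerAl.
Qed.

Lemma quot_scaleAr (a : F) (u v : quot) : a *: (u * v) = u * (a *: v).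
Proof.
rewrite -(quot_piK u) -(quot_piK v) /GRing.scale /GRing.mul /=.
by rewrite !quotE scalerAr.
Qed.

Section Augmentation.
Variable phi : A -> F.
Hypotheses (phiB : zmod_morphism phi) (phiM : monoid_morphism phi).
Hypothesis phiS : forall x, S x -> phi x = 0.

Let phi0 : phi 0 = 0. Proof. by rewrite -(subrr 0) phiB subrr. Qed.

Lemma gen_ideal_aug x : gen_ideal x -> phi x = 0.
Proof.
elim=> {x} [x /phiS //|//|x y _ px _ py|a x _ px|a x _ px].
- by rewrite -[y]opprK -[- y]sub0r !phiB phi0 px py !subr0.
- by rewrite phiM.2 px mulr0.
- by rewrite phiM.2 px mul0r.
Qed.

Definition quot_aug (u : quot) : F := phi (repr u).

Lemma quot_augE x : quot_aug (quot_pi x) = phi x.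
Proof.
by apply/subr0_eq; rewrite -phiB gen_ideal_aug //; apply: quot_reprP.
Qed.

Lemma quot_aug_zmod_morphism : zmod_morphism quot_aug.
Proof.
move=> u v; rewrite -(quot_piK u) -(quot_piK v) -quot_piB !quot_augE.
exact: phiB.
Qed.

Lemma quot_aug_monoid_morphism : monoid_morphism quot_aug.
Proof.
split=> [|u v]; first by rewrite quot_augE phiM.1.
by rewrite -(quot_piK u) -(quot_piK v) -quot_piM !quot_augE phiM.2.
Qed.

Lemma quot_neq0 : 1 != 0 :> quot.
Proof.
apply/eqP => /(congr1 quot_aug); rewrite !quot_augE phi0 phiM.1.
by apply/eqP; rewrite oner_eq0.
Qed.

End Augmentation.

End Quotient.

Section Tensor.
Variables A B : algType F.

(* A finite list of pairs (a_i, b_i) stands for the sum of the a_i (x) b_i;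
   two lists are identified when no bilinear map tells them apart. *)
Definition tens_rel : rel (seq (A * B)) := fun s1 s2 =>
  `[< forall (W : lmodType F) (b : A -> B -> W), bilinear_for *:%R *:%R b ->
      \sum_(p <- s1) b p.1 p.2 = \sum_(p <- s2) b p.1 p.2 >].

Lemma tens_rel_refl : reflexive tens_rel.
Proof. by move=> s; apply/asboolP. Qed.

Lemma tens_rel_sym : symmetric tens_rel.
Proof.
by move=> s1 s2; apply/asboolP/asboolP => eqs W b bP; rewrite (eqs W b bP).
Qed.

Lemma tens_rel_trans : transitive tens_rel.
Proof.
move=> s2 s1 s3 /asboolP e12 /asboolP e23; apply/asboolP => W b bP.
by rewrite (e12 W b bP) (e23 W b bP).
Qed.

Definition tens_equiv :=
  EquivRel tens_rel tens_rel_refl tens_rel_sym tens_rel_trans.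

Definition tens := {eq_quot tens_equiv}.
HB.instance Definition _ := Choice.on tens.

Fact tens_key : unit. Proof. by []. Qed.

Definition tens_pi : seq (A * B) -> tens :=
  locked_with tens_key (fun s => \pi s).

Lemma tens_pi_unlock s : tens_pi s = \pi s.
Proof. by rewrite /tens_pi unlock. Qed.

(* The linear map induced by a bilinear map b; in Sweedler's notation it sends
   \sum t_(1) (x) t_(2) to \sum b t_(1) t_(2). *)
Definition tens_lift (W : lmodType F) (b : A -> B -> W) (t : tens) : W :=
  \sum_(p <- repr t) b p.1 p.2.

Lemma tens_piP s1 s2 :
  (forall (W : lmodType F) (b : A -> B -> W), bilinear_for *:%R *:%R b ->
      \sum_(p <- s1) b p.1 p.2 = \sum_(p <- s2) b p.1 p.2)
  <-> tens_pi s1 = tens_pi s2.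
Proof.
rewrite !tens_pi_unlock; split=> [e12|/eqquotP /asboolP //].
by apply/eqquotP; apply/asboolP.
Qed.

Lemma tens_piK t : tens_pi (repr t) = t.
Proof. by rewrite tens_pi_unlock reprK. Qed.

Lemma tens_lift_pi (W : lmodType F) (b : A -> B -> W) s :
  bilinear_for *:%R *:%R b ->
  tens_lift b (tens_pi s) = \sum_(p <- s) b p.1 p.2.
Proof. by move=> bP; apply: (tens_piP _ _).2 => //; rewrite tens_piK. Qed.

Definition tens_addl (s1 s2 : seq (A * B)) := s1 ++ s2.
Definition tens_scalel (c : F) (s : seq (A * B)) :=
  [seq (c *: p.1, p.2) | p <- s].
Definition tens_mull (s1 s2 : seq (A * B)) :=
  [seq (p.1 * r.1, p.2 * r.2) | p <- s1, r <- s2].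

Definition tens_add : tens -> tens -> tens :=
  locked_with tens_key (fun t u => tens_pi (tens_addl (repr t) (repr u))).
Definition tens_scale : F -> tens -> tens :=
  locked_with tens_key (fun c t => tens_pi (tens_scalel c (repr t))).
Definition tens_opp (t : tens) := tens_scale (- 1) t.
Definition tens_mul : tens -> tens -> tens :=
  locked_with tens_key (fun t u => tens_pi (tens_mull (repr t) (repr u))).

Section Bilinear.
Variables (W : lmodType F) (b : A -> B -> W).
Hypothesis bP : bilinear_for *:%R *:%R b.

Lemma bilinZl c x y : b (c *: x) y = c *: b x y.
Proof. exact: (scalable_linear (bP.1 y)). Qed.

Lemma bilinZr c x y : b x (c *: y) = c *: b x y.
Proof. exact: (scalable_linear (bP.2 x)). Qed.

Lemma sum_addl s1 s2 : \sum_(p <- tens_addl s1 s2) b p.1 p.2 =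
  \sum_(p <- s1) b p.1 p.2 + \sum_(p <- s2) b p.1 p.2.
Proof. exact: big_cat. Qed.

Lemma sum_scalel c s : \sum_(p <- tens_scalel c s) b p.1 p.2 =
  c *: \sum_(p <- s) b p.1 p.2.
Proof.
by rewrite big_map scaler_sumr; apply: eq_bigr => p _; rewrite bilinZl.
Qed.

Lemma sum_mull s1 s2 : \sum_(p <- tens_mull s1 s2) b p.1 p.2 =
  \sum_(p <- s1) \sum_(r <- s2) b (p.1 * r.1) (p.2 * r.2).
Proof. by rewrite big_allpairs_dep. Qed.

Lemma bilin_mulr x y :
  bilinear_for *:%R *:%R (fun x' y' => b (x * x') (y * y')).
Proof.
split=> [z|z] a u v /=; first by rewrite mulrDr -scalerAr bP.1.
by rewrite mulrDr -scalerAr bP.2.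
Qed.

Lemma bilin_mull x y :
  bilinear_for *:%R *:%R (fun x' y' => b (x' * x) (y' * y)).
Proof.
split=> [z|z] a u v /=; first by rewrite mulrDl -scalerAl bP.1.
by rewrite mulrDl -scalerAl bP.2.
Qed.

End Bilinear.

Lemma repr_sum s (W : lmodType F) (b : A -> B -> W) :
  bilinear_for *:%R *:%R b ->
  \sum_(p <- repr (tens_pi s)) b p.1 p.2 = \sum_(p <- s) b p.1 p.2.
Proof. exact: tens_lift_pi. Qed.

Lemma tens_addE s1 s2 :
  tens_add (tens_pi s1) (tens_pi s2) = tens_pi (tens_addl s1 s2).
Proof.
rewrite /tens_add unlock.
by apply/tens_piP => W b bP; rewrite !sum_addl !repr_sum.
Qed.

Lemma tens_scaleE c s : tens_scale c (tens_pi s) = tens_pi (tens_scalel c s).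
Proof.
rewrite /tens_scale unlock.
by apply/tens_piP => W b bP; rewrite !sum_scalel // repr_sum.
Qed.

Lemma tens_mulE s1 s2 :
  tens_mul (tens_pi s1) (tens_pi s2) = tens_pi (tens_mull s1 s2).
Proof.
rewrite /tens_mul unlock.
apply/tens_piP => W b bP; rewrite !sum_mull.
under eq_bigr => p _ do rewrite (repr_sum s2 (bilin_mulr bP p.1 p.2)).
rewrite exchange_big [RHS]exchange_big /=; apply: eq_bigr => r _.
exact: (repr_sum s1 (bilin_mull bP r.1 r.2)).
Qed.

Lemma tens_addA : associative tens_add.
Proof.
move=> t u v; rewrite -(tens_piK t) -(tens_piK u) -(tens_piK v) !tens_addE.
by rewrite /tens_addl catA.
Qed.

Lemma tens_addC : commutative tens_add.
Proof.
move=> t u; rewrite -(tens_piK t) -(tens_piK u) !tens_addE.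
by apply/tens_piP => W b bP; rewrite !sum_addl addrC.
Qed.

Lemma tens_add0 : left_id (tens_pi [::]) tens_add.
Proof. by move=> t; rewrite -(tens_piK t) tens_addE. Qed.

Lemma tens_addN : left_inverse (tens_pi [::]) tens_opp tens_add.
Proof.
move=> t; rewrite -(tens_piK t) /tens_opp tens_scaleE tens_addE.
apply/tens_piP => W b bP; rewrite sum_addl sum_scalel // scaleN1r addNr.
by rewrite big_nil.
Qed.

HB.instance Definition _ :=
  GRing.isZmodule.Build tens tens_addA tens_addC tens_add0 tens_addN.

Lemma tens_mulA : associative tens_mul.
Proof.
move=> t u v; rewrite -(tens_piK t) -(tens_piK u) -(tens_piK v) !tens_mulE.
apply/tens_piP => W b bP; rewrite !sum_mull !big_allpairs_dep /=.
apply: eq_bigr => p _; rewrite big_allpairs_dep /=; apply: eq_bigr => r _.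
by apply: eq_bigr => s _; rewrite !mulrA.
Qed.

Lemma tens_mul1l : left_id (tens_pi [:: (1, 1)]) tens_mul.
Proof.
move=> t; rewrite -(tens_piK t) tens_mulE; apply/tens_piP => W b bP.
by rewrite sum_mull big_seq1; apply: eq_bigr => p _; rewrite !mul1r.
Qed.

Lemma tens_mul1r : right_id (tens_pi [:: (1, 1)]) tens_mul.
Proof.
move=> t; rewrite -(tens_piK t) tens_mulE; apply/tens_piP => W b bP.
by rewrite sum_mull; apply: eq_bigr => p _; rewrite big_seq1 !mulr1.
Qed.

Lemma tens_mulDl : left_distributive tens_mul tens_add.
Proof.
move=> t u v; rewrite -(tens_piK t) -(tens_piK u) -(tens_piK v).
rewrite !(tens_addE, tens_mulE).
by apply/tens_piP => W b bP; rewrite sum_addl !sum_mull big_cat.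
Qed.

Lemma tens_mulDr : right_distributive tens_mul tens_add.
Proof.
move=> t u v; rewrite -(tens_piK t) -(tens_piK u) -(tens_piK v).
rewrite !(tens_addE, tens_mulE).
apply/tens_piP => W b bP; rewrite sum_addl !sum_mull -big_split /=.
by apply: eq_bigr => p _; rewrite big_cat.
Qed.

HB.instance Definition _ := GRing.Zmodule_isPzRing.Build tens
  tens_mulA tens_mul1l tens_mul1r tens_mulDl tens_mulDr.

Lemma tens_scaleA a c t : tens_scale a (tens_scale c t) = tens_scale (a * c) t.
Proof.
rewrite -(tens_piK t) !tens_scaleE; apply/tens_piP => W b bP.
by rewrite !sum_scalel // scalerA.
Qed.

Lemma tens_scale1 : left_id 1 tens_scale.
Proof.
move=> t; rewrite -(tens_piK t) tens_scaleE; apply/tens_piP => W b bP.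
by rewrite sum_scalel // scale1r.
Qed.

Lemma tens_scaleDr : right_distributive tens_scale +%R.
Proof.
move=> a t u; rewrite -(tens_piK t) -(tens_piK u) /GRing.add /=.
rewrite !(tens_scaleE, tens_addE); apply/tens_piP => W b bP.
by rewrite !(sum_scalel, sum_addl) // scalerDr.
Qed.

Lemma tens_scaleDl t : {morph tens_scale^~ t : a c / a + c}.
Proof.
move=> a c; rewrite -(tens_piK t) [in RHS]/GRing.add /=.
rewrite !(tens_scaleE, tens_addE); apply/tens_piP => W b bP.
by rewrite !(sum_scalel, sum_addl) // scalerDl.
Qed.

HB.instance Definition _ := GRing.Zmodule_isLmodule.Build F tens
  tens_scaleA tens_scale1 tens_scaleDr tens_scaleDl.

Definition tpair (x : A) (y : B) : tens := tens_pi [:: (x, y)].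

Lemma tens_liftE (W : lmodType F) (b : A -> B -> W) x y :
  bilinear_for *:%R *:%R b -> tens_lift b (tpair x y) = b x y.
Proof. by move=> bP; rewrite tens_lift_pi // big_seq1. Qed.

Lemma tens_lift_linear (W : lmodType F) (b : A -> B -> W) :
  bilinear_for *:%R *:%R b -> linear (tens_lift b).
Proof.
move=> bP a t u; rewrite -(tens_piK t) -(tens_piK u).
rewrite /GRing.add /= /GRing.scale /= tens_scaleE tens_addE !tens_lift_pi //.
by rewrite sum_addl sum_scalel.
Qed.

Lemma tens_sum t : t = \sum_(p <- repr t) tpair p.1 p.2.
Proof.
rewrite -{1}(tens_piK t).
elim: (repr t) => [|p s IHs]; first by rewrite big_nil.
rewrite big_cons -IHs [RHS]tens_addE; congr tens_pi.
by rewrite /tens_addl /= -surjective_pairing.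
Qed.

End Tensor.

End GeneralAlgebra.

Definition Qq : fieldType := {fraction {poly rat}}.
Arguments Qq : simpl never.
Definition q : Qq := tofrac 'X.

(* Throughout, the indices 1, ..., n are shifted to 0, ..., n - 1 ('I_n), and
   1, ..., n - 1 to 0, ..., n - 2 ('I_n.-1). *)

Section QuantumMatrices.
Variable n : nat.

Let x (i j : 'I_n) : freeAlg Qq ('I_n * 'I_n)%type := fgen Qq (i, j).

Inductive OqM_rel : freeAlg Qq ('I_n * 'I_n)%type -> Prop :=
| OqM_row (i j k : 'I_n) of (j < k)%N :
    OqM_rel (x i j * x i k - q ^+ 2 *: (x i k * x i j))
| OqM_col (i j k : 'I_n) of (i < k)%N :
    OqM_rel (x i j * x k j - q ^+ 2 *: (x k j * x i j))
| OqM_anti (i j s t : 'I_n) of (s < i)%N & (j < t)%N :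
    OqM_rel (x i j * x s t - x s t * x i j)
| OqM_diag (i j s t : 'I_n) of (i < s)%N & (j < t)%N :
    OqM_rel (x i j * x s t
             - (x s t * x i j + (q ^+ 2 - q ^- 2) *: (x i t * x s j))).

Let OqM_pre_aug : freeAlg Qq ('I_n * 'I_n)%type -> Qq :=
  feval (fun p => (p.1 == p.2)%:R).

Lemma OqM_rel_aug z : OqM_rel z -> OqM_pre_aug z = 0.
Proof.
have xE i j : OqM_pre_aug (x i j) = (i == j)%:R by exact: feval_gen.
have xxE i j s t : OqM_pre_aug (x i j * x s t) = (i == j)%:R * (s == t)%:R.
  by rewrite -!xE; exact: fevalM.
have xxZ c i j s t : OqM_pre_aug (c *: (x i j * x s t))
    = c * ((i == j)%:R * (s == t)%:R).
  by rewrite -xxE; exact: fevalZ.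
have augB u w c : OqM_pre_aug u = c -> OqM_pre_aug w = c ->
    OqM_pre_aug (u - w) = 0.
  move=> uc wc; have -> : OqM_pre_aug (u - w) = OqM_pre_aug u - OqM_pre_aug w.
    exact: feval_zmod_morphism.
  by rewrite uc wc subrr.
case=> [i j k ltjk|i j k ltik|i j s t _ _|i j s t ltis ltjt];
  apply: augB (xxE _ _ _ _) _.
- apply: etrans (xxZ _ _ _ _ _) _.
  case: (eqVneq i j) => [->|_]; last by rewrite mulr0n !(mul0r, mulr0).
  by rewrite -val_eqE ltn_eqF // mulr0n !(mul0r, mulr0).
- apply: etrans (xxZ _ _ _ _ _) _.
  case: (eqVneq i j) => [eqij|_]; last by rewrite mulr0n !(mul0r, mulr0).
  by rewrite -eqij -val_eqE gtn_eqF // mulr0n !(mul0r, mulr0).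
- by apply: etrans (xxE _ _ _ _) _; rewrite mulrC.
- apply: etrans (fevalD _ _ _) _.
  apply: etrans (congr2 +%R (xxE _ _ _ _) (xxZ _ _ _ _ _)) _.
  have -> : (i == t)%:R * (s == j)%:R = 0 :> Qq.
    case: (eqVneq i t) => [eqit|_]; last by rewrite mulr0n mul0r.
    case: (eqVneq s j) => [eqsj|_]; last by rewrite mulr0n mulr0.
    by move: ltis; rewrite eqit eqsj ltnNge (ltnW ltjt).
  by rewrite mulr0 addr0 mulrC.
Qed.

Definition OqM := quot OqM_rel.
HB.instance Definition _ := GRing.Lmodule.on OqM.
HB.instance Definition _ := GRing.PzRing.on OqM.

Lemma OqM_neq0 : 1 != 0 :> OqM.
Proof.
exact: (quot_neq0 (@feval_zmod_morphism _ _ _)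
  (@feval_monoid_morphism _ _ _) OqM_rel_aug).
Qed.

HB.instance Definition _ := GRing.PzSemiRing_isNonZero.Build OqM OqM_neq0.
HB.instance Definition _ := GRing.LSemiModule_isLSemiAlgebra.Build Qq OqM
  (@quot_scaleAl _ _ _).
HB.instance Definition _ := GRing.Lalgebra_isAlgebra.Build Qq OqM
  (@quot_scaleAr _ _ _).

Definition xM (i j : 'I_n) : OqM := quot_pi OqM_rel (x i j).

Definition perm_length m (s : 'S_m) : nat :=
  #|[set p : 'I_m * 'I_m | (p.1 < p.2)%N && (s p.2 < s p.1)%N]|.

(* enum_val lists the elements of a set of ordinals in increasing order. *)
Definition set_nth m (I : {set 'I_n}) (hI : #|I| = m) (a : 'I_m) : 'I_n :=
  enum_val (cast_ord (esym hI) a).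

Definition qminor m (I J : {set 'I_n}) (hI : #|I| = m) (hJ : #|J| = m) : OqM :=
  \sum_(s : 'S_m)
    (- q ^+ 2) ^+ perm_length s *:
      \prod_(a < m) xM (set_nth hI a) (set_nth hJ (s a)).

Lemma card_setT_ord : #|[set: 'I_n]| = n.
Proof. by rewrite cardsT card_ord. Qed.

Definition qdet : OqM := qminor card_setT_ord card_setT_ord.

Definition OqSL_rel : OqM -> Prop := eq (qdet - 1).
Definition OqSL := quot OqSL_rel.
HB.instance Definition _ := GRing.Lmodule.on OqSL.
HB.instance Definition _ := GRing.PzRing.on OqSL.

Let OqM_aug : OqM -> Qq := quot_aug OqM_pre_aug.

Lemma OqM_augE z : OqM_aug (quot_pi OqM_rel z) = OqM_pre_aug z.
Proof.
exact: (quot_augE (@feval_zmod_morphism _ _ _) (@feval_monoid_morphism _ _ _)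
  OqM_rel_aug).
Qed.

Lemma OqM_augB : zmod_morphism OqM_aug.
Proof.
exact: (quot_aug_zmod_morphism (@feval_zmod_morphism _ _ _)
  (@feval_monoid_morphism _ _ _) OqM_rel_aug).
Qed.

Lemma OqM_augM : monoid_morphism OqM_aug.
Proof.
exact: (quot_aug_monoid_morphism (@feval_zmod_morphism _ _ _)
  (@feval_monoid_morphism _ _ _) OqM_rel_aug).
Qed.

Lemma qdet_aug : OqM_aug qdet = 1.
Proof.
have augZ c u : OqM_aug (c *: u) = c * OqM_aug u.
  by rewrite -(quot_piK u) -quot_piZ !OqM_augE; apply: fevalZ.
have aug0 : OqM_aug 0 = 0 by rewrite -(subrr 0) OqM_augB subrr.
have augD : {morph OqM_aug : u w / u + w >-> u + w}.
  move=> u w; have -> : u + w = u - (0 - w) by rewrite sub0r opprK.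
  by rewrite !OqM_augB aug0 sub0r opprK.
have aug_prod := big_morph OqM_aug OqM_augM.2 OqM_augM.1.
have xE i j : OqM_aug (xM i j) = (i == j)%:R.
  by rewrite OqM_augE; apply: feval_gen.
pose c (s : 'S_n) := (- q ^+ 2) ^+ perm_length s * \prod_(a < n) (a == s a)%:R.
have -> : OqM_aug qdet = \sum_(s : 'S_n) c s.
  rewrite /qdet /qminor (big_morph OqM_aug augD aug0).
  apply: eq_bigr => s _; rewrite augZ aug_prod; congr (_ * _).
  apply: eq_bigr => a _; rewrite xE /set_nth (inj_eq enum_val_inj).
  by rewrite (inj_eq (@cast_ord_inj _ _ _)).
rewrite (bigD1 (1%g : {perm 'I_n})) //= big1 => [|s s_neq1].
  rewrite addr0 /c (_ : perm_length _ = 0%N) ?mul1r.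
    by apply: big1 => a _; rewrite perm1 eqxx.
  by apply: eq_card0 => p; rewrite !inE !perm1; case: ltngtP.
have [a sa_neq] : exists a, s a != a.
  apply/existsP; apply: contraNT s_neq1; rewrite negb_exists => /forallP sid.
  by apply/eqP/permP => a; rewrite perm1; apply/eqP/negPn.
by rewrite /c (bigD1 a) //= [a == _]eq_sym (negbTE sa_neq) mulr0n mul0r mulr0.
Qed.

Lemma OqSL_rel_aug z : OqSL_rel z -> OqM_aug z = 0.
Proof. by move=> <-; rewrite OqM_augB qdet_aug OqM_augM.1 subrr. Qed.

Lemma OqSL_neq0 : 1 != 0 :> OqSL.
Proof. exact: (quot_neq0 OqM_augB OqM_augM OqSL_rel_aug). Qed.

HB.instance Definition _ := GRing.PzSemiRing_isNonZero.Build OqSL OqSL_neq0.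
HB.instance Definition _ := GRing.LSemiModule_isLSemiAlgebra.Build Qq OqSL
  (@quot_scaleAl _ _ _).
HB.instance Definition _ := GRing.Lalgebra_isAlgebra.Build Qq OqSL
  (@quot_scaleAr _ _ _).

Definition T : OqM -> OqSL := quot_pi OqSL_rel.

Definition xSL (i j : 'I_n) : OqSL := T (xM i j).

End QuantumMatrices.

Inductive Uq_gen (m : nat) : Type :=
| genE of 'I_m | genF of 'I_m | genK of 'I_m | genKV of 'I_m.

Section UqGenChoice.
Variable m : nat.

Definition Uq_gen_code (g : Uq_gen m) : 'I_m + 'I_m + ('I_m + 'I_m) :=
  match g with
  | genE i => inl (inl i) | genF i => inl (inr i)
  | genK i => inr (inl i) | genKV i => inr (inr i)
  end.

Definition Uq_gen_decode (c : 'I_m + 'I_m + ('I_m + 'I_m)) : Uq_gen m :=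
  match c with
  | inl (inl i) => genE i | inl (inr i) => genF i
  | inr (inl i) => genK i | inr (inr i) => genKV i
  end.

Lemma Uq_gen_codeK : cancel Uq_gen_code Uq_gen_decode.
Proof. by case. Qed.

HB.instance Definition _ := Choice.copy (Uq_gen m) (can_type Uq_gen_codeK).

End UqGenChoice.

Section QuantizedEnvelopingAlgebra.
Variable n : nat.

Definition adjacent (i j : 'I_n.-1) : bool :=
  (i == j.+1 :> nat) || (j == i.+1 :> nat).

Definition cartan (i j : 'I_n.-1) : int :=
  if i == j then 2%:Z else if adjacent i j then - 1%:Z else 0.

Let e (i : 'I_n.-1) : freeAlg Qq (Uq_gen n.-1) := fgen Qq (genE i).
Let f (i : 'I_n.-1) : freeAlg Qq (Uq_gen n.-1) := fgen Qq (genF i).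
Let k (i : 'I_n.-1) : freeAlg Qq (Uq_gen n.-1) := fgen Qq (genK i).
Let k' (i : 'I_n.-1) : freeAlg Qq (Uq_gen n.-1) := fgen Qq (genKV i).

Inductive Uq_rel : freeAlg Qq (Uq_gen n.-1) -> Prop :=
| Uq_KK i j : Uq_rel (k i * k j - k j * k i)
| Uq_KKV i : Uq_rel (k i * k' i - 1)
| Uq_KVK i : Uq_rel (k' i * k i - 1)
| Uq_EF i j :
    Uq_rel (e i * f j - f j * e i
            - (i == j)%:R *: ((q ^+ 2 - q ^- 2)^-1 *: (k i ^+ 2 - k' i ^+ 2)))
| Uq_KE i j : Uq_rel (k i * e j - (q ^ cartan i j) *: (e j * k i))
| Uq_KF i j : Uq_rel (k i * f j - (q ^ (- cartan i j)) *: (f j * k i))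
| Uq_serreE i j of adjacent i j :
    Uq_rel (e i ^+ 2 * e j - (q ^+ 2 + q ^- 2) *: (e i * e j * e i)
            + e j * e i ^+ 2)
| Uq_serreF i j of adjacent i j :
    Uq_rel (f i ^+ 2 * f j - (q ^+ 2 + q ^- 2) *: (f i * f j * f i)
            + f j * f i ^+ 2)
| Uq_farE i j of i != j & ~~ adjacent i j : Uq_rel (e i * e j - e j * e i)
| Uq_farF i j of i != j & ~~ adjacent i j : Uq_rel (f i * f j - f j * f i).

Let Uq_pre_aug : freeAlg Qq (Uq_gen n.-1) -> Qq :=
  feval (fun g => match g with genK _ | genKV _ => 1 | _ => 0 end).

Lemma Uq_rel_aug z : Uq_rel z -> Uq_pre_aug z = 0.
Proof.
pose ev := Uq_pre_aug; rewrite -[Uq_pre_aug]/ev.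
have eE i : ev (e i) = 0 by exact: feval_gen.
have fE i : ev (f i) = 0 by exact: feval_gen.
have kE i : ev (k i) = 1 by exact: feval_gen.
have k'E i : ev (k' i) = 1 by exact: feval_gen.
have oneE : ev 1 = 1 by exact: feval1.
have evB u w a b : ev u = a -> ev w = b -> ev (u - w) = a - b.
  by move=> <- <-; exact: feval_zmod_morphism.
have evD u w a b : ev u = a -> ev w = b -> ev (u + w) = a + b.
  by move=> <- <-; exact: fevalD.
have evM u w a b : ev u = a -> ev w = b -> ev (u * w) = a * b.
  by move=> <- <-; exact: fevalM.
have evZ c u a : ev u = a -> ev (c *: u) = c * a.
  by move=> <-; exact: fevalZ.
have evX u a : ev u = a -> ev (u ^+ 2) = a ^+ 2.
  by move=> <-; exact: fevalX.
have serre (g h : freeAlg Qq (Uq_gen n.-1)) c : ev g = 0 ->  ev h = 0 ->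
    ev (g ^+ 2 * h - c *: (g * h * g) + h * g ^+ 2) = 0.
  move=> g0 h0.
  apply: etrans (evD _ _ _ _ (evB _ _ _ _ (evM _ _ _ _ (evX _ _ g0)
    h0) (evZ _ _ _ (evM _ _ _ _ (evM _ _ _ _ g0 h0) g0)))
    (evM _ _ _ _ h0 (evX _ _ g0))) _.
  by rewrite !(mul0r, mulr0) subrr addr0.
have far g h : ev g = 0 -> ev h = 0 -> ev (g * h - h * g) = 0.
  move=> g0 h0.
  apply: etrans (evB _ _ _ _ (evM _ _ _ _ g0 h0) (evM _ _ _ _ h0 g0)) _.
  by rewrite mul0r subrr.
case=> [i j|i|i|i j|i j|i j|i j _|i j _|i j _ _|i j _ _].
- apply: etrans (evB _ _ _ _ (evM _ _ _ _ (kE i) (kE j))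
    (evM _ _ _ _ (kE j) (kE i))) _.
  by rewrite subrr.
- apply: etrans (evB _ _ _ _ (evM _ _ _ _ (kE i) (k'E i)) oneE) _.
  by rewrite mulr1 subrr.
- apply: etrans (evB _ _ _ _ (evM _ _ _ _ (k'E i) (kE i)) oneE) _.
  by rewrite mulr1 subrr.
- apply: etrans (evB _ _ _ _ (far _ _ (eE i) (fE j)) (evZ _ _ _ (evZ _ _ _
    (evB _ _ _ _ (evX _ _ (kE i)) (evX _ _ (k'E i)))))) _.
  by rewrite subrr !mulr0 subrr.
- apply: etrans (evB _ _ _ _ (evM _ _ _ _ (kE i) (eE j))
    (evZ _ _ _ (evM _ _ _ _ (eE j) (kE i)))) _.
  by rewrite !(mul0r, mulr0) subrr.
- apply: etrans (evB _ _ _ _ (evM _ _ _ _ (kE i) (fE j))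
    (evZ _ _ _ (evM _ _ _ _ (fE j) (kE i)))) _.
  by rewrite !(mul0r, mulr0) subrr.
- exact: serre (eE i) (eE j).
- exact: serre (fE i) (fE j).
- exact: far (eE i) (eE j).
- exact: far (fE i) (fE j).
Qed.

Definition Uq := quot Uq_rel.
HB.instance Definition _ := GRing.Lmodule.on Uq.
HB.instance Definition _ := GRing.PzRing.on Uq.

Lemma Uq_neq0 : 1 != 0 :> Uq.
Proof.
exact: (quot_neq0 (@feval_zmod_morphism _ _ _)
  (@feval_monoid_morphism _ _ _) Uq_rel_aug).
Qed.

HB.instance Definition _ := GRing.PzSemiRing_isNonZero.Build Uq Uq_neq0.
HB.instance Definition _ := GRing.LSemiModule_isLSemiAlgebra.Build Qq Uq
  (@quot_scaleAl _ _ _).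
HB.instance Definition _ := GRing.Lalgebra_isAlgebra.Build Qq Uq
  (@quot_scaleAr _ _ _).

Definition Egen (i : 'I_n.-1) : Uq := quot_pi Uq_rel (e i).
Definition Fgen (i : 'I_n.-1) : Uq := quot_pi Uq_rel (f i).
Definition Kgen (i : 'I_n.-1) : Uq := quot_pi Uq_rel (k i).
Definition KVgen (i : 'I_n.-1) : Uq := quot_pi Uq_rel (k' i).

Definition natE (i : 'I_n.-1) : 'M[Qq]_n :=
  \matrix_(a < n, b < n) ((a == i :> nat) && (b == i.+1 :> nat))%:R.
Definition natF (i : 'I_n.-1) : 'M[Qq]_n :=
  \matrix_(a < n, b < n) ((a == i.+1 :> nat) && (b == i :> nat))%:R.
Definition natK (i : 'I_n.-1) : 'M[Qq]_n :=
  \matrix_(a < n, b < n)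
    if a != b then 0
    else if a == i :> nat then q else if a == i.+1 :> nat then q^-1 else 1.

End QuantizedEnvelopingAlgebra.

(* The structure maps below are determined by the values prescribed on the
   generators; bundling them with these values is how the Hopf structures, the
   natural representation and the pairing are referred to. *)

Record Uq_hopf (n : nat) := UqHopf {
  UqDelta : Uq n -> tens (Uq n) (Uq n);
  UqEps : {lrmorphism Uq n -> Qq | *%R};
  UqS : {linear Uq n -> Uq n};
  UqDelta_linear : linear UqDelta;
  UqDelta_morph : monoid_morphism UqDelta;
  UqS_one : UqS 1 = 1;
  UqS_mul : forall u v, UqS (u * v) = UqS v * UqS u;
  UqDelta_K : forall i, UqDelta (Kgen i) = tpair (Kgen i) (Kgen i);
  UqDelta_E : forall i,
    UqDelta (Egen i) = tpair (Egen i) 1 + tpair (Kgen i ^+ 2) (Egen i);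
  UqDelta_F : forall i,
    UqDelta (Fgen i) = tpair (Fgen i) (KVgen i ^+ 2) + tpair 1 (Fgen i);
  UqEps_K : forall i, UqEps (Kgen i) = 1;
  UqEps_E : forall i, UqEps (Egen i) = 0;
  UqEps_F : forall i, UqEps (Fgen i) = 0;
  UqS_K : forall i, UqS (Kgen i) = KVgen i;
  UqS_E : forall i, UqS (Egen i) = - (KVgen i ^+ 2 * Egen i);
  UqS_F : forall i, UqS (Fgen i) = - (Fgen i * Kgen i ^+ 2)
}.

Record OqSL_bialgebra (n : nat) := OqSLBialgebra {
  OqDelta : OqSL n -> tens (OqSL n) (OqSL n);
  OqEps : {lrmorphism OqSL n -> Qq | *%R};
  OqDelta_linear : linear OqDelta;
  OqDelta_morph : monoid_morphism OqDelta;
  OqDelta_x : forall i j,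
    OqDelta (xSL i j) = \sum_(k < n) tpair (xSL i k) (xSL k j);
  OqEps_x : forall i j, OqEps (xSL i j) = (i == j)%:R
}.

Record natural_rep (n : nat) := NaturalRep {
  rho : Uq n -> 'M[Qq]_n;
  rho_linear : linear rho;
  rho_morph : monoid_morphism rho;
  rho_E : forall i, rho (Egen i) = natE i;
  rho_F : forall i, rho (Fgen i) = natF i;
  rho_K : forall i, rho (Kgen i) = natK i
}.

Record hopf_pairing (n : nat) (HU : Uq_hopf n) (HO : OqSL_bialgebra n)
    (V : natural_rep n) := HopfPairing {
  pairing : OqSL n -> Uq n -> Qq^o;
  pairing_bilinear : bilinear_for *:%R *:%R pairing;
  pairing_x : forall i j u, pairing (xSL i j) u = rho V u i j;
  pairing_mull : forall f g u, pairing (f * g) u =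
    tens_lift (fun u1 u2 => pairing f u1 * pairing g u2 : Qq^o)
      (UqDelta HU u);
  pairing_mulr : forall f u v, pairing f (u * v) =
    tens_lift (fun f1 f2 => pairing f1 u * pairing f2 v : Qq^o)
      (OqDelta HO f);
  pairing_1l : forall u, pairing 1 u = UqEps HU u;
  pairing_1r : forall f, pairing f 1 = OqEps HO f
}.

Definition Lact n (HU : Uq_hopf n) (HO : OqSL_bialgebra n) (V : natural_rep n)
    (P : hopf_pairing HU HO V) (u : Uq n) (f : OqSL n) : OqSL n :=
  tens_lift (fun f1 f2 => pairing P f1 (UqS HU u) *: f2) (OqDelta HO f).

Section Levi.
Variables (n t : nat) (k : 'I_t -> nat).

Definition partial_sum (s : nat) : nat := (\sum_(r < t | r < s) k r)%N.

Definition block (s : 'I_t) : {set 'I_n} :=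
  [set i : 'I_n | (partial_sum s <= i < partial_sum s.+1)%N].

Lemma card_block (s : 'I_t) : (\sum_(r < t) k r = n)%N -> #|block s| = k s.
Proof.
move=> hk; have def_s1 : partial_sum s.+1 = (partial_sum s + k s)%N.
  rewrite /partial_sum (bigD1 s) //= addnC; congr addn.
  by apply: eq_bigl => r; rewrite ltnS ltn_neqAle andbC.
have le_s1n : (partial_sum s.+1 <= n)%N.
  rewrite -hk /partial_sum.
  by rewrite [leqRHS](bigID (fun r : 'I_t => r < s.+1)%N) leq_addr.
have lt_a (a : 'I_(k s)) : (partial_sum s + a < n)%N.
  by apply: leq_trans le_s1n; rewrite def_s1 ltn_add2l.
pose h a := Ordinal (lt_a a).
have h_inj : injective h by move=> a b [] /addnI /val_inj.
rewrite -[RHS]card_ord -(card_imset predT h_inj); apply: eq_card => i.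
rewrite inE def_s1; apply/andP/imsetP => [[le_i lt_i]|[a _ ->]] /=.
  have lt_d : (i - partial_sum s < k s)%N by rewrite ltn_subLR.
  by exists (Ordinal lt_d) => //; apply: val_inj; rewrite /= subnKC.
by rewrite leq_addr ltn_add2l.
Qed.

(* N_1, ..., N_(t-1) are the values partial_sum s for 0 < s < t, and
   i : 'I_n.-1 stands for the vertex i + 1. *)
Definition Theta : {set 'I_n.-1} :=
  [set i : 'I_n.-1 |
    ~~ [exists s : 'I_t, (0 < s)%N && (i.+1 == partial_sum s)]].

Inductive Uqk_gens : Uq n -> Prop :=
| Uqk_E i of i \in Theta : Uqk_gens (Egen i)
| Uqk_F i of i \in Theta : Uqk_gens (Fgen i)
| Uqk_K j : Uqk_gens (Kgen j)
| Uqk_KV j : Uqk_gens (KVgen j).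

Definition Uqk : Uq n -> Prop := gen_subalg Uqk_gens.

Definition OqKG (HU : Uq_hopf n) (HO : OqSL_bialgebra n) (V : natural_rep n)
    (P : hopf_pairing HU HO V) (f : OqSL n) : Prop :=
  forall u, Uqk u -> Lact P u f = UqEps HU u *: f.

(* These minors are killed by L_{E_i} and L_{F_i} for i \in Theta, but they are
   only semi-invariant under the torus: L_{K_j} multiplies T(det_q(I_s, J)) by
   q^-1 if j = N_s, by q if j = N_(s-1), and by 1 otherwise. *)
Definition block_minors (hk : (\sum_(r < t) k r = n)%N) (f : OqSL n) : Prop :=
  exists (s : 'I_t) (J : {set 'I_n}) (hJ : #|J| = k s),
    f = T (qminor (card_block s hk) hJ).

End Levi.

(* Main.v *)
(* Write V for the natural representation and x_(I,J) for the product of the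
   x_(i,j) along two words I, J of the same length m; the x_(I,J) span O_q(SL(n)),
   and u acts on the row index I through V^(tensor m). The span of the relations
   between the x_(I,J) is a subrepresentation. The usual scalar product on
   V^(tensor m) is positive, as Q(q) is formally real, and U_q is stable under
   transposition; hence the orthogonal of the relations is a subrepresentation
   too, and a Levi-invariant f lifts to a combination of Levi-invariant vectors.

   It remains to see that an invariant vector v of V^(tensor m) gives, for every J,
   a polynomial sum_I v_I x_(I,J) in the block minors (the first fundamental
   theorem). The vectors with this property are stable under the Hecke operators,
   by the relation R x1 x2 = x1 x2 R, and under tensoring with the q-wedge of a
   block. Assume that v is orthogonal to the invariant ones among them, and
   nonzero. By induction on m the contraction of h v with the wedge of any block is
   zero for every product h of Hecke operators. Clearing denominators and setting
   q = 1 gives a nonzero tensor killed by the matrix units e_ij with i <> j in a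
   common block, all of whose alternating contractions over a block vanish; a
   descending induction on the number of alternated letters, in the spirit of
   Capelli's identity, shows that such a tensor is zero. *)

Require Import Defs.
From HB Require Import structures.
From mathcomp Require Import all_boot all_order all_algebra.
From mathcomp Require Import boolp perm ring.
From mathcomp Require Import monalg.

Import GRing.Theory Num.Theory.
Local Open Scope ring_scope.

Set Implicit Arguments.
Unset Strict Implicit.
Unset Printing Implicit Defensive.

(** * Specialisation at q = 1, and positivity over Q(q) *)

(* x is regular at q = 1, with value a. *)
Definition spec1 (x : Qq) (a : rat) : Prop :=
  exists p d : {poly rat}, [/\ d.[1] != 0, x = tofrac p / tofrac d
    & a = p.[1] / d.[1]].

Lemma tofrac_neq0 (d : {poly rat}) : d.[1] != 0 -> tofrac d != 0 :> Qq.
Proof. by apply: contraNneq => /eqP; rewrite tofrac_eq0 => /eqP ->; rewrite horner0. Qed.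

Lemma spec1_poly (p : {poly rat}) : spec1 (tofrac p) p.[1].
Proof.
by exists p, 1; split; rewrite ?hornerC ?oner_eq0 ?rmorph1 ?divr1.
Qed.

Lemma spec1_0 : spec1 0 0.
Proof. by have := spec1_poly 0; rewrite horner0 rmorph0. Qed.

Lemma spec1_1 : spec1 1 1.
Proof. by have := spec1_poly 1; rewrite hornerC rmorph1. Qed.

Lemma spec1_q : spec1 q 1.
Proof. by have := spec1_poly 'X; rewrite hornerX. Qed.

Lemma spec1_qV : spec1 q^-1 1.
Proof.
by exists 1, 'X; split; rewrite ?hornerX ?hornerC ?oner_eq0 ?rmorph1 ?div1r ?invr1.
Qed.

Lemma spec1D x y a b : spec1 x a -> spec1 y b -> spec1 (x + y) (a + b).
Proof.
move=> [p [d [d0 -> ->]]] [r [e [e0 -> ->]]]; exists (p * e + r * d), (d * e).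
split; first by rewrite hornerM mulf_neq0.
- by rewrite addf_div ?tofrac_neq0 // !(rmorphD, rmorphM).
- by rewrite addf_div // !hornerE.
Qed.

Lemma spec1M x y a b : spec1 x a -> spec1 y b -> spec1 (x * y) (a * b).
Proof.
move=> [p [d [d0 -> ->]]] [r [e [e0 -> ->]]]; exists (p * r), (d * e).
split; first by rewrite hornerM mulf_neq0.
- by rewrite mulf_div !rmorphM.
- by rewrite mulf_div !hornerE.
Qed.

Lemma spec1N x a : spec1 x a -> spec1 (- x) (- a).
Proof.
move=> [p [d [d0 -> ->]]]; exists (- p), d.
by split; rewrite // ?rmorphN ?hornerN mulNr.
Qed.

Lemma spec1X x a m : spec1 x a -> spec1 (x ^+ m) (a ^+ m).
Proof.
move=> xa; elim: m => [|m IH]; first exact: spec1_1.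
by rewrite !exprS; apply: spec1M.
Qed.

Lemma spec1_nat m : spec1 m%:R m%:R.
Proof.
elim: m => [|m IH]; first exact: spec1_0.
by rewrite -!natr1; apply: spec1D IH spec1_1.
Qed.

Lemma spec1_sum (T : Type) (s : seq T) (P : pred T) (x : T -> Qq) (a : T -> rat) :
  (forall t, P t -> spec1 (x t) (a t)) ->
  spec1 (\sum_(t <- s | P t) x t) (\sum_(t <- s | P t) a t).
Proof.
move=> xa; apply: (big_ind2 spec1) => //; first exact: spec1_0.
by move=> x1 x2 y1 y2; apply: spec1D.
Qed.

Lemma spec1_inj x a b : spec1 x a -> spec1 x b -> a = b.
Proof.
move=> [p [d [d0 -> ->]]] [r [e [e0 eqx ->]]].
move/eqP: eqx; rewrite eqr_div ?tofrac_neq0 // -!rmorphM tofrac_eq => /eqP eqx.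
by apply/eqP; rewrite eqr_div // -!hornerM eqx.
Qed.

Lemma q_neq0 : q != 0.
Proof. by rewrite tofrac_eq0 polyX_eq0. Qed.

Lemma fracE (x : Qq) : exists2 d : {poly rat}, d != 0 &
  exists p : {poly rat}, tofrac d * x = tofrac p.
Proof.
elim/quotW: x => r; exists (frac r).2; first exact: denom_ratioP.
exists (frac r).1; unlock tofrac; rewrite -[LHS]FracField.pi_mul.
apply/eqmodP; rewrite /= FracField.equivfE /FracField.mulf /=.
rewrite !numden_Ratio ?oner_eq0 ?mulr1 ?mul1r ?denom_ratioP //.
Qed.

Lemma common_denominator (T : eqType) (s : seq T) (x : T -> Qq) :
  exists2 d : {poly rat}, d != 0 &
    exists p : T -> {poly rat}, forall t, t \in s -> tofrac d * x t = tofrac (p t).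
Proof.
elim: s => [|t s [d d0 [p IH]]]; first by exists 1; [rewrite oner_eq0|exists (fun=> 0)].
have [e e0 [r er]] := fracE (x t).
exists (d * e); first by rewrite mulf_neq0.
exists (fun u => if u == t then d * r else e * p u) => u.
rewrite inE; case: eqVneq => [->|_] /=; first by rewrite !rmorphM -mulrA er.
by move=> /IH du; rewrite rmorphM mulrAC du mulrC -rmorphM.
Qed.

(* Clear denominators, then divide by 'X - 1 as long as it divides all the
   entries. *)
Lemma spec1_scale (T : eqType) (s : seq T) (x : T -> Qq) (t0 : T) :
  t0 \in s -> x t0 != 0 ->
  exists (c : Qq) (a : T -> rat), [/\ c != 0,
    forall t, t \in s -> spec1 (c * x t) (a t) & exists2 t, t \in s & a t != 0].
Proof.
move=> st0 x0; have [d d0 [p dp]] := common_denominator s x.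
have {dp} : exists c : Qq, c != 0 /\ forall t, t \in s -> c * x t = tofrac (p t).
  by exists (tofrac d); rewrite tofrac_eq0.
(* Induction on a bound for the size of [p t0]: dividing by ['X - 1] lowers that size, and [p t0]
   stays nonzero because [x t0] is. *)
elim: {p}(size (p t0)) {-2}p (leqnn (size (p t0))) => [|m IH] p szp [c [c0 cp]].
  have p0 : p t0 = 0 by apply/eqP; rewrite -size_poly_leq0.
  have : c * x t0 = 0 by rewrite cp // p0 rmorph0.
  by move/eqP; rewrite mulf_eq0 (negbTE c0) (negbTE x0).
have [/allP p1|] := boolP (all (fun t => root (p t) 1) s); last first.
  move=> /allPn [t ts pt]; exists c, (fun t => (p t).[1]); split=> //.
    by move=> u us; rewrite cp //; apply: spec1_poly.
  by exists t.
pose p' t := p t %/ ('X - 1%:P).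
have p'E t : t \in s -> p t = p' t * ('X - 1%:P).
  by move=> /p1; rewrite -dvdp_XsubCl => /divpK.
have X1 : tofrac ('X - 1%:P) != 0 :> Qq by rewrite tofrac_eq0 polyXsubC_eq0.
have p'0 : p' t0 != 0.
  apply/eqP => pt0; move/eqP: (cp _ st0); rewrite p'E // pt0 mul0r rmorph0.
  by rewrite mulf_eq0 (negbTE c0) (negbTE x0).
apply: (IH p') => [|].
  by move: szp; rewrite p'E // size_Mmonic ?monicXsubC // size_XsubC addn2.
exists (c / tofrac ('X - 1%:P)); split.
  by apply: mulf_neq0; [exact: c0|apply: invr_neq0; exact: X1].
by move=> t ts; rewrite mulrAC cp // p'E // rmorphM; apply: mulfK; exact: X1.
Qed.

(** Were some entry nonzero, the family could be rescaled so as to be regular at q = 1 with a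
    nonzero value there; the sum of squares would then specialise to a positive rational. *)
Lemma sum_sq_eq0 (T : eqType) (s : seq T) (x : T -> Qq) :
  \sum_(t <- s) x t * x t = 0 -> forall t, t \in s -> x t = 0.
Proof.
move=> sum0 t0 st0; apply/eqP/negPn/negP => x0.
have [c [a [c0 ca [t ts at0]]]] := spec1_scale st0 x0.
have /(spec1_inj spec1_0) : spec1 0 (\sum_(t <- s) a t * a t).
  rewrite -(mulr0 (c * c)) -sum0 mulr_sumr big_seq [\sum_(t <- s) a t * _]big_seq.
  by apply: spec1_sum => u us; rewrite mulrACA; apply: spec1M; apply: ca.
rewrite big_seq (_ : \sum_(t <- s | _) _ = \sum_(t <- s) a t * a t); last first.
  by rewrite [RHS]big_seq.
move=> /esym /eqP; rewrite psumr_eq0 => [/allP /(_ t ts)|u _]; last exact: sqr_ge0.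
by rewrite implyTb mulf_eq0 orbb (negbTE at0).
Qed.

(** Orthogonal projection onto the subspace [Z], by induction on the list of coordinates: the
    vectors of [Z] that vanish at [t0] form a subspace [Z'] of codimension at most one, to which the
    induction hypothesis applies. *)
Lemma orthogonal_decomposition (F : fieldType) (T : eqType) (s : seq T)
    (Z : (T -> F) -> Prop) :
  (forall (s : seq T) (x : T -> F), \sum_(t <- s) x t * x t = 0 ->
     forall t, t \in s -> x t = 0) ->
  Z (fun=> 0) ->
  (forall a y z, Z y -> Z z -> Z (fun t => a * y t + z t)) ->
  forall x : T -> F, exists2 z, Z z &
    forall y, Z y -> \sum_(t <- s) (x t - z t) * y t = 0.
Proof.
move=> formally_real; elim: s Z => [|t0 s IH] Z Z0 ZD x.
  by exists (fun=> 0) => // y _; rewrite big_nil.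
pose Z' y := Z y /\ y t0 = 0.
have Z'0 : Z' (fun=> 0) by [].
have Z'D a y z : Z' y -> Z' z -> Z' (fun t => a * y t + z t).
  by move=> [Zy y0] [Zz z0]; split; [apply: ZD|rewrite y0 z0 mulr0 addr0].
have {IH} IH := IH Z' Z'0 Z'D.
have [[z1 Zz1 z10]|noz1] := pselect (exists2 z, Z z & z t0 != 0); last first.
  have [z [Zz z0] xz] := IH x; exists z => // y Zy.
  have y0 : y t0 = 0 by apply/eqP/negPn/negP => ny0; apply: noz1; exists y.
  by rewrite big_cons y0 mulr0 add0r xz.
have [z2 [Zz2 z20] z12] := IH z1.
(* [z] is [z1] minus its projection to [Z'], so [Z] is the orthogonal sum of [Z'] and the line of
   [z]. *)
pose z t := z1 t - z2 t.
have Zz : Z z.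
  suff -> : z = (fun t => -1 * z2 t + z1 t) by apply: ZD.
  by apply/funext => t; rewrite mulN1r addrC.
have zt0 : z t0 = z1 t0 by rewrite /z z20 subr0.
have zZ' y : Z' y -> \sum_(t <- t0 :: s) z t * y t = 0.
  by move=> Zy; rewrite big_cons Zy.2 mulr0 add0r z12.
have zz0 : \sum_(t <- t0 :: s) z t * z t != 0.
  apply: contraNneq z10 => /formally_real /(_ t0).
  by rewrite inE eqxx zt0 => ->.
have [z3 [Zz3 z30] xz3] := IH x.
pose a := (\sum_(t <- t0 :: s) (x t - z3 t) * z t) / \sum_(t <- t0 :: s) z t * z t.
exists (fun t => a * z t + z3 t) => [|y Zy]; first exact: ZD.
(* [b] is chosen so that [y - b z] vanishes at [t0], hence lies in [Z']. *)
pose b := y t0 / z t0.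
have Z'y : Z' (fun t => - b * z t + y t).
  split; first exact: ZD.
  by rewrite /b mulNr divfK ?zt0 // addNr.
have xZ' w : Z' w -> \sum_(t <- t0 :: s) (x t - (a * z t + z3 t)) * w t = 0.
  move=> Zw; rewrite (eq_bigr (fun t => (x t - z3 t) * w t - a * (z t * w t))).
    by rewrite sumrB -mulr_sumr zZ' // mulr0 subr0 big_cons Zw.2 mulr0 add0r xz3.
  by move=> t _; rewrite opprD addrCA addrC mulrDl mulNr mulrA.
rewrite (eq_bigr (fun t => (x t - (a * z t + z3 t)) * (- b * z t + y t)
   + b * ((x t - z3 t) * z t - a * (z t * z t)))); last first.
  by move=> t _; ring.
rewrite big_split /= xZ' // add0r -mulr_sumr sumrB -mulr_sumr.
by rewrite /a divfK // subrr mulr0.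
Qed.

(** * Words, the Hecke operators and antisymmetric functions *)

Section Words.
Variable n : nat.
Implicit Types (I J A B : seq 'I_n) (x y : 'I_n).

Fixpoint words m : seq (seq 'I_n) :=
  if m is m'.+1 then [seq x :: w | x <- enum 'I_n, w <- words m'] else [:: [::]].

Lemma mem_words m I : (I \in words m) = (size I == m).
Proof.
elim: m I => [|m IH] I; first by rewrite /= inE; case: I.
apply/allpairsP/idP => [[[y J] [/= _ + ->]]|]; first by rewrite IH.
by case: I => // x I szI; exists (x, I); rewrite mem_enum IH.
Qed.

Lemma words_uniq m : uniq (words m).
Proof.
elim: m => [|m IH] //; apply: allpairs_uniq => //; first exact: enum_uniq.
by move=> [x I] [y J] _ _ [-> ->].
Qed.

Lemma big_words_cons (M : nmodType) m (g : seq 'I_n -> M) :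
  \sum_(I <- words m.+1) g I = \sum_(x : 'I_n) \sum_(I <- words m) g (x :: I).
Proof. by rewrite big_allpairs_dep big_enum. Qed.

Lemma big_words_cat (M : nmodType) k m (g : seq 'I_n -> M) :
  \sum_(I <- words (k + m)) g I
  = \sum_(A <- words k) \sum_(B <- words m) g (A ++ B).
Proof.
elim: k g => [|k IH] g; first by rewrite big_seq1.
by rewrite !big_words_cons; apply: eq_bigr => x _; rewrite IH.
Qed.

Lemma big_words_delta (M : nmodType) m I (g : seq 'I_n -> M) : size I = m ->
  \sum_(J <- words m) (if I == J then g J else 0) = g I.
Proof.
move=> szI; have Im : I \in words m by rewrite mem_words szI.
rewrite (bigD1_seq I) ?words_uniq //= eqxx big1 ?addr0 // => J.
by rewrite eq_sym => /negbTE ->.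
Qed.

Lemma eq_big_words (M : nmodType) m (g h : seq 'I_n -> M) :
  (forall I, size I = m -> g I = h I) ->
  \sum_(I <- words m) g I = \sum_(I <- words m) h I.
Proof.
move=> gh; apply: eq_big_seq => I; rewrite mem_words => /eqP; exact: gh.
Qed.

Fixpoint inversions I : nat :=
  if I is x :: I' then (count (fun y => y < x)%N I' + inversions I')%N else 0%N.

Lemma inversions_swap A x y B : (x < y)%N ->
  inversions (A ++ y :: x :: B) = (inversions (A ++ x :: y :: B)).+1.
Proof.
move=> xy; elim: A => [|a A IH] /=.
  by rewrite xy ltnNge (ltnW xy) /= add0n add1n !addSn addnCA.
by rewrite IH addnS !count_cat /= (addnCA (y < a)%N).
Qed.

Lemma perm_swap_adjacent A x y B :
  perm_eq (A ++ y :: x :: B) (A ++ x :: y :: B).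
Proof. by rewrite perm_cat2l; apply/permPl/(perm_catCA [:: y] [:: x] B). Qed.

Definition ltI : rel 'I_n := fun x y => (x < y)%N.
Definition leI : rel 'I_n := fun x y => (x <= y)%N.

Lemma ltI_trans : transitive ltI. Proof. by move=> ? ? ?; apply: ltn_trans. Qed.
Lemma leI_trans : transitive leI. Proof. by move=> ? ? ?; apply: leq_trans. Qed.
Lemma leI_total : total leI. Proof. by move=> ? ?; apply: leq_total. Qed.
Lemma leI_anti : antisymmetric leI.
Proof. by move=> x y /anti_leq /val_inj. Qed.

Lemma ltI_sorted_leI I : sorted ltI I -> sorted leI I.
Proof. by apply: sub_sorted => x y /ltnW. Qed.

Lemma ltI_sorted_uniq I : sorted ltI I -> uniq I.
Proof. by apply: sorted_uniq; [apply: ltI_trans|move=> x; apply: ltnn]. Qed.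

Lemma inversions_sorted I : sorted ltI I -> inversions I = 0%N.
Proof.
elim: I => //= x I IH xI; rewrite IH ?(path_sorted xI) // addn0.
apply/eqP; rewrite -leqn0 leqNgt -has_count; apply/hasPn => y yI.
by rewrite -leqNgt ltnW //; apply: (allP (order_path_min ltI_trans xI)).
Qed.

Lemma sorted_or_descent I :
  sorted ltI I \/ exists A x y B, I = A ++ x :: y :: B /\ (y <= x)%N.
Proof.
elim: I => [|x [|y I] IH]; [by left|by left|].
case: IH => [sI|[A [a [b [B [-> ba]]]]]]; last by right; exists (x :: A), a, b, B.
case: (ltnP x y) => xy; last by right; exists [::], x, y, I.
by left; rewrite /= /ltI xy.
Qed.

(* Induction on the number of inversions (bubble sort). *)
Lemma word_ind (P : seq 'I_n -> Prop) :
  (forall I, sorted ltI I -> P I) ->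
  (forall A x B, P (A ++ x :: x :: B)) ->
  (forall A x y B, (x < y)%N -> P (A ++ x :: y :: B) -> P (A ++ y :: x :: B)) ->
  forall I, P I.
Proof.
move=> Psort Prep Pswap I.
elim: {I}_.+1 {-2}I (ltnSn (inversions I)) => // m IH I invI.
have [/Psort //|[A [x [y [B [eqI]]]]]] := sorted_or_descent I; subst I.
rewrite leq_eqVlt => /orP[/eqP /val_inj ->|yx] //.
by apply: Pswap => //; apply: IH; rewrite inversions_swap // ltnS in invI.
Qed.

(** * Hecke operators on functions of words *)

Section Hecke.
Variables (F : fieldType) (z : F).
Hypotheses (z0 : z != 0) (zV : z + z^-1 != 0).

(** Diagonal entries of the braid matrix T, normalised by (T - z)(T + z^-1) = 0: on the words xy and
    yx with x < y, the matrix has the rows (z - z^-1, 1) and (1, 0). *)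
Definition hecke_coef x y : F :=
  if x == y then z else if (x < y)%N then z - z^-1 else 0.

(* The Hecke generator acting on the letters p and p + 1 of a word; it is the
   identity on shorter words. *)
Fixpoint hecke (M : lmodType F) p (g : seq 'I_n -> M) I : M :=
  match p, I with
  | 0, x :: y :: B =>
      hecke_coef x y *: g (x :: y :: B) + (x != y)%:R *: g (y :: x :: B)
  | p'.+1, x :: B => hecke p' (fun B => g (x :: B)) B
  | _, _ => g I
  end.

Lemma eq_hecke (M : lmodType F) p (g h : seq 'I_n -> M) I :
  (forall J, size J = size I -> g J = h J) -> hecke p g I = hecke p h I.
Proof.
elim: p I g h => [|p IH] [|x I] g h gh /=; try exact: gh.
  by case: I gh => [|y B] gh; rewrite !gh.
by apply: IH => J szJ; apply: gh; rewrite /= szJ.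
Qed.

Lemma hecke_linear (M N : lmodType F) p (f : M -> N) (g : seq 'I_n -> M) I :
  linear f -> f (hecke p g I) = hecke p (fun J => f (g J)) I.
Proof.
move=> fP; elim: p I g => [|p IH] [|x I] g //=.
case: I => [|y I] //; rewrite fP; congr (_ + _).
by rewrite (scalable_linear fP).
Qed.

Lemma hecke_sum (M : lmodType F) (T : Type) (s : seq T) p (a : T -> F)
    (g : T -> seq 'I_n -> M) I :
  hecke p (fun J => \sum_(t <- s) a t *: g t J) I = \sum_(t <- s) a t *: hecke p (g t) I.
Proof.
elim: p I g => [|p IH] [|x I] g //=; case: I => [|y I] //.
rewrite !scaler_sumr -big_split; apply: eq_bigr => t _ /=.
by rewrite scalerDr !scalerA ![_ * a t]mulrC.
Qed.

Lemma hecke_cat (M : lmodType F) (g : seq 'I_n -> M) A x y B :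
  hecke (size A) g (A ++ x :: y :: B) =
  hecke_coef x y *: g (A ++ x :: y :: B) + (x != y)%:R *: g (A ++ y :: x :: B).
Proof. by elim: A g => //= a A IH g; rewrite IH. Qed.

(** The matrix of a Hecke generator is symmetric: off the diagonal it only exchanges two words, with
    coefficient 1 both ways. *)
Lemma hecke_adjoint (M : lmodType F) p m (v : seq 'I_n -> F^o) (g : seq 'I_n -> M) :
  \sum_(I <- words m) hecke p v I *: g I = \sum_(I <- words m) v I *: hecke p g I.
Proof.
elim: p m v g => [|p IH] [|m] v g; try by rewrite !big_seq1.
  case: m => [|m]; first by apply: eq_big_words => -[|x []].
  rewrite !big_words_cons.
  pose G x y := \sum_(I <- words m) v (x :: y :: I) *: g (x :: y :: I).
  pose H x y := \sum_(I <- words m) v (x :: y :: I) *: g (y :: x :: I).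
  transitivity (\sum_x \sum_y (hecke_coef x y *: G x y + (x != y)%:R *: H y x)).
    apply: eq_bigr => x _; rewrite big_words_cons; apply: eq_bigr => y _.
    rewrite !scaler_sumr -big_split; apply: eq_bigr => I _ /=.
    by rewrite scalerDl !scalerA.
  transitivity (\sum_x \sum_y (hecke_coef x y *: G x y + (x != y)%:R *: H x y)).
    rewrite (eq_bigr (fun x => \sum_y hecke_coef x y *: G x y
      + \sum_y (x != y)%:R *: H y x)) => [|x _]; last by rewrite big_split.
    rewrite [RHS](eq_bigr (fun x => \sum_y hecke_coef x y *: G x y
      + \sum_y (x != y)%:R *: H x y)) => [|x _]; last by rewrite big_split.
    rewrite !big_split; congr (_ + _); rewrite exchange_big.
    by apply: eq_bigr => x _; apply: eq_bigr => y _; rewrite eq_sym.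
  apply: eq_bigr => x _; rewrite big_words_cons; apply: eq_bigr => y _.
  rewrite !scaler_sumr -big_split; apply: eq_bigr => I _ /=.
  by rewrite scalerDr !scalerA ![v _ * _]mulrC.
by rewrite !big_words_cons; apply: eq_bigr => x _; apply: IH.
Qed.

(** * q-antisymmetric functions of words *)

Section Antisymmetric.
Variables (M : lmodType F) (k : nat) (g : seq 'I_n -> M).
Hypothesis g_anti :
  forall p I, size I = k -> (p.+1 < k)%N -> hecke p g I = - z^-1 *: g I.

Lemma antisym_cat A x y B : size (A ++ x :: y :: B) = k ->
  hecke_coef x y *: g (A ++ x :: y :: B) + (x != y)%:R *: g (A ++ y :: x :: B)
  = - z^-1 *: g (A ++ x :: y :: B).
Proof.
move=> szI; rewrite -hecke_cat g_anti // -szI size_cat /= !addnS.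
by rewrite !ltnS leq_addr.
Qed.

(** On a doubled letter the Hecke generator multiplies by z, which differs from -z^-1 by [zV]. *)
Lemma antisym_repeat A x B : size (A ++ x :: x :: B) = k -> g (A ++ x :: x :: B) = 0.
Proof.
move=> /antisym_cat; rewrite /hecke_coef eqxx scale0r addr0 => /eqP.
rewrite -subr_eq0 -scalerBl opprK scaler_eq0 (negbTE zV).
by move/eqP.
Qed.

Lemma antisym_swap A x y B : size (A ++ x :: y :: B) = k -> (x < y)%N ->
  g (A ++ y :: x :: B) = - z *: g (A ++ x :: y :: B).
Proof.
move=> /antisym_cat + xy; rewrite /hecke_coef -val_eqE (ltn_eqF xy) xy /= scale1r.
move=> /(canRL (addKr _)) ->; rewrite -scaleNr -scalerDl; congr (_ *: _).
by rewrite opprB addrAC subrr add0r.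
Qed.

Lemma antisym_eq0 I : size I = k -> ~~ uniq I -> g I = 0.
Proof.
elim/word_ind: I => [I /ltI_sorted_uniq ->|A x B szI _|A x y B xy IH szI nuI] //.
  exact: antisym_repeat.
have pe := perm_swap_adjacent A x y B.
have szI' : size (A ++ x :: y :: B) = k by rewrite -(perm_size pe).
by rewrite antisym_swap // IH ?scaler0 // -(perm_uniq pe).
Qed.

(** Bubble sort: by [antisym_swap], each exchange that removes an inversion costs a factor -z. A
    q-antisymmetric function is thus determined by its values on increasing words. *)
Lemma antisym_sort I : size I = k -> uniq I ->
  g I = (- z) ^+ inversions I *: g (sort leI I).
Proof.
elim/word_ind: I => [I sI _ _|A x B|A x y B xy IH szI uI].
- rewrite inversions_sorted // scale1r sorted_sort //; first exact: leI_trans.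
  exact: ltI_sorted_leI.
- by move=> _; rewrite cat_uniq /= inE eqxx /= !andbF.
have pe := perm_swap_adjacent A x y B.
have szI' : size (A ++ x :: y :: B) = k by rewrite -(perm_size pe).
rewrite antisym_swap // IH // -?(perm_uniq pe) //.
have -> : sort leI (A ++ y :: x :: B) = sort leI (A ++ x :: y :: B).
  by apply/perm_sortP => //; [exact: leI_total|exact: leI_trans|exact: leI_anti].
by rewrite (inversions_swap _ _ xy) exprS scalerA.
Qed.

End Antisymmetric.

(** The coefficients of the q-exterior product of the letters of an increasing word [b]; for z = q^2
    they are the coefficients of a quantum minor. *)
Definition wedge b I : F := if perm_eq I b then (- z) ^+ inversions I else 0.

Lemma wedge_anti b : uniq b -> forall p I, size I = size b -> (p.+1 < size b)%N ->
  hecke p (wedge b : _ -> F^o) I = - z^-1 *: (wedge b I : F^o).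
Proof.
move=> ub p I szI pb.
have [A [x [y [B [szA eqI]]]]] : exists A x y B, size A = p /\ I = A ++ x :: y :: B.
  rewrite -szI in pb; have sz1 : (1 < size (drop p I))%N by rewrite size_drop ltn_subRL addn1.
  exists (take p I); move: sz1 (cat_take_drop p I).
  case: (drop p I) => [|x [|y B]] // _ eqI.
  by exists x, y, B; rewrite size_takel // ltnW // ltnW.
subst p I; rewrite hecke_cat /wedge.
have pe := perm_swap_adjacent A x y B.
rewrite (permPl pe); case: ifP => pb'; last by rewrite !scaler0 addr0.
have : uniq (A ++ x :: y :: B) by rewrite (perm_uniq pb').
move=> uI; have xy : x != y.
  by apply: contraTneq uI => ->; rewrite cat_uniq /= inE eqxx /= !andbF.
rewrite -val_eqE in xy; case: (ltngtP x y) xy => // xy _.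
  rewrite (inversions_swap _ _ xy) /hecke_coef -val_eqE /= ltn_eqF // xy /= scale1r exprS.
  by rewrite /GRing.scale /=; field.
rewrite (inversions_swap _ _ xy) /hecke_coef -val_eqE /= gtn_eqF // ltnNge ltnW //=.
by rewrite scale0r scale1r add0r exprS /GRing.scale /=; field.
Qed.

End Hecke.
End Words.

(** * The classical descent *)

Section Classical.
Variables (n : nat) (R : numDomainType).
Implicit Types (I J K : seq 'I_n) (v : seq 'I_n -> R) (b c x y : 'I_n).

(* The matrix unit e_{bc} acting as a derivation: the sum of the values of v on
   the words obtained from I by replacing one occurrence of c by b. *)
Fixpoint polarize b c v I : R :=
  if I is x :: I' then
    (x == c)%:R * v (b :: I') + polarize b c (fun J => v (x :: J)) I'
  else 0.

Lemma eq_polarize b c v v' I :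
  (forall J, size J = size I -> v J = v' J) -> polarize b c v I = polarize b c v' I.
Proof.
elim: I v v' => //= x I IH v v' vv'; rewrite vv' //; congr (_ + _).
by apply: IH => J szJ; rewrite vv' //= szJ.
Qed.

Lemma polarize_sum (T : Type) (s : seq T) (P : pred T) (a : T -> R)
    (v : T -> seq 'I_n -> R) b c I :
  polarize b c (fun J => \sum_(t <- s | P t) a t * v t J) I
  = \sum_(t <- s | P t) a t * polarize b c (v t) I.
Proof.
elim: I v => [|x I IH] v /=; first by rewrite big1 // => t _; rewrite mulr0.
rewrite IH mulr_sumr -big_split; apply: eq_bigr => t _ /=.
by rewrite mulrDr mulrCA.
Qed.

Lemma polarizeD b c v v' I :
  polarize b c (fun J => v J + v' J) I = polarize b c v I + polarize b c v' I.
Proof.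
elim: I v v' => [|x I IH] v v' /=; first by rewrite addr0.
by rewrite IH mulrDr addrACA.
Qed.

Lemma polarizeZ b c a v I :
  polarize b c (fun J => a * v J) I = a * polarize b c v I.
Proof.
elim: I v => [|x I IH] v /=; first by rewrite mulr0.
by rewrite IH mulrDr mulrCA.
Qed.

Lemma polarize0 b c I : polarize b c (fun=> 0) I = 0.
Proof. by elim: I => //= x I ->; rewrite mulr0 addr0. Qed.

(** The commutation relation of matrix units; it serves to pass from neighbouring indices to any two
    indices of a block. *)
Lemma polarize_commutator a b c v I : a != c ->
  polarize b c (polarize a b v) I
  = polarize a b (polarize b c v) I + polarize a c v I.
Proof.
move=> ac; elim: I v => [|x I IH] v /=; first by rewrite addr0.
rewrite !polarizeD !polarizeZ IH eqxx (negbTE ac).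
by rewrite mulr1n mulr0n; ring.
Qed.

Lemma polarize_cat b c v I K : c \notin I ->
  polarize b c v (I ++ K) = polarize b c (fun K' => v (I ++ K')) K.
Proof.
elim: I v => //= x I IH v; rewrite inE negb_or => /andP[cx cI].
by rewrite eq_sym (negbTE cx) mul0r add0r IH.
Qed.

Fixpoint swap p I : seq 'I_n :=
  match p, I with
  | 0, x :: y :: J => y :: x :: J
  | p'.+1, x :: J => x :: swap p' J
  | _, _ => I
  end.

Lemma swap_cat I x y J : swap (size I) (I ++ x :: y :: J) = I ++ y :: x :: J.
Proof. by elim: I => //= a I ->. Qed.

(** The classical counterpart, at q = 1, of contracting the first [r] letters with the wedge of the
    letters [b]. *)
Definition alternate r (b : 'I_r -> 'I_n) v K : R :=
  \sum_(s : 'S_r) (-1) ^+ s * v ([seq b (s a) | a <- enum 'I_r] ++ K).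

Lemma alternate0 (b : 'I_0 -> 'I_n) v K : alternate b v K = v K.
Proof.
rewrite /alternate (bigD1 (1%g : 'S_0)) //= big1 => [|s /negP[]]; last first.
  by apply/eqP/permP => -[].
by rewrite odd_perm1 mul1r addr0 enum_ord0.
Qed.

Lemma alternate_perm r (b : 'I_r -> 'I_n) (t : 'S_r) v K :
  alternate (fun a => b (t a)) v K = (-1) ^+ t * alternate b v K.
Proof.
rewrite /alternate mulr_sumr [RHS](reindex_inj (mulIg t)) /=.
apply: eq_bigr => s _; rewrite mulrA -signr_addb odd_permM addbCA addbb addbF.
by congr (_ * v (_ ++ _)); apply: eq_map => a; rewrite permM.
Qed.

Lemma big_perm_fix_max (M : nmodType) r (g : 'S_r.+1 -> M) :
  \sum_(s : 'S_r.+1 | s ord_max == ord_max) g s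
  = \sum_(t : 'S_r) g (lift_perm ord_max ord_max t).
Proof.
pose h := lift ord_max : 'I_r -> 'I_r.+1.
have hK (s : 'S_r.+1) : s ord_max = ord_max ->
    exists t : 'S_r, s = lift_perm ord_max ord_max t.
  move=> smax; have sh k : exists l, s (h k) = h l.
    have : ord_max != s (h k) by rewrite -{1}smax (inj_eq perm_inj) neq_lift.
    by case/unlift_some => l -> _; exists l.
  (* By [sh], the image of [h k] avoids [ord_max], so [unlift] succeeds and the default [k] is never
     taken. *)
  have t_inj : injective (fun k => odflt k (unlift ord_max (s (h k)))).
    move=> k1 k2; have [l1 e1] := sh k1; have [l2 e2] := sh k2.
    rewrite e1 e2 !liftK /= => l12.
    by apply: (@lift_inj _ ord_max); apply: (@perm_inj _ s); rewrite -!/(h _) e1 e2 l12.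
  exists (perm t_inj); apply/permP => k.
  case: (unliftP ord_max k) => [k'|] ->; last by rewrite smax lift_perm_id.
  rewrite lift_perm_lift permE /=; have [l] := sh k'.
  by rewrite /h => ->; rewrite liftK.
have f_inj : injective (lift_perm ord_max ord_max : 'S_r -> 'S_r.+1).
  move=> t1 t2 e; apply/permP => a; apply: (@lift_inj _ ord_max).
  by rewrite -!(lift_perm_lift ord_max) e.
have -> : \sum_(s : 'S_r.+1 | s ord_max == ord_max) g s =
    \sum_(s in [set lift_perm ord_max ord_max t | t : 'S_r]) g s.
  apply: eq_bigl => s; apply/eqP/imsetP => [/hK[t ->]|[t _ ->]]; first by exists t.
  exact: lift_perm_id.
by rewrite big_imset //= => t1 t2 _ _; apply: f_inj.
Qed.

Lemma widen_lift_max r (a : 'I_r) : widen_ord (leqnSn r) a = lift ord_max a.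
Proof. by apply: val_inj; rewrite /= /bump leqNgt ltn_ord. Qed.

(** Laplace expansion along the last alternated letter: [j] is the value of the permutation at
    [ord_max], and the transposition that moves [j] to the end gives the sign -1 unless [j] is
    already there. *)
Lemma alternateS r (b : 'I_r.+1 -> 'I_n) v K :
  alternate b v K = \sum_(j < r.+1) (-1) ^+ (j != ord_max) *
    alternate (fun a => b (tperm j ord_max (lift ord_max a))) v (b j :: K).
Proof.
rewrite {1}/alternate (partition_big (fun s : 'S_r.+1 => s ord_max) predT) //=.
apply: eq_bigr => j _; rewrite /alternate mulr_sumr.
(* Multiplying by the transposition turns the permutations sending [ord_max] to [j] into those
   fixing [ord_max]. *)
rewrite (reindex_inj (mulIg (tperm j ord_max))) /=.
rewrite (eq_bigl (fun s : 'S_r.+1 => s ord_max == ord_max)); last first.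
  by move=> s; rewrite permM -{2}(tpermR j ord_max) (inj_eq perm_inj).
rewrite big_perm_fix_max; apply: eq_bigr => t _; rewrite mulrA -signr_addb.
rewrite odd_permM odd_tperm odd_lift_perm addbb addFb addbC.
congr (_ * v _); rewrite enum_ordSr map_rcons permM lift_perm_id tpermR cat_rcons.
congr (_ ++ _); rewrite -map_comp; apply: eq_map => a /=.
by rewrite permM widen_lift_max lift_perm_lift.
Qed.

Section Descent.
Variables (m : nat) (G : (seq 'I_n -> R) -> Prop).
Hypothesis G_swap : forall v p, G v -> G (fun I => v (swap p I)).

(** A succession of adjacent swaps carries a letter past [k] others. Swaps act by position, hence
    the fixed lengths of [A] and [K1]. *)
Lemma G_move k a v : G v -> exists2 v', G v' &
  forall A x K1 K2, size A = a -> size K1 = k ->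
    v' (A ++ x :: K1 ++ K2) = v (A ++ K1 ++ x :: K2).
Proof.
elim: k a v => [|k IH] a v Gv; first by exists v => // A x [].
have [v1 Gv1 v1E] := IH a.+1 v Gv.
exists (fun I => v1 (swap a I)) => [|A x [|y K1] K2 szA // [szK]]; first exact: G_swap.
rewrite -szA /= swap_cat -cat_rcons v1E ?size_rcons ?szA //.
by rewrite cat_rcons.
Qed.

(* Sum, over the occurrences of b ord_max in K, the expansion of the alternating sum
   of order r + 1 along the letter standing there. The term of a letter b j other
   than b ord_max is a polarization, which the invariance of v turns into the
   alternating sum of order r. *)
Lemma alternate_step r (b : 'I_r.+1 -> 'I_n) : injective b ->
  (forall v i j K, G v -> size K = m -> i != j -> polarize (b i) (b j) v K = 0) ->
  (forall v K, G v -> (r.+1 + size K)%N = m -> alternate b v K = 0) ->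
  forall v K, G v -> (r + size K)%N = m ->
    (count_mem (b ord_max) K + r)%:R * alternate (b \o lift ord_max) v K = 0.
Proof.
move=> b_inj polb altb v K Gv szK; set c := b ord_max; set b' := b \o lift _.
(* The letters that remain alternated after expanding along [b' j]: there [c] takes the place of
   [b' j]. *)
pose bj (j : 'I_r) a := if a == j then c else b' a.
have bjE (j a : 'I_r) : b (tperm (lift ord_max j) ord_max (lift ord_max a)) = bj j a.
  rewrite /bj; case: eqVneq => [->|aj]; first by rewrite tpermL.
  by rewrite tpermD ?neq_lift // (inj_eq lift_inj) eq_sym.
(* The vanishing of the alternating sum of order r + 1, expanded. The expansion puts the
   distinguished letter right after the alternated ones, and [G_move] brings it to its place inside
   the word. *)
have altE K1 K2 : (r + size (K1 ++ c :: K2))%N = m ->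
    alternate b' v (K1 ++ c :: K2)
    = \sum_(j < r) alternate (bj j) v (K1 ++ b' j :: K2).
  move=> szK12; have [v' Gv' v'E] := G_move (size K1) r Gv.
  have altv' q (d : 'I_q -> 'I_n) x : q = r ->
      alternate d v' (x :: K1 ++ K2) = alternate d v (K1 ++ x :: K2).
    move=> qr; apply: eq_bigr => s _; rewrite v'E //.
    by rewrite size_map size_enum_ord.
  have := altb v' (K1 ++ K2) Gv'; rewrite alternateS big_ord_recr /= eqxx mul1r.
  rewrite altv' //.
  have -> : alternate (fun a => b (tperm ord_max ord_max (lift ord_max a))) v
      (K1 ++ c :: K2) = alternate b' v (K1 ++ c :: K2).
    apply: eq_bigr => s _; congr (_ * v (_ ++ _)); apply: eq_map => a.
    by rewrite tperm1 perm1.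
  move=> e; apply/eqP; rewrite -subr_eq0 addrC -sumrN -[X in _ == X]e; last first.
    by move: szK12; rewrite !size_cat /= !addnS addSn.
  apply/eqP; congr (_ + _); apply: eq_bigr => j _.
  rewrite widen_lift_max.
  rewrite eq_sym neq_lift mulN1r altv' //; congr (- _).
  by apply: eq_bigr => s _; congr (_ * v (_ ++ _)); apply: eq_map => a; rewrite bjE.
(* [altE] summed over the occurrences of [c] in [K2]; [K1] accumulates the letters already
   passed. *)
have countE K1 K2 : (r + size (K1 ++ K2))%N = m ->
    (count_mem c K2)%:R * alternate b' v (K1 ++ K2) =
    \sum_(j < r) polarize (b' j) c (fun K' => alternate (bj j) v (K1 ++ K')) K2.
  elim: K2 K1 => [|x K2 IH] K1 szK12.
    by rewrite mul0r big1.
  rewrite /= natrD mulrDl big_split /= -cat_rcons IH ?cat_rcons //.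
  congr (_ + _); last first.
    apply: eq_bigr => j _; apply: eq_polarize => J _.
    by rewrite cat_rcons.
  rewrite -mulr_sumr; case: eqVneq => [xc|]; last by rewrite !mul0r.
  by rewrite xc altE // -xc.
rewrite natrD mulrDl -[K in alternate _ _ K]cat0s countE //.
have -> : r%:R * alternate b' v K = \sum_(j < r) alternate b' v K.
  by rewrite sumr_const card_ord mulr_natl.
rewrite -big_split big1 //= => j _.
rewrite /alternate polarize_sum -big_split big1 //= => s _.
rewrite -mulrDr; apply/eqP; rewrite mulf_eq0; apply/orP; right; apply/eqP.
(* [a] is the only alternated position where [bj j] puts [c]. Polarizing the whole word from [c] to
   [b' j] either restores the word of [b'] at that position or polarizes [K]; the invariance of [v]
   makes these contributions cancel. *)
pose a := (s^-1)%g j.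
have [E1 [E2 defE]] : exists E1 E2, enum 'I_r = E1 ++ a :: E2.
  have : a \in enum 'I_r by rewrite mem_enum.
  by case/splitPr => E1 E2; exists E1, E2.
have sa : s a = j by rewrite permKV.
have aE : (a \notin E1) && (a \notin E2).
  have := enum_uniq 'I_r; rewrite defE cat_uniq /= has_sym /= negb_or.
  by case/and4P => _ /andP[-> _] ->.
case/andP: aE => aE1 aE2.
have sE (E : seq 'I_r) : a \notin E -> [seq bj j (s i) | i <- E] = [seq b' (s i) | i <- E].
  move=> aE; apply/eq_in_map => i iE; rewrite /bj -sa (inj_eq perm_inj).
  by case: eqVneq => // ia; rewrite -ia iE in aE.
have cE (E : seq 'I_r) : c \notin [seq b' (s i) | i <- E].
  apply/mapP => -[i _ /b_inj /eqP]; apply/negP; exact: neq_lift.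
rewrite addrC defE !map_cat /= !sE // sa -!catA.
have := polb v (lift ord_max j) ord_max
  ([seq b' (s i) | i <- E1] ++ c :: [seq b' (s i) | i <- E2] ++ K) Gv.
rewrite polarize_cat //= eqxx mul1r polarize_cat // => polb'.
rewrite -[RHS]polb' ?[_ == ord_max]eq_sym ?neq_lift //.
  by congr (_ + _); apply: eq_polarize => J _; rewrite /bj eqxx -catA.
have szE : (size E1 + size E2).+1 = r.
  by rewrite -[RHS](size_enum_ord r) defE size_cat addnS.
by rewrite -szK -[X in (X + _)%N]szE !size_cat /= !size_cat !size_map !addnS addSn addnA.
Qed.

End Descent.

(** Each step drops the last letter of [b], the coefficient in [alternate_step] being positive. When
    only [b ord0] is left, that coefficient is its number of occurrences in [K]. *)
Theorem alternate_descent m (G : (seq 'I_n -> R) -> Prop) r (b : 'I_r.+1 -> 'I_n) :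
  (forall v p, G v -> G (fun I => v (swap p I))) ->
  injective b ->
  (forall v i j K, G v -> size K = m -> i != j -> polarize (b i) (b j) v K = 0) ->
  (forall v K, G v -> (r.+1 + size K)%N = m -> alternate b v K = 0) ->
  forall v K, G v -> size K = m -> b ord0 \in K -> v K = 0.
Proof.
move=> Gswap; elim: r b => [|r IH] b b_inj polb altb v K Gv szK bK.
  have := alternate_step Gswap b_inj polb altb Gv (szK : (0 + size K)%N = m).
  rewrite addn0 alternate0 => /eqP; rewrite mulf_eq0 pnatr_eq0 => /orP[|/eqP //].
  by rewrite -leqn0 leqNgt -has_count has_pred1 (_ : ord_max = ord0) ?bK //; apply: val_inj.
apply: (IH (b \o lift ord_max)) Gv szK _ => //=.
- exact: inj_comp b_inj lift_inj.
- by move=> w i j I Gw szI ij; apply: polb => //; rewrite (inj_eq lift_inj).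
- move=> w I Gw szI; have := alternate_step Gswap b_inj polb altb Gw szI.
  by move/eqP; rewrite mulf_eq0 pnatr_eq0 addnS => /eqP.
- by rewrite (_ : lift ord_max ord0 = ord0) //; apply: val_inj.
Qed.

(** The letter surviving the descent is [b ord0]; a transposition brings any chosen letter there and
    changes the alternating sums only by a sign. *)
Corollary alternate_descent_letter m (G : (seq 'I_n -> R) -> Prop) r (b : 'I_r -> 'I_n) :
  (forall v p, G v -> G (fun I => v (swap p I))) ->
  injective b ->
  (forall v i j K, G v -> size K = m -> i != j -> polarize (b i) (b j) v K = 0) ->
  (forall v K, G v -> (r + size K)%N = m -> alternate b v K = 0) ->
  forall v K j, G v -> size K = m -> b j \in K -> v K = 0.
Proof.
case: r b => [|r] b Gswap b_inj polb altb v K j; first by case: j.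
move=> Gv szK bK; pose b' a := b (tperm ord0 j a).
apply: (alternate_descent (b := b') Gswap) Gv szK _; rewrite /b' ?tpermL //.
- exact: inj_comp b_inj perm_inj.
- by move=> w i1 i2 I Gw szI ij; apply: polb => //; rewrite (inj_eq perm_inj).
- by move=> w I Gw szI; rewrite alternate_perm altb // mulr0.
Qed.

End Classical.

(** * Permutations as words *)

Section PermutedWords.
Variables (n k : nat) (b : 'I_k -> 'I_n).
Hypothesis b_incr : forall i j : 'I_k, (i < j)%N -> (b i < b j)%N.

Definition perm_word (s : 'S_k) : seq 'I_n := [seq b (s a) | a <- enum 'I_k].

Lemma incr_ltn (i j : 'I_k) : (b i < b j)%N = (i < j)%N.
Proof.
case: (ltngtP i j) => [/b_incr //|/b_incr/ltnW|/val_inj ->]; last by rewrite ltnn.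
by rewrite leqNgt => /negbTE.
Qed.

Lemma incr_inj : injective b.
Proof.
move=> i j bij; apply: val_inj; case: (ltngtP i j) => // /b_incr;
by rewrite bij ltnn.
Qed.

Lemma size_perm_word s : size (perm_word s) = k.
Proof. by rewrite size_map size_enum_ord. Qed.

Lemma perm_word1 : perm_word 1%g = [seq b a | a <- enum 'I_k].
Proof. by apply: eq_map => a; rewrite perm1. Qed.

Lemma enum_ord_sorted m : sorted (@ltI m) (enum 'I_m).
Proof.
by have := iota_ltn_sorted 0 m; rewrite -val_enum_ord sorted_map.
Qed.

Lemma perm_word_inj : injective perm_word.
Proof.
move=> s t /eq_in_map st; apply/permP => a.
by apply: incr_inj; apply: st; rewrite mem_enum.
Qed.

Lemma perm_eq_perm_word A :
  reflect (exists s, A = perm_word s) (perm_eq A (perm_word 1%g)).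
Proof.
have -> : perm_word 1%g = [tuple b i | i < k] by rewrite perm_word1.
apply: (iffP tuple_permP) => -[s ->]; exists s.
  by rewrite /perm_word /=; apply: eq_map => i; rewrite tnth_mktuple.
by rewrite /perm_word /=; apply: eq_map => i; rewrite tnth_mktuple.
Qed.

Lemma big_perm_word (M : nmodType) (h : seq 'I_n -> M) :
  \sum_(A <- words n k | perm_eq A (perm_word 1%g)) h A
  = \sum_(s : 'S_k) h (perm_word s).
Proof.
rewrite -big_filter -[RHS]big_enum -(big_map perm_word predT h).
apply: perm_big; apply: uniq_perm.
- exact: filter_uniq (words_uniq _ _).
- by rewrite map_inj_uniq ?enum_uniq //; apply: perm_word_inj.
move=> A; rewrite mem_filter mem_words; apply/andP/mapP => [[/perm_eq_perm_word[s ->] _]|].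
  by exists s; rewrite ?mem_enum.
by move=> [s _ ->]; rewrite size_perm_word; split => //; apply/perm_eq_perm_word; exists s.
Qed.

Lemma inversions_map (l : seq 'I_k) (s : 'I_k -> 'I_n) : sorted (@ltI k) l ->
  inversions (map s l)
  = (\sum_(i <- l) \sum_(j <- l) ((i < j)%N && (s j < s i)%N))%N.
Proof.
elim: l => [|x l IH] /= xl; first by rewrite big_nil.
have sl := path_sorted xl; have /allP xall := order_path_min (@ltI_trans k) xl.
rewrite IH // big_cons big_cons ltnn /=. rewrite add0n count_map -sum1_count; congr addn.
  rewrite [RHS]big_seq [LHS]big_seq_cond; rewrite [RHS](bigID (fun j => s j < s x)%N) /=.
  rewrite [X in (_ + X)%N]big1 ?addn0; last by move=> j /andP[_ /negbTE ->]; rewrite andbF.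
  by apply: eq_bigr => j /andP[/xall + ->]; rewrite andbT /ltI => ->.
rewrite [LHS]big_seq [RHS]big_seq; apply: eq_bigr => i il.
by rewrite big_cons ltnNge (ltnW (xall _ il)) /= add0n.
Qed.

Lemma inversions_perm_word s : inversions (perm_word s) = perm_length s.
Proof.
rewrite inversions_map ?enum_ord_sorted // big_enum /perm_length.
under eq_bigr do rewrite big_enum.
rewrite pair_big /= -sum1_card [RHS]big_mkcond /=; apply: eq_bigr => -[i j] _ /=.
by rewrite inE /= incr_ltn; case: ifP.
Qed.

Lemma wedge_sum (F : fieldType) (z : F) (M : lmodType F) (g : seq 'I_n -> M) :
  \sum_(A <- words n k) wedge z (perm_word 1%g) A *: g A
  = \sum_(s : 'S_k) (- z) ^+ perm_length s *: g (perm_word s).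
Proof.
rewrite -(eq_bigr _ (fun s _ => congr1 (fun l => (- z) ^+ l *: g _) (inversions_perm_word s))).
rewrite -(big_perm_word (fun A => (- z) ^+ inversions A *: g A)) [RHS]big_mkcond.
by apply: eq_bigr => A _; rewrite /wedge; case: ifP; rewrite ?scale0r.
Qed.

End PermutedWords.

Lemma sorted_perm1 k (s : 'S_k) : sorted (@ltI k) [seq s a | a <- enum 'I_k] -> s = 1%g.
Proof.
move=> ss; suff e : [seq s a | a <- enum 'I_k] = enum 'I_k.
  apply/permP => a; rewrite perm1; move: e; rewrite -{2}(map_id (enum 'I_k)).
  by move/eq_in_map; apply; rewrite mem_enum.
apply: (irr_sorted_eq (@ltI_trans k)) ss (enum_ord_sorted k) _.
  by move=> x; rewrite /ltI ltnn.
move=> x; rewrite mem_enum; apply/mapP; exists (s^-1 x)%g; rewrite ?mem_enum ?permKV //.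
Qed.

(** Bubble sort again, on all words of permutations: exchanging the neighbouring letters x and y in
    the word of a permutation composes it with the transposition of x and y. *)
Lemma sign_inversions k (s : 'S_k) (R : pzRingType) :
  (-1) ^+ inversions [seq s a | a <- enum 'I_k] = (-1) ^+ s :> R.
Proof.
suff signI I (t : 'S_k) : I = [seq t a | a <- enum 'I_k] ->
  (-1) ^+ inversions I = (-1) ^+ t :> R by apply: signI.
elim/word_ind: I t => {s}.
- move=> I sI s eqI; have s1 : s = 1%g by apply: sorted_perm1; rewrite -eqI.
  by rewrite inversions_sorted // s1 odd_perm1.
- move=> A x B s eqI; have : uniq (A ++ x :: x :: B).
    by rewrite eqI map_inj_uniq ?enum_uniq //; apply: perm_inj.
  by rewrite cat_uniq /= inE eqxx /= !andbF.
move=> A x y B xy IH s eqI; rewrite (inversions_swap _ _ xy) exprS mulN1r.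
have -> : s = ((s * tperm x y) * tperm x y)%g by rewrite -mulgA tperm2 mulg1.
rewrite odd_permM odd_tperm (_ : x != y); last by rewrite -val_eqE neq_ltn xy.
rewrite addbT signrN; congr (- _); apply: IH.
have : uniq (A ++ y :: x :: B).
  by rewrite eqI map_inj_uniq ?enum_uniq //; apply: perm_inj.
rewrite (perm_uniq (perm_swap_adjacent A x y B)) cat_uniq => /and3P[_].
rewrite /= !negb_or => /and3P[xA yA _].
move=> /and3P[/andP[_ xB] yB _].
have -> : [seq (s * tperm x y)%g a | a <- enum 'I_k]
    = map (tperm x y) (A ++ y :: x :: B).
  by rewrite eqI -[RHS]map_comp; apply: eq_map => a /=; rewrite permM.
have fixl (l : seq 'I_k) : x \notin l -> y \notin l -> map (tperm x y) l = l.
  move=> xl yl; rewrite -[RHS]map_id; apply/eq_in_map => a al.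
  by rewrite tpermD //; apply: contraTneq al => <-.
by rewrite map_cat /= tpermL tpermR !fixl.
Qed.

(** * Words in the quantum coordinate ring *)

Lemma q2_neq0 : q ^+ 2 != 0.
Proof. by rewrite expf_eq0 (negbTE q_neq0). Qed.

Lemma spec1_neq0 x a : spec1 x a -> a != 0 -> x != 0.
Proof.
by move=> xa; apply: contraNneq => x0; rewrite x0 in xa; rewrite (spec1_inj xa spec1_0).
Qed.

Lemma q2V_neq0 : q ^+ 2 + (q ^+ 2)^-1 != 0.
Proof.
apply: (@spec1_neq0 _ (1 ^+ 2 + 1 ^+ 2)); last by [].
by rewrite -exprVn; apply: spec1D; apply: spec1X; [exact: spec1_q|exact: spec1_qV].
Qed.

Lemma tpair_mul (F : fieldType) (A B : algType F) (a c : A) (b d : B) :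
  tpair a b * tpair c d = tpair (a * c) (b * d).
Proof. exact: tens_mulE. Qed.

Section MatrixWords.
Variables (n : nat) (F : fieldType) (z : F) (A : algType F) (x : 'I_n -> 'I_n -> A).
Implicit Types (I J K : seq 'I_n) (i j k s t : 'I_n).
Hypothesis z0 : z != 0.
Hypothesis x_row : forall i j k, (j < k)%N -> x i j * x i k = z *: (x i k * x i j).
Hypothesis x_col : forall i j k, (i < k)%N -> x i j * x k j = z *: (x k j * x i j).
Hypothesis x_anti : forall i j s t, (s < i)%N -> (j < t)%N ->
  x i j * x s t = x s t * x i j.
Hypothesis x_diag : forall i j s t, (i < s)%N -> (j < t)%N ->
  x i j * x s t = x s t * x i j + (z - z^-1) *: (x i t * x s j).

Fixpoint matrix_word I J : A :=
  match I, J with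
  | i :: I', j :: J' => x i j * matrix_word I' J'
  | _, _ => 1
  end.

Lemma matrix_word_cat I J I' J' : size I = size J ->
  matrix_word (I ++ I') (J ++ J') = matrix_word I J * matrix_word I' J'.
Proof.
elim: I J => [|i I IH] [|j J] //= => [_|[/IH ->]]; first by rewrite mul1r.
by rewrite mulrA.
Qed.

(* The defining relations of the quantum matrices, in the form R x1 x2 = x1 x2 R. *)
Lemma hecke_matrix_word p I J : size I = size J ->
  hecke z p (matrix_word^~ J) I = hecke z p (matrix_word I) J.
Proof.
elim: p I J => [|p IH] [|i I] [|j J] //=; last first.
  move=> [/IH eqIJ]; pose f (w : A) := x i j * w.
  have fP : linear f by move=> a u v; rewrite /f mulrDr scalerAr.
  by rewrite -(hecke_linear _ _ _ _ fP) eqIJ (hecke_linear _ _ _ _ fP).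
case: I J => [|i' I] [|j' J] //= _.
rewrite !mulrA !scalerAl -!mulrDl; congr (_ * _).
rewrite /hecke_coef -![_ == _ :> 'I_n]val_eqE.
case: (ltngtP i i') => [ii'|ii'|/val_inj <-];
  case: (ltngtP j j') => [jj'|jj'|/val_inj <-] /=;
  rewrite ?scale0r ?scale1r ?mul0r ?addr0 ?add0r -?scalerAl //.
- by rewrite (x_anti ii' jj').
- by rewrite (x_diag ii' jj') addrC.
- by rewrite (x_col _ ii') scalerA mulrBl mulVf // scalerBl scale1r subrK scalerA.
- by rewrite (x_diag ii' jj') (x_anti ii' jj') addrC.
- by rewrite (x_anti ii' jj').
- by rewrite (x_col _ ii').
- by rewrite (x_row _ jj') !scalerA mulrBl mulVf // scalerBl scale1r subrK.
- by rewrite (x_row _ jj').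
Qed.

End MatrixWords.

Section QuantumWords.
Variable n : nat.
Implicit Types (I J K : seq 'I_n) (i j k s t : 'I_n).

Local Notation xword := (matrix_word (@xSL n)).

Lemma T_mul (a b : OqM n) : T (a * b) = T a * T b.
Proof. exact: quot_piM. Qed.

Lemma T_scale c (a : OqM n) : T (c *: a) = c *: T a.
Proof. exact: quot_piZ. Qed.

Lemma T_add (a b : OqM n) : T (a + b) = T a + T b.
Proof. by rewrite [RHS]quot_addE. Qed.

Lemma T_linear : linear (@T n).
Proof. by move=> c a b; rewrite T_add T_scale. Qed.

Local Notation pi := (quot_pi (@OqM_rel n)).
Local Notation free := (freeAlg Qq ('I_n * 'I_n)%type).

Lemma OqM_pi_mul (a b : free) : pi (a * b) = (pi a : OqM n) * pi b :> OqM n.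
Proof. exact: quot_piM. Qed.

Lemma OqM_pi_scale c (a : free) : pi (c *: a) = c *: (pi a : OqM n) :> OqM n.
Proof. exact: quot_piZ. Qed.

Lemma OqM_pi_add (a b : free) : pi (a + b) = (pi a : OqM n) + pi b :> OqM n.
Proof. by rewrite [RHS]quot_addE. Qed.

Lemma xSL_row i j k : (j < k)%N -> xSL i j * xSL i k = q ^+ 2 *: (xSL i k * xSL i j).
Proof.
move=> jk; rewrite /xSL -!T_mul -T_scale /xM -!OqM_pi_mul -OqM_pi_scale; apply: (congr1 (@T n)).
by apply/quot_piP; apply: gen_ideal_base; exact: OqM_row jk.
Qed.

Lemma xSL_col i j k : (i < k)%N -> xSL i j * xSL k j = q ^+ 2 *: (xSL k j * xSL i j).
Proof.
move=> ik; rewrite /xSL -!T_mul -T_scale /xM -!OqM_pi_mul -OqM_pi_scale; apply: (congr1 (@T n)).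
by apply/quot_piP; apply: gen_ideal_base; exact: OqM_col ik.
Qed.

Lemma xSL_anti i j s t : (s < i)%N -> (j < t)%N -> xSL i j * xSL s t = xSL s t * xSL i j.
Proof.
move=> si jt; rewrite /xSL -!T_mul /xM -!OqM_pi_mul; apply: (congr1 (@T n)).
by apply/quot_piP; apply: gen_ideal_base; exact: OqM_anti si jt.
Qed.

Lemma xSL_diag i j s t : (i < s)%N -> (j < t)%N ->
  xSL i j * xSL s t = xSL s t * xSL i j + (q ^+ 2 - q ^- 2) *: (xSL i t * xSL s j).
Proof.
move=> si jt; rewrite /xSL -!T_mul -T_scale -T_add /xM -!OqM_pi_mul -OqM_pi_scale -OqM_pi_add.
by apply: (congr1 (@T n)); apply/quot_piP; apply: gen_ideal_base; exact: OqM_diag si jt.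
Qed.

Lemma hecke_xword p I J : size I = size J ->
  hecke (q ^+ 2) p (xword^~ J) I = hecke (q ^+ 2) p (xword I) J.
Proof.
exact: hecke_matrix_word q2_neq0 xSL_row xSL_col xSL_anti xSL_diag p I J.
Qed.

(** * The action and the pairing on words *)

Section Pairing.
Variables (HU : Uq_hopf n) (HO : OqSL_bialgebra n) (V : natural_rep n).
Variable P : hopf_pairing HU HO V.

(** The action with the antipode left out, which is a right action of the quantized enveloping
    algebra. *)
Definition Ract (u : Uq n) (f : OqSL n) : OqSL n :=
  tens_lift (fun f1 f2 => pairing P f1 u *: f2) (OqDelta HO f).

Lemma LactE u f : Lact P u f = Ract (UqS HU u) f.
Proof. by []. Qed.

(** The matrix of [u] on a tensor power of the natural representation. *)
Definition pword (u : Uq n) I J : Qq := pairing P (xword I J) u.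

Lemma pairing_linl u a f g : pairing P (a *: f + g) u = a * pairing P f u + pairing P g u.
Proof. exact: (pairing_bilinear P).1. Qed.

Lemma pairing_linr f a u v : pairing P f (a *: u + v) = a * pairing P f u + pairing P f v.
Proof. exact: (pairing_bilinear P).2. Qed.

Lemma Ract_bilinear u : bilinear_for *:%R *:%R
  ((fun f1 f2 => pairing P f1 u *: f2) : OqSL n -> OqSL n -> OqSL n).
Proof.
split=> [g|f] a x y /=; first by rewrite pairing_linl scalerDl scalerA.
by rewrite scalerDr !scalerA mulrC.
Qed.

Lemma mulr_bilinear u v : bilinear_for *:%R *:%R
  ((fun f g => pairing P f u * pairing P g v) : OqSL n -> OqSL n -> Qq^o).
Proof.
split=> [g|f] a x y /=; first by rewrite pairing_linl mulrDl -mulrA.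
by rewrite pairing_linl mulrDr mulrCA.
Qed.

Lemma mull_bilinear f g : bilinear_for *:%R *:%R
  ((fun u v => pairing P f u * pairing P g v) : Uq n -> Uq n -> Qq^o).
Proof.
split=> [v|u] a x y /=; first by rewrite pairing_linr mulrDl -mulrA.
by rewrite pairing_linr mulrDr mulrCA.
Qed.

Lemma big_linear (A B : lmodType Qq) (f : A -> B) (T : Type) (s : seq T) (Q : pred T)
    (g : T -> A) : linear f ->
  f (\sum_(t <- s | Q t) g t) = \sum_(t <- s | Q t) f (g t).
Proof.
move=> fP; pose h : {linear A -> B} := HB.pack f (GRing.isLinear.Build _ _ _ _ f fP).
exact: (raddf_sum h).
Qed.

Lemma OqDelta_xword I J : size I = size J ->
  OqDelta HO (xword I J)
  = \sum_(K <- words n (size I)) tpair (xword I K) (xword K J).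
Proof.
elim: I J => [|i I IH] [|j J] //= => [_|[eqIJ]].
  by rewrite big_seq1; exact: (OqDelta_morph HO).1.
rewrite (OqDelta_morph HO).2 OqDelta_x IH // big_words_cons mulr_suml.
apply: eq_bigr => k _; rewrite mulr_sumr; apply: eq_bigr => K _.
exact: tpair_mul.
Qed.

Lemma Ract_xword u I J : size I = size J ->
  Ract u (xword I J) = \sum_(K <- words n (size I)) pword u I K *: xword K J.
Proof.
move=> eqIJ; rewrite /Ract OqDelta_xword // big_linear; last first.
  exact: tens_lift_linear (Ract_bilinear u).
by apply: eq_bigr => K _; rewrite tens_liftE //; apply: Ract_bilinear.
Qed.

Lemma pword_mul u v I J : size I = size J ->
  pword (u * v) I J = \sum_(K <- words n (size I)) pword u I K * pword v K J.
Proof.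
move=> eqIJ; rewrite /pword pairing_mulr OqDelta_xword // big_linear; last first.
  exact: tens_lift_linear (mulr_bilinear u v).
by apply: eq_bigr => K _; rewrite tens_liftE //; apply: mulr_bilinear.
Qed.

Lemma pword1 I J : size I = size J -> pword 1 I J = (I == J)%:R.
Proof.
have epsM f g : OqEps HO (f * g) = OqEps HO f * OqEps HO g by exact: rmorphM.
rewrite /pword pairing_1r; elim: I J => [|i I IH] [|j J] //=.
  by move=> _; exact: (rmorph1 (OqEps HO)).
by move=> [/IH]; rewrite epsM OqEps_x eqseq_cons => ->; rewrite -natrM mulnb.
Qed.

Lemma Ract_linear u : linear (Ract u).
Proof.
move=> a f g; rewrite /Ract OqDelta_linear.
exact: (tens_lift_linear (Ract_bilinear u)).
Qed.

End Pairing.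
End QuantumWords.

(* Conversion must not unfold the fractions of polynomials. *)
Opaque Qq.

(** * Matrices of the generators on tensor powers of the natural representation *)

Section PairingOnWords.
Variable n : nat.
Variables (HU : Uq_hopf n) (HO : OqSL_bialgebra n) (V : natural_rep n).
Variable P : hopf_pairing HU HO V.
Implicit Types (I J K : seq 'I_n) (i j k : 'I_n) (a : 'I_n.-1).
Local Notation xword := (matrix_word (@xSL n)).
Local Notation pword := (pword P).
Local Notation Ract := (Ract P).

Lemma Kgen_KVgen a : Kgen a * KVgen a = 1.
Proof.
apply: etrans (esym (quot_piM _ _ _)) _.
by apply/quot_piP; apply: gen_ideal_base; exact: Uq_KKV.
Qed.

Lemma KVgen_Kgen a : KVgen a * Kgen a = 1.
Proof.
apply: etrans (esym (quot_piM _ _ _)) _.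
by apply/quot_piP; apply: gen_ideal_base; exact: Uq_KVK.
Qed.

Lemma pairing_mulK a f g : pairing P (f * g) (Kgen a)
  = pairing P f (Kgen a) * pairing P g (Kgen a).
Proof.
rewrite pairing_mull UqDelta_K tens_liftE //; exact: mull_bilinear.
Qed.

Lemma pairing_mulE a f g : pairing P (f * g) (Egen a)
  = pairing P f (Egen a) * pairing P g 1
    + pairing P f (Kgen a ^+ 2) * pairing P g (Egen a).
Proof.
have lb := mull_bilinear P f g; have ll := tens_lift_linear lb.
rewrite pairing_mull UqDelta_E -[tpair (Egen a) 1]scale1r ll scale1r.
by rewrite !tens_liftE.
Qed.

Lemma pairing_mulF a f g : pairing P (f * g) (Fgen a)
  = pairing P f (Fgen a) * pairing P g (KVgen a ^+ 2)
    + pairing P f 1 * pairing P g (Fgen a).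
Proof.
have lb := mull_bilinear P f g; have ll := tens_lift_linear lb.
rewrite pairing_mull UqDelta_F -[tpair (Fgen a) _]scale1r ll scale1r.
by rewrite !tens_liftE.
Qed.

Definition kappa a i : Qq :=
  if i == a :> nat then q else if i == a.+1 :> nat then q^-1 else 1.

Definition kappaw a I : Qq := \prod_(i <- I) kappa a i.

Lemma kappaw_cons a i I : kappaw a (i :: I) = kappa a i * kappaw a I.
Proof. exact: big_cons. Qed.

Lemma kappaw_cat a I J : kappaw a (I ++ J) = kappaw a I * kappaw a J.
Proof. exact: big_cat. Qed.

Lemma kappa_neq0 a i : kappa a i != 0.
Proof.
rewrite /kappa; case: ifP => _; first exact: q_neq0.
by case: ifP => _; [apply: invr_neq0; exact: q_neq0|exact: oner_neq0].
Qed.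

Lemma kappaw_neq0 a I : kappaw a I != 0.
Proof.
elim: I => [|i I IH]; first by rewrite /kappaw big_nil oner_neq0.
rewrite kappaw_cons; apply: mulf_neq0; [exact: kappa_neq0|exact: IH].
Qed.

Lemma natKE a i j : natK a i j = if i == j then kappa a i else 0.
Proof. by rewrite mxE; case: eqVneq. Qed.

Definition diagonal (u : Uq n) (d : seq 'I_n -> Qq) :=
  forall I J, size I = size J -> pword u I J = if I == J then d I else 0.

Lemma pword_nil (u : Uq n) : pword u [::] [::] = UqEps HU u.
Proof. exact: pairing_1l. Qed.

Lemma pairing_xSL i j u : pairing P (xSL i j) u = rho V u i j.
Proof. exact: pairing_x. Qed.

Lemma pword_K a : diagonal (Kgen a) (kappaw a).
Proof.
elim=> [|i I IH] [|j J] //= => [_|[/IH {}IH]].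
  by rewrite /kappaw big_nil pword_nil UqEps_K.
rewrite kappaw_cons /pword /= pairing_mulK pairing_xSL rho_K natKE eqseq_cons.
case: (eqVneq i j) => [_|_]; last by rewrite mul0r.
by rewrite -[pairing _ _ _]/(pword _ _ _) IH /=; case: eqP; rewrite ?mulr0.
Qed.

Lemma diagonalM u v d e : diagonal u d -> diagonal v e ->
  diagonal (u * v) (fun I => d I * e I).
Proof.
move=> ud ve I J eqIJ; rewrite pword_mul //.
rewrite (eq_big_words (h := fun K => if I == K then d I * pword v I J else 0)) => [|K szK].
  rewrite (big_words_delta (fun K => d I * pword v I J)) //= ve //.
  by case: eqP; rewrite ?mulr0.
by rewrite ud //; case: eqP => [<-|]; rewrite ?mul0r.
Qed.

(** The structure maps are prescribed on [Kgen]; the matrix of [KVgen] is found by inverting the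
    diagonal matrix of [Kgen]. *)
Lemma pword_KV a : diagonal (KVgen a) (fun I => (kappaw a I)^-1).
Proof.
move=> I J eqIJ; have := pword_mul P (Kgen a) (KVgen a) eqIJ.
rewrite Kgen_KVgen (pword1 P eqIJ).
rewrite (eq_big_words (h := fun K => if I == K then kappaw a I * pword (KVgen a) I J else 0));
  last by move=> K szK; rewrite pword_K //; case: eqP => [<-|]; rewrite ?mul0r.
rewrite (big_words_delta (fun K => kappaw a I * pword (KVgen a) I J)) //= => e.
apply: (mulfI (kappaw_neq0 a I)); rewrite -e.
by case: eqP => // _; rewrite ?mulr0 // divff // kappaw_neq0.
Qed.

Lemma pword_E_cat a I J I' J' : size I = size J -> size I' = size J' ->
  pword (Egen a) (I ++ I') (J ++ J')
  = pword (Egen a) I J * (I' == J')%:R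
    + (I == J)%:R * (kappaw a I ^+ 2 * pword (Egen a) I' J').
Proof.
move=> eqIJ eqIJ'; rewrite /pword matrix_word_cat // pairing_mulE.
rewrite -!/(pword _ _ _) (pword1 P eqIJ') (diagonalM (@pword_K a) (@pword_K a) eqIJ) -expr2.
by congr (_ + _); case: eqP; rewrite ?mul0r ?mul1r.
Qed.

Lemma pword_F_cat a I J I' J' : size I = size J -> size I' = size J' ->
  pword (Fgen a) (I ++ I') (J ++ J')
  = pword (Fgen a) I J * ((I' == J')%:R * kappaw a I' ^- 2)
    + (I == J)%:R * pword (Fgen a) I' J'.
Proof.
move=> eqIJ eqIJ'; rewrite /pword matrix_word_cat // pairing_mulF.
rewrite -!/(pword _ _ _) (pword1 P eqIJ) (diagonalM (@pword_KV a) (@pword_KV a) eqIJ') -invfM -expr2.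
by congr (_ * _ + _); case: eqP; rewrite ?mul0r ?mul1r.
Qed.

Lemma pword1E u i j : pword u [:: i] [:: j] = rho V u i j.
Proof. by rewrite /pword /= mulr1 pairing_xSL. Qed.

Lemma pword_E_nil a : pword (Egen a) [::] [::] = 0.
Proof. by rewrite pword_nil UqEps_E. Qed.

Lemma pword_F_nil a : pword (Fgen a) [::] [::] = 0.
Proof. by rewrite pword_nil UqEps_F. Qed.

Lemma pword_E_cons a i j I J : size I = size J ->
  pword (Egen a) (i :: I) (j :: J)
  = ((i == a :> nat) && (j == a.+1 :> nat))%:R * (I == J)%:R
    + (i == j)%:R * (kappa a i ^+ 2 * pword (Egen a) I J).
Proof.
move=> eqIJ; have := @pword_E_cat a [:: i] [:: j] I J erefl eqIJ.
rewrite /= => ->; rewrite pword1E rho_E mxE kappaw_cons /kappaw big_nil mulr1.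
by rewrite eqseq_cons andbT.
Qed.

Lemma pword_F_cons a i j I J : size I = size J ->
  pword (Fgen a) (i :: I) (j :: J)
  = ((i == a.+1 :> nat) && (j == a :> nat))%:R * ((I == J)%:R * kappaw a I ^- 2)
    + (i == j)%:R * pword (Fgen a) I J.
Proof.
move=> eqIJ; have := @pword_F_cat a [:: i] [:: j] I J erefl eqIJ.
by rewrite /= => ->; rewrite pword1E rho_F mxE eqseq_cons andbT.
Qed.

(* The transpose of E_a is q^2 K_a^2 F_a. *)
Lemma pword_E_tr a I J : size I = size J ->
  pword (Egen a) I J = q ^+ 2 * (kappaw a J ^+ 2 * pword (Fgen a) J I).
Proof.
elim: I J => [|i I IH] [|j J] //= => [_|[eqIJ]].
  by rewrite pword_E_nil pword_F_nil !mulr0.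
rewrite pword_E_cons // pword_F_cons // IH // kappaw_cons [J == I]eq_sym [j == i]eq_sym.
rewrite [(val j == _) && _]andbC.
have k2 : kappaw a J ^+ 2 != 0 by apply: expf_neq0; exact: kappaw_neq0.
case: (eqVneq i j) => [<-|ij].
  have -> : (i == a :> nat) && (i == a.+1 :> nat) = false.
    by case: eqP => //= ->; rewrite eqn_leq ltnn andbF.
  by rewrite !mul0r !add0r !mul1r exprMn; ring.
rewrite !mul0r !addr0; case: (eqVneq I J) => [_|_]; last by rewrite !(mul0r, mulr0).
case: (boolP (_ && _)) => [/andP[/eqP ia /eqP ja]|_]; last by rewrite !(mul0r, mulr0).
(* Here j = a + 1, so [kappa a j] is q^-1, which cancels the factor q^2. *)
rewrite {1}/kappa ja eqn_leq ltnn andFb eqxx !mul1r exprMn.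
by rewrite (mulfK k2) exprVn (mulfV q2_neq0).
Qed.

Lemma pword_E_support a I J : size I = size J -> pword (Egen a) I J != 0 ->
  exists A i j B, [/\ I = A ++ i :: B, J = A ++ j :: B, i = a :> nat & j = a.+1 :> nat].
Proof.
elim: I J => [|i I IH] [|j J] //= => [_|[eqIJ]]; first by rewrite pword_E_nil eqxx.
rewrite pword_E_cons //; case: (boolP (_ && _)) => [/andP[/eqP ia /eqP ja]|_].
  have -> : (i == j) = false by rewrite -val_eqE /= ia ja eqn_leq ltnn andbF.
  rewrite mul0r addr0 mul1r; case: (eqVneq I J) => [<- _|_ /eqP //].
  by exists [::], i, j, I.
rewrite mul0r add0r; case: (eqVneq i j) => [<-|_]; last by rewrite mul0r => /eqP.
rewrite mul1r mulf_eq0 negb_or => /andP[_ /(IH _ eqIJ)[A [i' [j' [B [-> -> ? ?]]]]]].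
by exists (i :: A), i', j', B.
Qed.

End PairingOnWords.

(** * The action on tensors, and the map from tensors to the coordinate ring *)

Section WordAction.
Variable n : nat.
Variables (HU : Uq_hopf n) (HO : OqSL_bialgebra n) (V : natural_rep n).
Variable P : hopf_pairing HU HO V.
Implicit Types (I J K : seq 'I_n) (v w : seq 'I_n -> Qq) (a : 'I_n.-1).
Local Notation xword := (matrix_word (@xSL n)).
Local Notation pword := (pword P).
Local Notation Ract := (Ract P).
Local Notation hecke := (hecke (q ^+ 2)).

(** The tensor [v] is a row vector, multiplied on the right by the matrix of [u]. *)
Definition wact (u : Uq n) v K : Qq :=
  \sum_(I <- words n (size K)) v I * pword u I K.

Definition phi J v : OqSL n := \sum_(I <- words n (size J)) v I *: xword I J.

Lemma eq_wact u v w K : (forall I, size I = size K -> v I = w I) ->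
  wact u v K = wact u w K.
Proof. by move=> vw; apply: eq_big_words => I szI; rewrite vw. Qed.

Lemma eq_phi v w J : (forall I, size I = size J -> v I = w I) -> phi J v = phi J w.
Proof. by move=> vw; apply: eq_big_words => I szI; rewrite vw. Qed.

Lemma wact_linear u c v w K :
  wact u (fun I => c * v I + w I) K = c * wact u v K + wact u w K.
Proof.
rewrite /wact mulr_sumr -big_split; apply: eq_bigr => I _ /=.
by rewrite mulrDl mulrA.
Qed.

Lemma phi_linear J c v w : phi J (fun I => c * v I + w I) = c *: phi J v + phi J w.
Proof.
rewrite /phi scaler_sumr -big_split; apply: eq_bigr => I _ /=.
by rewrite scalerDl scalerA.
Qed.

Lemma phi0 J : phi J (fun=> 0) = 0.
Proof. by rewrite /phi big1 // => I _; rewrite scale0r. Qed.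

Lemma Ract_sum u (T : Type) (s : seq T) (c : T -> Qq) (g : T -> OqSL n) :
  Ract u (\sum_(t <- s) c t *: g t) = \sum_(t <- s) c t *: Ract u (g t).
Proof.
have Rlin := Ract_linear P u.
rewrite (big_linear _ _ _ Rlin); apply: eq_bigr => t _.
exact: (scalable_linear Rlin).
Qed.

Lemma Ract_phi u J v : Ract u (phi J v) = phi J (wact u v).
Proof.
rewrite /phi Ract_sum.
rewrite (eq_big_words (h := fun I =>
    \sum_(K <- words n (size J)) (v I * pword u I K) *: xword K J)); last first.
  move=> I szI; rewrite Ract_xword // szI scaler_sumr.
  by apply: eq_bigr => K _; rewrite scalerA.
rewrite exchange_big; apply: eq_big_words => K szK.
by rewrite /wact szK scaler_suml.
Qed.

Lemma wactM u u' v K : wact (u * u') v K = wact u' (wact u v) K.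
Proof.
rewrite /wact (eq_big_words (h := fun I =>
    \sum_(J <- words n (size K)) v I * pword u I J * pword u' J K)); last first.
  move=> I szI; rewrite pword_mul // szI mulr_sumr.
  by apply: eq_bigr => J _; rewrite mulrA.
rewrite exchange_big; apply: eq_big_words => J szJ.
by rewrite szJ mulr_suml.
Qed.

Lemma wact_diagonal u d v K : diagonal P u d -> wact u v K = v K * d K.
Proof.
move=> ud; rewrite /wact (eq_big_words (h := fun I => if K == I then v K * d K else 0)).
  exact: (big_words_delta (fun=> v K * d K)).
by move=> I szI; rewrite ud // eq_sym; case: eqP => [<-|]; rewrite ?mulr0.
Qed.

(** Self-adjointness moves the Hecke operator from [v] to the row word, and R x1 x2 = x1 x2 R moves
    it from the row word to the column word. *)
Lemma phi_hecke p J v :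
  phi J (hecke p (v : _ -> Qq^o)) = hecke p (phi^~ v) J.
Proof.
rewrite /phi (hecke_adjoint _ _ _ v).
rewrite (eq_big_words (h := fun I => v I *: hecke p (xword I) J)) => [|I szI].
  rewrite -hecke_sum; apply: eq_hecke => J' szJ'.
  by rewrite /phi szJ'.
by rewrite hecke_xword.
Qed.

(** Obtained by pairing R x1 x2 = x1 x2 R with [u]: the Hecke operators commute with the quantized
    enveloping algebra on tensor powers. *)
Lemma hecke_pword p u I K : size I = size K ->
  hecke p (fun I => pword u I K : Qq^o) I = hecke p (pword u I : _ -> Qq^o) K.
Proof.
move=> eqIK; have plin : linear ((fun f => pairing P f u) : OqSL n -> Qq^o).
  exact: (pairing_bilinear P).1.
by rewrite -!(hecke_linear _ _ _ _ plin) hecke_xword.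
Qed.

Lemma wact_hecke p u v K :
  wact u (hecke p (v : _ -> Qq^o)) K = hecke p (wact u v : _ -> Qq^o) K.
Proof.
have -> : hecke p (wact u v : _ -> Qq^o) K = hecke p (fun J =>
    \sum_(I <- words n (size K)) v I *: (pword u I J : Qq^o)) K.
  by apply: eq_hecke => J szJ; rewrite /wact szJ.
rewrite hecke_sum.
apply: etrans (hecke_adjoint _ p (size K) v (fun I => pword u I K : Qq^o)) _.
by apply: eq_big_words => I szI; rewrite hecke_pword.
Qed.

Lemma wact_E_cat a v K1 K2 : wact (Egen a) v (K1 ++ K2) =
  \sum_(A <- words n (size K1)) v (A ++ K2) * pword (Egen a) A K1
  + kappaw a K1 ^+ 2 * wact (Egen a) (fun B => v (K1 ++ B)) K2.
Proof.
rewrite /wact size_cat big_words_cat mulr_sumr.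
rewrite (eq_big_words (h := fun A => v (A ++ K2) * pword (Egen a) A K1
    + if K1 == A then \sum_(B <- words n (size K2))
       kappaw a K1 ^+ 2 * (v (K1 ++ B) * pword (Egen a) B K2) else 0)) => [|A szA].
  by rewrite big_split /= (big_words_delta (fun=> \sum_(B <- _) _)).
rewrite (eq_big_words (h := fun B => (if K2 == B then v (A ++ K2) * pword (Egen a) A K1 else 0)
    + (A == K1)%:R * (kappaw a K1 ^+ 2 * (v (A ++ B) * pword (Egen a) B K2)))) => [|B szB].
  rewrite big_split /= (big_words_delta (fun=> _ * _)) // -mulr_sumr eq_sym.
  congr (_ + _); case: eqP => [->|_]; by rewrite ?mul1r ?mul0r.
rewrite pword_E_cat // mulrDr; congr (_ + _).
  by rewrite eq_sym; case: eqP => [->|_]; rewrite ?mulr1 ?mulr0.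
rewrite mulrCA; case: (eqVneq A K1) => [->|_]; last by rewrite !mul0r.
by congr (_ * _); exact: mulrCA.
Qed.

Lemma wact_F_cat a v K1 K2 : wact (Fgen a) v (K1 ++ K2) =
  kappaw a K2 ^- 2 * \sum_(A <- words n (size K1)) v (A ++ K2) * pword (Fgen a) A K1
  + wact (Fgen a) (fun B => v (K1 ++ B)) K2.
Proof.
rewrite /wact size_cat big_words_cat mulr_sumr.
rewrite (eq_big_words (h := fun A => kappaw a K2 ^- 2 * (v (A ++ K2) * pword (Fgen a) A K1)
    + if K1 == A then \sum_(B <- words n (size K2))
       v (K1 ++ B) * pword (Fgen a) B K2 else 0)) => [|A szA].
  by rewrite big_split /= (big_words_delta (fun=> \sum_(B <- _) _)).
rewrite (eq_big_words (h := fun B =>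
    (if K2 == B then kappaw a K2 ^- 2 * (v (A ++ K2) * pword (Fgen a) A K1) else 0)
    + (A == K1)%:R * (v (A ++ B) * pword (Fgen a) B K2))) => [|B szB].
  rewrite big_split /= (big_words_delta (fun=> _ * _)) // -mulr_sumr eq_sym.
  congr (_ + _); case: eqP => [->|_]; by rewrite ?mul1r ?mul0r.
rewrite pword_F_cat // mulrDr; congr (_ + _).
  rewrite eq_sym; case: eqP => [->|_]; last by rewrite mul0r !mulr0.
  by rewrite mul1r mulrA mulrC.
by rewrite mulrCA.
Qed.

(** * Invariant tensors, their products and contractions *)

Section Invariants.
Variable Th : {set 'I_n.-1}.

(** Only the K_a with [a] in [Th] are asked to fix [v]: the rest of the torus need not fix the
    q-wedge of a block. *)
Definition invariant_word m v := forall a, a \in Th -> forall K, size K = m ->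
  [/\ wact (Egen a) v K = 0, wact (Fgen a) v K = 0 & wact (Kgen a) v K = v K].

Lemma invariant0 m : invariant_word m (fun=> 0).
Proof.
by move=> a _ K _; rewrite /wact !big1 // => I _; rewrite mul0r.
Qed.

Lemma invariant_linear m c v w : invariant_word m v -> invariant_word m w ->
  invariant_word m (fun I => c * v I + w I).
Proof.
move=> vi wi a aTh K szK; have [vE vF vK] := vi a aTh K szK.
have [wE wF wK] := wi a aTh K szK.
by rewrite !wact_linear vE vF vK wE wF wK !mulr0 !addr0.
Qed.

Lemma invariant_hecke m p v : invariant_word m v -> invariant_word m (hecke p (v : _ -> Qq^o)).
Proof.
move=> vi a aTh K szK; rewrite !wact_hecke.
have h0 : hecke p (fun=> 0 : Qq^o) K = 0.
  elim: p {szK} K => [|p IH] [|x K] //=; case: K => // y K.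
  by rewrite !scaler0 addr0.
split.
- apply: etrans h0; apply: eq_hecke => J szJ.
  by have [-> _ _] := vi a aTh J (etrans szJ szK).
- apply: etrans h0; apply: eq_hecke => J szJ.
  by have [_ -> _] := vi a aTh J (etrans szJ szK).
- apply: (@eq_hecke _ _ _ Qq^o p (wact (Kgen a) v) v) => J szJ.
  by have [_ _ ->] := vi a aTh J (etrans szJ szK).
Qed.

Lemma invariant_kappaw m v a K : invariant_word m v -> a \in Th -> size K = m ->
  v K * kappaw a K = v K.
Proof.
move=> vi aTh szK; have [_ _ vK] := vi a aTh K szK.
by rewrite -[RHS]vK (wact_diagonal v K (pword_K P a)).
Qed.

(** Every term of the coproduct of E_a or F_a applies E_a or F_a to one of the two factors and kills
    it. *)
Lemma invariant_tensor k m d v : invariant_word k d -> invariant_word m v ->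
  invariant_word (k + m) (fun I => d (take k I) * v (drop k I)).
Proof.
move=> di vi a aTh K szK.
pose K1 := take k K; pose K2 := drop k K.
have eqK : K = K1 ++ K2 by rewrite cat_take_drop.
have sz1 : size K1 = k by rewrite size_takel // szK leq_addr.
have sz2 : size K2 = m by rewrite size_drop szK addKn.
have [dE dF _] := di a aTh K1 sz1; have [vE vF _] := vi a aTh K2 sz2.
have dvE A B : size A = k -> d (take k (A ++ B)) * v (drop k (A ++ B)) = d A * v B.
  by move=> <-; rewrite take_size_cat // drop_size_cat.
have sumA u : \sum_(A <- words n (size K1))
    d (take k (A ++ K2)) * v (drop k (A ++ K2)) * pword u A K1 = v K2 * wact u d K1.
  rewrite /wact mulr_sumr; apply: eq_big_words => A szA.
  by rewrite dvE ?szA // mulrAC mulrC.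
have sumB u : wact u (fun B => d (take k (K1 ++ B)) * v (drop k (K1 ++ B))) K2
    = d K1 * wact u v K2.
  rewrite /wact mulr_sumr; apply: eq_bigr => B _.
  by rewrite dvE // mulrA.
split.
- by rewrite eqK wact_E_cat sumA sumB dE vE !mulr0 addr0.
- by rewrite eqK wact_F_cat sumA sumB dF vF !mulr0 addr0.
rewrite (wact_diagonal _ _ (pword_K P a)) eqK dvE // kappaw_cat mulrACA.
by rewrite (invariant_kappaw di aTh sz1) (invariant_kappaw vi aTh sz2).
Qed.

Definition contract k (d v : seq 'I_n -> Qq) K : Qq :=
  \sum_(A <- words n k) d A * v (A ++ K).

(** By the coproduct, acting on the uncontracted letters amounts to acting on all of [v] minus
    acting on the contracted letters; the latter part is moved to [d] by transposition and vanishes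
    there. *)
Lemma invariant_contract k m d v : invariant_word k d -> invariant_word (k + m) v ->
  invariant_word m (contract k d v).
Proof.
move=> di vi a aTh K szK.
have szAK A : size A = k -> size (A ++ K) = (k + m)%N by rewrite size_cat szK => ->.
have q0 := q2_neq0.
(* The transpose of E_a is q^2 K_a^2 F_a, where K_a fixes [d] and F_a kills it. *)
have coE A : size A = k -> \sum_(K1 <- words n k) d K1 * pword (Egen a) A K1 = 0.
  move=> szA; rewrite (eq_big_words (h := fun K1 => q ^+ 2 * (d K1 * pword (Fgen a) K1 A))).
    by rewrite -mulr_sumr -{1}szA -/(wact _ d A); have [_ -> _] := di a aTh A szA; rewrite mulr0.
  move=> K1 sz1; rewrite pword_E_tr ?szA //.
  rewrite mulrCA; congr (_ * _); rewrite mulrA expr2 mulrA.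
  by rewrite !(invariant_kappaw di aTh sz1).
have coF A : size A = k -> \sum_(K1 <- words n k) d K1 * pword (Fgen a) A K1 = 0.
  move=> szA; have nz : q ^+ 2 * kappaw a A ^+ 2 != 0.
    by apply: mulf_neq0; [exact: q0|apply: expf_neq0; exact: kappaw_neq0].
  apply: (mulfI nz); rewrite mulr0 mulr_sumr.
  rewrite (eq_big_words (h := fun K1 => d K1 * pword (Egen a) K1 A)).
    by rewrite -{1}szA -/(wact _ d A); have [-> _ _] := di a aTh A szA.
  move=> K1 sz1; rewrite pword_E_tr ?szA // mulrCA; congr (_ * _).
  by rewrite mulrA.
have sumB u : wact u (contract k d v) K
    = \sum_(A <- words n k) d A * wact u (fun B => v (A ++ B)) K.
  rewrite /wact /contract (eq_big_words (h := fun I =>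
     \sum_(A <- words n k) d A * (v (A ++ I) * pword u I K))) => [|I _].
    by rewrite exchange_big; apply: eq_bigr => A _; rewrite mulr_sumr.
  by rewrite mulr_suml; apply: eq_bigr => A _; rewrite mulrA.
have sumA u : (forall A, size A = k -> \sum_(K1 <- words n k) d K1 * pword u A K1 = 0) ->
    \sum_(K1 <- words n k) d K1 * \sum_(A <- words n (size K1)) v (A ++ K) * pword u A K1 = 0.
  move=> co; rewrite (eq_big_words (h := fun K1 =>
     \sum_(A <- words n k) v (A ++ K) * (d K1 * pword u A K1))) => [|K1 sz1].
    rewrite exchange_big (eq_big_words (h := fun=> 0)) => [|A szA]; last first.
      by rewrite -mulr_sumr co // mulr0.
    by rewrite big1.
  by rewrite sz1 mulr_sumr; apply: eq_bigr => A _; rewrite mulrCA.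
split.
- rewrite sumB (eq_big_words (h := fun A => d A * wact (Egen a) v (A ++ K) -
     d A * \sum_(B <- words n (size A)) v (B ++ K) * pword (Egen a) B A)) => [|A szA].
    rewrite sumrB sumA // subr0 (eq_big_words (h := fun=> 0)) ?big1 // => A szA.
    by have [-> _ _] := vi a aTh _ (szAK A szA); rewrite mulr0.
  rewrite wact_E_cat mulrDr [X in X - _]addrC addrK.
  by rewrite mulrA expr2 mulrA !(invariant_kappaw di aTh szA).
- rewrite sumB (eq_big_words (h := fun A => d A * wact (Fgen a) v (A ++ K) -
     kappaw a K ^- 2 *
     (d A * \sum_(B <- words n (size A)) v (B ++ K) * pword (Fgen a) B A))) => [|A szA].
    rewrite sumrB -mulr_sumr sumA // mulr0 subr0.
    rewrite (eq_big_words (h := fun=> 0)) ?big1 // => A szA.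
    by have [_ -> _] := vi a aTh _ (szAK A szA); rewrite mulr0.
  by rewrite wact_F_cat mulrDr [X in X - _]addrC mulrCA addrK.
rewrite (wact_diagonal _ _ (pword_K P a)) /contract mulr_suml.
apply: eq_big_words => A szA.
rewrite -{1}(invariant_kappaw di aTh szA) -!mulrA [kappaw a A * _]mulrCA -kappaw_cat.
by rewrite (invariant_kappaw vi aTh (szAK A szA)).
Qed.

End Invariants.
End WordAction.

Local Notation set_nth := Defs.set_nth.

(** * Quantum minors *)

Lemma enum_set_sorted n (J : {set 'I_n}) : sorted (@ltI n) (enum J).
Proof.
rewrite /enum_mem -enumT; apply: sorted_filter; first exact: ltI_trans.
exact: enum_ord_sorted.
Qed.

Lemma set_nth_nth n m (J : {set 'I_n}) (hJ : #|J| = m) x0 (a : 'I_m) :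
  set_nth hJ a = nth x0 (enum J) a.
Proof. by rewrite /set_nth (enum_val_nth x0). Qed.

Lemma map_set_nth n m (J : {set 'I_n}) (hJ : #|J| = m) :
  [seq set_nth hJ a | a <- enum 'I_m] = enum J.
Proof.
have szJ : size (enum J) = m by rewrite -cardE.
case: m => [|m] in hJ szJ *; first by rewrite enum_ord0 (size0nil szJ).
pose x0 := set_nth hJ ord0.
rewrite (eq_map (set_nth_nth hJ x0)) (map_comp (nth x0 (enum J)) val) val_enum_ord.
by rewrite -szJ -/(mkseq _ _) mkseq_nth.
Qed.

Lemma set_nth_incr n m (J : {set 'I_n}) (hJ : #|J| = m) (i j : 'I_m) :
  (i < j)%N -> (set_nth hJ i < set_nth hJ j)%N.
Proof.
move=> ij; have [x0 _] : exists x0 : 'I_n, true by exists (set_nth hJ i).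
rewrite !(set_nth_nth hJ x0).
apply: (sorted_ltn_nth (@ltI_trans n) _ (enum_set_sorted J)) => //;
  by rewrite inE -cardE hJ.
Qed.

Lemma sorted_enum_set n (I : seq 'I_n) : sorted (@ltI n) I -> enum [set x in I] = I.
Proof.
move=> sI; apply: (irr_sorted_eq (@ltI_trans n)) (enum_set_sorted _) sI _.
  by move=> x; rewrite /ltI ltnn.
by move=> x; rewrite mem_enum inE.
Qed.

Section GeneratedSubalgebra.
Variables (F : fieldType) (A : algType F) (S : A -> Prop).

Lemma gen_subalg0 : gen_subalg S 0.
Proof.
by rewrite -(addNr 1) -scaleN1r; apply: gen_subalg_lin; apply: gen_subalg_one.
Qed.

Lemma gen_subalgZ a x : gen_subalg S x -> gen_subalg S (a *: x).
Proof. by move=> Sx; rewrite -[_ *: _]addr0; apply/gen_subalg_lin/gen_subalg0. Qed.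

Lemma gen_subalgD x y : gen_subalg S x -> gen_subalg S y -> gen_subalg S (x + y).
Proof. by move=> Sx Sy; rewrite -[x]scale1r; apply: gen_subalg_lin. Qed.

Lemma gen_subalg_sum (T : eqType) (s : seq T) (g : T -> A) :
  (forall t, t \in s -> gen_subalg S (g t)) -> gen_subalg S (\sum_(t <- s) g t).
Proof.
move=> Sg; rewrite big_seq; apply: (big_ind (gen_subalg S)) => //.
- exact: gen_subalg0.
- exact: gen_subalgD.
Qed.

Lemma gen_subalg_hecke n (z : F) p (g : seq 'I_n -> A) I :
  (forall J, size J = size I -> gen_subalg S (g J)) -> gen_subalg S (hecke z p g I).
Proof.
elim: p I g => [|p IH] [|x I] g Sg //=; try exact: Sg.
  case: I Sg => [|y I] Sg; first exact: Sg.
  by apply: gen_subalgD; apply: gen_subalgZ; apply: Sg.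
by apply: IH => J szJ; apply: Sg; rewrite /= szJ.
Qed.

End GeneratedSubalgebra.

Section Minors.
Variable n : nat.
Local Notation xword := (matrix_word (@xSL n)).
Local Notation wedge := (wedge (q ^+ 2)).
Local Notation hecke := (hecke (q ^+ 2)).

Lemma T_prod (T1 : Type) (s : seq T1) (g : T1 -> OqM n) :
  T (\prod_(t <- s) g t) = \prod_(t <- s) T (g t).
Proof. by apply: (big_morph (@T n)) => // a b; apply: T_mul. Qed.

Lemma matrix_word_map m (l : seq 'I_m) (f g : 'I_m -> 'I_n) :
  xword (map f l) (map g l) = \prod_(a <- l) xSL (f a) (g a).
Proof. by elim: l => [|a l IH] /=; rewrite ?big_nil ?big_cons // IH. Qed.

Lemma T_qminor m (I J : {set 'I_n}) (hI : #|I| = m) (hJ : #|J| = m) :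
  T (qminor hI hJ)
  = \sum_(s : 'S_m) (- q ^+ 2) ^+ perm_length s *: xword (enum I) (perm_word (set_nth hJ) s).
Proof.
rewrite /qminor (big_linear _ _ _ (@T_linear n)); apply: eq_bigr => s _.
rewrite T_scale; congr (_ *: _).
rewrite T_prod -(map_set_nth hI) matrix_word_map.
by have -> : enum 'I_m = index_enum 'I_m by rewrite [index_enum _]unlock enumT.
Qed.

Lemma phi_wedge_anti (b : seq 'I_n) : uniq b ->
  forall p (J : seq 'I_n), size J = size b -> (p.+1 < size b)%N ->
  hecke p ((@phi n)^~ (wedge b)) J = - (q ^+ 2)^-1 *: phi J (wedge b).
Proof.
move=> ub p J szJ pb; rewrite -phi_hecke.
have -> : phi J (hecke p (wedge b : _ -> Qq^o)) = phi J (fun I => - (q ^+ 2)^-1 * wedge b I).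
  by apply: eq_phi => I szI; rewrite (wedge_anti q2_neq0 ub) ?szI.
by rewrite /phi scaler_sumr; apply: eq_bigr => A _; rewrite scalerA.
Qed.

(** The value at q = 1 is the factorial of [m]. *)
Lemma sum_sign_sq_neq0 m : \sum_(s : 'S_m) (- q ^+ 2) ^+ perm_length s
  * (- q ^+ 2) ^+ perm_length s != 0.
Proof.
apply: (@spec1_neq0 _ (\sum_(s : 'S_m)
    (- 1 ^+ 2) ^+ perm_length s * (- 1 ^+ 2) ^+ perm_length s)).
  apply: spec1_sum => s _.
  by apply: spec1M; apply: spec1X; apply: spec1N; apply: spec1X; exact: spec1_q.
rewrite (eq_bigr (fun=> 1)) => [|s _]; last by rewrite expr1n -exprD addnn -mul2n exprM sqrrN !expr1n.
by rewrite sumr_const card_Sn pnatr_eq0 -lt0n fact_gt0.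
Qed.

(* Both sides become equal after multiplication by the sum of the squares of the
   coefficients of a minor: evaluate the sum of the x_(A, B), weighted by the
   coefficients of A and B in the two wedges, by rows and by columns. *)
Lemma phi_wedge_qminor m (I J : {set 'I_n}) (hI : #|I| = m) (hJ : #|J| = m) :
  phi (enum J) (wedge (enum I)) = T (qminor hI hJ).
Proof.
have uI := enum_uniq I; have uJ := enum_uniq J.
have szI : size (enum I) = m by rewrite -cardE.
have szJ : size (enum J) = m by rewrite -cardE.
(* [g] alternates the rows and [h] the columns: [g (enum J)] is the left side, and [h (enum I)] is
   the minor as it is defined. *)
pose g B := \sum_(A <- words n m) wedge (enum I) A *: xword A B.
pose h A := \sum_(B <- words n m) wedge (enum J) B *: xword A B.
have wI : enum I = perm_word (set_nth hI) 1%g by rewrite perm_word1 map_set_nth.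
have wJ : enum J = perm_word (set_nth hJ) 1%g by rewrite perm_word1 map_set_nth.
have hE : h (enum I) = T (qminor hI hJ).
  by rewrite T_qminor /h {1}wJ wedge_sum //; exact: set_nth_incr.
have g_anti p B : size B = m -> (p.+1 < m)%N ->
    hecke p g B = - (q ^+ 2)^-1 *: g B.
  move=> szB pm; rewrite -{1}szI in pm.
  have := phi_wedge_anti uI (etrans szB (esym szI)) pm.
  rewrite /phi szB => <-; apply: eq_hecke => B' szB'.
  by rewrite /g szB' szB.
have h_anti p A : size A = m -> (p.+1 < m)%N ->
    hecke p h A = - (q ^+ 2)^-1 *: h A.
  move=> szA pm.
  rewrite /h hecke_sum.
  rewrite (eq_big_words (h := fun B => wedge (enum J) B *: hecke p (xword A) B)); last first.
    by move=> B szB; rewrite -hecke_xword ?szA.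
  rewrite -(hecke_adjoint _ p m (wedge (enum J))) scaler_sumr.
  apply: eq_big_words => B szB.
  by rewrite (wedge_anti q2_neq0 uJ) ?szJ // scalerA.
have gs s : g (perm_word (set_nth hJ) s) = (- q ^+ 2) ^+ perm_length s *: g (enum J).
  have incrJ := @set_nth_incr n m J hJ.
  rewrite (antisym_sort g_anti) ?size_perm_word //; last first.
    by rewrite map_inj_uniq ?enum_uniq // => a b /(incr_inj incrJ) /perm_inj.
  rewrite (inversions_perm_word incrJ); congr (_ *: g _).
  apply: (sorted_eq (@leI_trans n) (@leI_anti n)).
  - exact: sort_sorted (@leI_total n) _.
  - exact: ltI_sorted_leI (enum_set_sorted J).
  rewrite perm_sort wJ; apply/perm_eq_perm_word; by exists s.
have hs s : h (perm_word (set_nth hI) s) = (- q ^+ 2) ^+ perm_length s *: h (enum I).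
  have incrI := @set_nth_incr n m I hI.
  rewrite (antisym_sort h_anti) ?size_perm_word //; last first.
    by rewrite map_inj_uniq ?enum_uniq // => a b /(incr_inj incrI) /perm_inj.
  rewrite (inversions_perm_word incrI); congr (_ *: h _).
  apply: (sorted_eq (@leI_trans n) (@leI_anti n)).
  - exact: sort_sorted (@leI_total n) _.
  - exact: ltI_sorted_leI (enum_set_sorted I).
  rewrite perm_sort wI; apply/perm_eq_perm_word; by exists s.
have gE : phi (enum J) (wedge (enum I)) = g (enum J) by rewrite /phi szJ.
rewrite gE -hE; apply: (scalerI (sum_sign_sq_neq0 m)).
transitivity (\sum_(B <- words n m) wedge (enum J) B *: g B).
  rewrite wJ wedge_sum -?wJ; last exact: set_nth_incr.
  by rewrite scaler_suml; apply: eq_bigr => s _; rewrite gs scalerA.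
transitivity (\sum_(A <- words n m) wedge (enum I) A *: h A); last first.
  rewrite wI wedge_sum -?wI; last exact: set_nth_incr.
  by rewrite scaler_suml; apply: eq_bigr => s _; rewrite hs scalerA.
rewrite (eq_bigr (fun B => \sum_(A <- words n m)
    (wedge (enum J) B * wedge (enum I) A) *: xword A B)) => [|B _]; last first.
  by rewrite scaler_sumr; apply: eq_bigr => A _; rewrite scalerA.
rewrite exchange_big; apply: eq_bigr => A _ /=.
by rewrite scaler_sumr; apply: eq_bigr => B _; rewrite scalerA mulrC.
Qed.

End Minors.

(** * Blocks *)

Section Blocks.
Variables (n t : nat) (k : 'I_t -> nat).
Hypothesis hk : (\sum_(r < t) k r = n)%N.
Local Notation psum := (partial_sum k).
Local Notation block := (block n k).
Local Notation Theta := (Theta n k).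

Lemma partial_sum_mono i j : (i <= j)%N -> (psum i <= psum j)%N.
Proof.
move=> ij; rewrite /partial_sum [leqRHS](bigID (fun r : 'I_t => r < i)%N) /=.
apply: leq_trans (leq_addr _ _); apply/eq_leq/eq_bigl => r.
by case: (ltnP r i) => [ri|]; rewrite ?andbF // andbT (leq_trans ri).
Qed.

Lemma partial_sum0 : psum 0 = 0%N.
Proof. by rewrite /partial_sum big_pred0. Qed.

Lemma partial_sum_total : psum t = n.
Proof. by rewrite -hk /partial_sum; apply: eq_bigl => r; rewrite ltn_ord. Qed.

Lemma block_exists (i : 'I_n) : exists s, i \in block s.
Proof.
have ex : exists r, (i < psum r)%N by exists t; rewrite partial_sum_total.
case: (ex_minnP ex) => -[|r]; first by rewrite partial_sum0.
move=> ir rmin; have rt : (r < t)%N.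
  by have := rmin t; rewrite partial_sum_total ltn_ord => /(_ isT).
exists (Ordinal rt); rewrite inE /= ir andbT leqNgt.
by apply: contraTN isT => /rmin; rewrite ltnn.
Qed.

Lemma block_adjacent (a : 'I_n.-1) (i j : 'I_n) s : i = a :> nat -> j = a.+1 :> nat ->
  a \in Theta -> (i \in block s) = (j \in block s).
Proof.
move=> ia ja; rewrite !inE ia ja => /existsPn aT; apply/andP/andP => -[sa as1]; split.
- exact: leqW.
- rewrite ltn_neqAle as1 andbT; apply/eqP => e.
  (* [Theta] excludes the end of a block only when another block follows; the last end is n, out of
     reach since [j] is an index. *)
  have [st|ts] := ltnP s.+1 t.
    by have := aT (Ordinal st); rewrite /= e eqxx.
  have e' : s.+1 = t by apply/eqP; rewrite eqn_leq ts ltn_ord.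
  by have := ltn_ord j; rewrite ja e e' partial_sum_total ltnn.
- rewrite leqNgt; apply/negP => lt.
  have e : a.+1 = psum s by apply/eqP; rewrite eqn_leq lt sa.
  have := aT s; rewrite e eqxx andbT -eqn0Ngt => /eqP s0.
  by move: e; rewrite s0 partial_sum0.
- exact: leq_trans as1.
Qed.

Lemma adjacent_Theta (a : 'I_n.-1) (i j : 'I_n) s : i = a :> nat -> j = a.+1 :> nat ->
  i \in block s -> j \in block s -> a \in Theta.
Proof.
move=> ia ja; rewrite !inE ia ja => /andP[sa _] /andP[_ as1].
apply/existsPn => r; rewrite negb_and orbC; apply/orP; left; apply/eqP => e.
case: (ltnP s r) => [/partial_sum_mono|/partial_sum_mono].
  by rewrite -e leqNgt as1.
by rewrite -e ltnNge sa.
Qed.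

Lemma block_convex s (i j : 'I_n) (l : 'I_n) : i \in block s -> j \in block s ->
  (i <= l <= j)%N -> l \in block s.
Proof.
rewrite !inE => /andP[si _] /andP[_ js] /andP[il lj].
by rewrite (leq_trans si il) (leq_ltn_trans lj js).
Qed.

Local Notation wedge := (wedge (q ^+ 2)).
Local Notation bwedge s := (wedge (enum (block s))).
Local Notation hecke := (hecke (q ^+ 2)).

Lemma size_enum_block s : size (enum (block s)) = k s.
Proof. by rewrite -cardE card_block. Qed.

(** The letters of weight q and q^-1 lie both in the block or both outside it. *)
Lemma kappaw_block a s : a \in Theta -> kappaw a (enum (block s)) = 1.
Proof.
move=> aT.
have la : (a < n)%N by apply: leq_trans (ltn_ord a) (leq_pred n).
have la1 : (a.+1 < n)%N by move: (ltn_ord a); rewrite ltn_predRL.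
pose i := Ordinal la; pose j := Ordinal la1.
have ij : j != i by rewrite -val_eqE /= eqn_leq ltnn.
have adj : (i \in block s) = (j \in block s) by apply: block_adjacent aT.
have kap1 (l : 'I_n) : l != i -> l != j -> kappa a l = 1.
  by rewrite -!val_eqE /kappa /= => /negbTE -> /negbTE ->.
rewrite /kappaw big_enum /=; case: (boolP (i \in block s)) => ib; last first.
  rewrite big1 // => l lb; apply: kap1; apply: contraNneq ib => e.
    by rewrite -e.
  by rewrite adj -e.
rewrite (bigD1 i) //= (bigD1 j) ?adj //=; last by rewrite -adj ib.
rewrite big1 => [|l /andP[/andP[_ li] lj]]; last exact: kap1.
rewrite mulr1 /kappa /= eqxx eqn_leq ltnn /= eqxx.
exact: (mulfV q_neq0).
Qed.

(** * Invariance of the q-wedge of a block *)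

Section Invariance.
Variables (HU : Uq_hopf n) (HO : OqSL_bialgebra n) (V : natural_rep n).
Variable P : hopf_pairing HU HO V.

(** The result is q-antisymmetric, since [u] commutes with the Hecke operators, so it vanishes on
    words with a repetition. The other words receive nothing: replacing a letter of an arrangement
    of the block by another letter of the block creates a repetition. *)
Lemma wact_wedge_eq0 u s :
  (forall I J, size I = size J -> pword P u I J != 0 ->
     exists A i j B, [/\ I = A ++ i :: B, J = A ++ j :: B, i != j
       & (i \in block s) = (j \in block s)]) ->
  forall K, size K = k s -> wact P u (bwedge s) K = 0.
Proof.
move=> usupp; have ub := enum_uniq (block s).
have anti p J : size J = k s -> (p.+1 < k s)%N ->
    hecke p (wact P u (bwedge s) : _ -> Qq^o) J
    = - (q ^+ 2)^-1 *: (wact P u (bwedge s) J : Qq^o).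
  move=> szJ ps; rewrite -wact_hecke.
  rewrite (eq_wact P u (w := fun I => - (q ^+ 2)^-1 * bwedge s I + 0)).
    rewrite wact_linear /wact [X in _ + X = _]big1 ?addr0 // => I _.
    by rewrite mul0r.
  move=> I szI; rewrite addr0 (wedge_anti q2_neq0 ub) ?szI ?szJ ?size_enum_block //.
move=> K szK; have [uK|nuK] := boolP (uniq K); last first.
  exact: (antisym_eq0 q2V_neq0 anti szK nuK).
rewrite /wact big1_seq // => I /=; rewrite mem_words => /eqP szI.
apply/eqP; rewrite mulf_eq0; apply/norP => -[wI pI].
have [A [i [j [B [eI eK ij adj]]]]] := usupp I K szI pI.
have pe : perm_eq I (enum (block s)).
  by apply: contraNT wI => /negbTE npe; rewrite /wedge npe.
have ib : i \in block s by rewrite -mem_enum -(perm_mem pe) eI mem_cat inE eqxx orbT.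
have : j \in I by rewrite (perm_mem pe) mem_enum -adj.
move: uK; rewrite eK eI cat_uniq /= negb_or mem_cat inE eq_sym (negbTE ij) /=.
by case/and3P => _ /andP[/negbTE -> _] /andP[/negbTE -> _].
Qed.

Lemma wedge_invariant s : invariant_word P Theta (k s) (bwedge s).
Proof.
move=> a aT K szK; split.
- apply: wact_wedge_eq0 szK => I J szI pE.
  have [A [i [j [B [-> -> ia ja]]]]] := pword_E_support szI pE.
  exists A, i, j, B; split=> //; last exact: block_adjacent aT.
  by rewrite -val_eqE /= ia ja eqn_leq ltnn andbF.
- apply: wact_wedge_eq0 szK => I J szI pF.
  have : pword P (Egen a) J I != 0.
    rewrite (pword_E_tr P a (esym szI)); apply: mulf_neq0; first exact: q2_neq0.
    by apply: mulf_neq0 pF; apply: expf_neq0; exact: kappaw_neq0.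
  move=> pE; have [A [j [i [B [-> -> ja ia]]]]] := pword_E_support (esym szI) pE.
  exists A, i, j, B; split=> //; last by rewrite (block_adjacent s ja ia aT).
  by rewrite -val_eqE /= ia ja eqn_leq ltnn.
rewrite (wact_diagonal _ _ (pword_K P a)) /wedge.
case: ifP => [pe|_]; last by rewrite mul0r.
by rewrite /kappaw (perm_big _ pe) -/(kappaw a _) kappaw_block // mulr1.
Qed.
End Invariance.

Local Notation minors := (block_minors hk).

(** By antisymmetry in the columns, the value is zero or a multiple of the minor on the sorted
    word. *)
Lemma phi_wedge_gen s J : size J = k s -> gen_subalg minors (phi J (bwedge s)).
Proof.
move=> szJ; have ub := enum_uniq (block s).
have anti p I : size I = k s -> (p.+1 < k s)%N ->
    hecke p ((@phi n)^~ (bwedge s)) I = - (q ^+ 2)^-1 *: phi I (bwedge s).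
  by move=> szI ps; apply: phi_wedge_anti; rewrite ?size_enum_block.
have [uJ|nuJ] := boolP (uniq J); last first.
  by rewrite (antisym_eq0 q2V_neq0 anti szJ nuJ); exact: gen_subalg0.
rewrite (antisym_sort anti szJ uJ); apply: gen_subalgZ.
have sJ : sorted (@ltI n) (sort (@leI n) J).
  have : sorted ltn (map val (sort (@leI n) J)).
    rewrite ltn_sorted_uniq_leq (map_inj_uniq val_inj) sort_uniq uJ sorted_map.
    exact: sort_sorted (@leI_total n) _.
  by rewrite sorted_map.
have hJ : #|[set x in sort (@leI n) J]| = k s.
  by rewrite cardE sorted_enum_set // size_sort.
rewrite -(sorted_enum_set sJ) (phi_wedge_qminor (card_block s hk) hJ).
by apply: gen_subalg_base; exists s, [set x in sort (@leI n) J], hJ.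
Qed.

End Blocks.

(** * The first fundamental theorem *)

Section Specialisation.
Variable n : nat.
Variables (HU : Uq_hopf n) (HO : OqSL_bialgebra n) (V : natural_rep n).
Variable P : hopf_pairing HU HO V.
Implicit Types (I J K : seq 'I_n) (w : seq 'I_n -> Qq) (u : seq 'I_n -> rat).

(** At z = 1 the coefficient z - z^-1 vanishes and the Hecke generator becomes the exchange of two
    letters. *)
Lemma spec1_hecke p w u I : (forall J, size J = size I -> spec1 (w J) (u J)) ->
  spec1 (hecke (q ^+ 2) p (w : _ -> Qq^o) I) (u (swap p I)).
Proof.
elim: p I w u => [|p IH] [|x I] w u wu /=; try exact: wu.
  case: I wu => [|y I] wu; first exact: wu.
  have sq : spec1 (q ^+ 2) 1 by rewrite -[1](expr1n _ 2); apply: spec1X; exact: spec1_q.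
  have sqV : spec1 (q ^- 2) 1.
    by rewrite -exprVn -[1](expr1n _ 2); apply: spec1X; exact: spec1_qV.
  rewrite /hecke_coef; case: eqVneq => [->|xy].
    rewrite scale0r addr0 -[u _]mul1r; apply: spec1M => //; exact: wu.
  rewrite scale1r -[u _]add0r; apply: spec1D; last exact: wu.
  rewrite -(mul0r (u (x :: y :: I))); apply: spec1M; last exact: wu.
  case: ifP => _; last exact: spec1_0.
  by rewrite -(subrr 1); apply: spec1D => //; apply: spec1N.
by apply: (IH I (fun J => w (x :: J)) (fun J => u (x :: J))) => J szJ; apply: wu; rewrite /= szJ.
Qed.

Lemma spec1_kappaw a I : spec1 (kappaw a I) 1.
Proof.
elim: I => [|i I IH]; first by rewrite /kappaw big_nil; exact: spec1_1.
rewrite kappaw_cons -[1]mul1r; apply: spec1M => //.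
rewrite /kappa; case: ifP => _; first exact: spec1_q.
by case: ifP => _; [exact: spec1_qV|exact: spec1_1].
Qed.

Lemma spec1V x : spec1 x 1 -> spec1 x^-1 1.
Proof.
move=> [p [d [d0 -> pd1]]].
have pd : p.[1] = d.[1] by rewrite -[LHS](divfK d0) -pd1 mul1r.
by exists d, p; split; [rewrite pd|rewrite invf_div|rewrite pd divff].
Qed.

(** At q = 1 the torus factor in the coproduct becomes 1, so that E_a acts as a derivation. *)
Lemma spec1_wact_E (a : 'I_n.-1) (i j : 'I_n) w u K :
  i = a :> nat -> j = a.+1 :> nat ->
  (forall I, size I = size K -> spec1 (w I) (u I)) ->
  spec1 (wact P (Egen a) w K) (polarize i j u K).
Proof.
move=> ia ja; elim: K w u => [|x K IH] w u wu.
  by rewrite /wact big_seq1 pword_E_nil mulr0; exact: spec1_0.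
rewrite -[x :: K]cat1s wact_E_cat; apply: spec1D; last first.
  rewrite -[X in spec1 _ X]mul1r; apply: spec1M.
    by rewrite -[1](expr1n _ 2); apply: spec1X; exact: spec1_kappaw.
  by apply: IH => I szI; apply: wu; rewrite /= szI.
rewrite big_words_cons (bigD1 i) //= [X in _ + X]big1 ?addr0 => [|y yi].
  rewrite big_seq1 pword1E rho_E mxE ia eqxx /= mulrC; apply: spec1M; last exact: wu.
  by rewrite -val_eqE /= ja; exact: spec1_nat.
rewrite big_seq1 pword1E rho_E mxE -ia.
by rewrite -val_eqE in yi; rewrite (negbTE yi) mulr0.
Qed.

Lemma spec1_wact_F (a : 'I_n.-1) (i j : 'I_n) w u K :
  i = a :> nat -> j = a.+1 :> nat ->
  (forall I, size I = size K -> spec1 (w I) (u I)) ->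
  spec1 (wact P (Fgen a) w K) (polarize j i u K).
Proof.
move=> ia ja; elim: K w u => [|x K IH] w u wu.
  by rewrite /wact big_seq1 pword_F_nil mulr0; exact: spec1_0.
rewrite -[x :: K]cat1s wact_F_cat; apply: spec1D; last first.
  by apply: IH => I szI; apply: wu; rewrite /= szI.
rewrite big_words_cons (bigD1 j) //= [X in _ * (_ + X)]big1 ?addr0 => [|y yj].
  rewrite big_seq1 pword1E rho_F mxE ja eqxx /= -[(x == i)%:R * _]mul1r.
  apply: spec1M.
    by apply: spec1V; rewrite -[1](expr1n _ 2); apply: spec1X; exact: spec1_kappaw.
  rewrite mulrC; apply: spec1M; last exact: wu.
  by rewrite -val_eqE /= ia; exact: spec1_nat.
rewrite big_seq1 pword1E rho_F mxE -ja.
by rewrite -val_eqE in yj; rewrite (negbTE yj) mulr0.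
Qed.

(** The powers of -q^2 given by the lengths specialise to the signs of the permutations. *)
Lemma spec1_contract m (B : {set 'I_n}) (hB : #|B| = m) w u K :
  (forall I, size I = (m + size K)%N -> spec1 (w I) (u I)) ->
  spec1 (contract m (wedge (q ^+ 2) (enum B)) w K) (alternate (set_nth hB) u K).
Proof.
move=> wu; rewrite /contract /alternate.
have wB : enum B = perm_word (set_nth hB) 1%g by rewrite perm_word1 map_set_nth.
rewrite wB.
rewrite -[X in spec1 X _]/(\sum_(A <- words n m) wedge (q ^+ 2)
  (perm_word (set_nth hB) 1%g) A *: (w (A ++ K) : Qq^o)).
rewrite wedge_sum; last exact: set_nth_incr.
apply: spec1_sum => s _; apply: spec1M; last first.
  by apply: wu; rewrite size_cat size_perm_word.
rewrite -(sign_inversions s) -[[seq s a | a <- enum 'I_m]]/(perm_word id s).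
rewrite inversions_perm_word //; apply: spec1X; apply: spec1N.
by rewrite -[1](expr1n _ 2); apply: spec1X; exact: spec1_q.
Qed.

End Specialisation.

Section FundamentalTheorem.
Variables (n t : nat) (k : 'I_t -> nat).
Hypotheses (hk1 : forall s, (1 <= k s)%N) (hk : (\sum_(r < t) k r = n)%N).
Variables (HU : Uq_hopf n) (HO : OqSL_bialgebra n) (V : natural_rep n).
Variable P : hopf_pairing HU HO V.
Local Notation Theta := (Theta n k).
Local Notation block := (block n k).
Local Notation minors := (block_minors hk).
Local Notation bwedge s := (wedge (q ^+ 2) (enum (block s))).
Local Notation invariant m := (invariant_word P Theta m).
Local Notation hecke := (hecke (q ^+ 2)).

Lemma phi_tensor m d v (J1 J2 : seq 'I_n) : size J1 = m ->
  phi (J1 ++ J2) (fun I => d (take m I) * v (drop m I)) = phi J1 d * phi J2 v.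
Proof.
move=> sz1; rewrite /phi size_cat sz1 big_words_cat mulr_suml.
apply: eq_big_words => A szA; rewrite mulr_sumr; apply: eq_big_words => B szB.
rewrite take_size_cat // drop_size_cat // matrix_word_cat ?szA //.
by rewrite -scalerAl -scalerAr scalerA.
Qed.

(** * The inductive step in degree m *)

Section Degree.
Variable m : nat.
Hypothesis IHm : forall m', (m' < m)%N -> forall v, invariant m' v ->
  forall J, size J = m' -> gen_subalg minors (phi J v).

Definition generating v := invariant m v /\
  forall J, size J = m -> gen_subalg minors (phi J v).

Lemma generating0 : generating (fun=> 0).
Proof.
split; first exact: invariant0.
by move=> J _; rewrite phi0; exact: gen_subalg0.
Qed.

Lemma generating_linear a v w : generating v -> generating w -> generating (fun I => a * v I + w I).
Proof.
move=> [vi vg] [wi wg]; split; first exact: invariant_linear.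
by move=> J szJ; rewrite phi_linear; apply: gen_subalg_lin; [exact: vg|exact: wg].
Qed.

Lemma generating_hecke p v : generating v -> generating (hecke p (v : _ -> Qq^o)).
Proof.
move=> [vi vg]; split; first exact: invariant_hecke.
move=> J szJ; rewrite phi_hecke; apply: gen_subalg_hecke => J' szJ'.
by apply: vg; rewrite szJ'.
Qed.

(** [phi] is multiplicative on tensor products: the wedge yields a minor, and the induction
    hypothesis covers [v], whose degree is smaller because the blocks are nonempty. *)
Lemma generating_tensor s m' v : (k s + m')%N = m -> invariant m' v ->
  generating (fun I => bwedge s (take (k s) I) * v (drop (k s) I)).
Proof.
move=> km vi; split.
  by rewrite -km; apply: invariant_tensor vi; exact: wedge_invariant.
move=> J szJ; have sz1 : size (take (k s) J) = k s.
  by rewrite size_takel // szJ -km leq_addr.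
rewrite -(cat_take_drop (k s) J) phi_tensor //; apply: gen_subalg_mul.
  exact: phi_wedge_gen.
apply: (IHm (m' := m')) => //; first by rewrite -km -[ltnLHS]add0n ltn_add2r hk1.
by rewrite size_drop szJ -km addKn.
Qed.

Definition orthogonal v := invariant m v /\
  forall y, generating y -> \sum_(I <- words n m) v I * y I = 0.

Lemma orthogonalZ a v : orthogonal v -> orthogonal (fun I => a * v I).
Proof.
move=> [vi vo]; split.
  have e : (fun I => a * v I) = (fun I => a * v I + 0).
    by apply/funext => I; rewrite addr0.
  by rewrite e; apply: invariant_linear => //; exact: invariant0.
move=> y gy; transitivity (a * \sum_(I <- words n m) v I * y I).
  by rewrite mulr_sumr; apply: eq_bigr => I _; rewrite mulrA.
by rewrite vo // mulr0.
Qed.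

Lemma orthogonal_hecke p v : orthogonal v -> orthogonal (hecke p (v : _ -> Qq^o)).
Proof.
move=> [vi vo]; split; first exact: invariant_hecke.
move=> y gy; apply: etrans (hecke_adjoint _ p m v (y : _ -> Qq^o)) _.
by apply: (vo (hecke p (y : _ -> Qq^o))); exact: generating_hecke.
Qed.

(* The contraction of v with the wedge of a block is again invariant, so its
   product with that wedge is generating; orthogonality then makes it of norm zero. *)
Lemma orthogonal_contract s v K : orthogonal v -> (k s + size K)%N = m ->
  contract (k s) (bwedge s) v K = 0.
Proof.
move=> [vi vo] km; set c := contract _ _ _.
have ci : invariant (size K) c.
  by apply: (invariant_contract (k := k s)); [exact: wedge_invariant|rewrite km].
have := vo _ (generating_tensor km ci); rewrite -km big_words_cat exchange_big /=.
rewrite (eq_big_words (h := fun B => c B * c B)) => [|B szB].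
  by move=> /sum_sq_eq0; apply; rewrite mem_words.
rewrite mulr_suml; apply: eq_big_words => A szA.
by rewrite take_size_cat // drop_size_cat // mulrA [v _ * _]mulrC.
Qed.

(** The rational tensors arising from orthogonal vectors at q = 1; this is the class [G] fed to the
    classical descent. *)
Definition orthogonal_spec u := exists2 w, orthogonal w &
  forall I, size I = m -> spec1 (w I) (u I).

Lemma orthogonal_spec_swap u p : orthogonal_spec u -> orthogonal_spec (fun I => u (swap p I)).
Proof.
move=> [w bw wu]; exists (hecke p (w : _ -> Qq^o)); first exact: orthogonal_hecke.
by move=> I szI; apply: spec1_hecke => J szJ; apply: wu; rewrite szJ.
Qed.

(** For neighbouring indices this is the value at q = 1 of the invariance under E_a and F_a; the
    general case follows by commutators, by induction on the distance between the indices. *)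
Lemma orthogonal_spec_polarize s u (i j : 'I_n) K : orthogonal_spec u -> size K = m ->
  i \in block s -> j \in block s -> i != j -> polarize i j u K = 0.
Proof.
move=> [w [wi _] wu].
suff main d (i0 j0 : 'I_n) : (j0 = i0 + d.+1 :> nat)%N -> i0 \in block s ->
    j0 \in block s -> forall K, size K = m ->
    polarize i0 j0 u K = 0 /\ polarize j0 i0 u K = 0.
  move=> szK ib jb; rewrite -val_eqE; case: ltngtP => // ij _.
    have e : (j = i + (j - i).-1.+1 :> nat)%N by rewrite prednK ?subn_gt0 // subnKC // ltnW.
    by have [] := main _ _ _ e ib jb K szK.
  have e : (i = j + (i - j).-1.+1 :> nat)%N by rewrite prednK ?subn_gt0 // subnKC // ltnW.
  by have [] := main _ _ _ e jb ib K szK.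
have adj (i1 j1 : 'I_n) : j1 = i1.+1 :> nat -> i1 \in block s -> j1 \in block s ->
    forall K, size K = m -> polarize i1 j1 u K = 0 /\ polarize j1 i1 u K = 0.
  move=> ij ib jb I szI; have lt_in : (i1 < n.-1)%N by rewrite ltn_predRL -ij ltn_ord.
  pose a : 'I_n.-1 := Ordinal lt_in.
  have aT : a \in Theta by apply: adjacent_Theta ib jb.
  have [wE wF _] := wi a aT I szI.
  have wuI J : size J = size I -> spec1 (w J) (u J) by rewrite szI; apply: wu.
  have := spec1_wact_E P (erefl : i1 = a :> nat) ij wuI.
  have := spec1_wact_F P (erefl : i1 = a :> nat) ij wuI.
  by rewrite wE wF => /(spec1_inj spec1_0) <- /(spec1_inj spec1_0) <-.
elim: d i0 j0 {i j K} => [|d IH] i j ij ib jb.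
  by apply: adj => //; rewrite ij addn1.
have lt_ln : (i.+1 < n)%N.
  by apply: leq_ltn_trans (ltn_ord j); rewrite ij -addn1 leq_add2l.
pose l : 'I_n := Ordinal lt_ln.
have jl : (j = l + d.+1 :> nat)%N by rewrite ij addSnnS.
have lb : l \in block s by apply: block_convex ib jb _; rewrite /= leqnSn jl leq_addr.
have il0 := adj i l erefl ib lb; have lj0 := IH l j jl lb jb.
have ij' : i != j by rewrite -val_eqE /= ij -{1}[val i]addn0 eqn_add2l.
have pol0 b c (v : seq 'I_n -> rat) : (forall I, size I = m -> v I = 0) -> forall I, size I = m ->
    polarize b c v I = 0.
  move=> v0 I szI; rewrite -(polarize0 rat b c I); apply: eq_polarize => J szJ.
  by rewrite v0 // szJ.
have il1 I : size I = m -> polarize i l u I = 0 by move=> /il0[].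
have il2 I : size I = m -> polarize l i u I = 0 by move=> /il0[].
have lj1 I : size I = m -> polarize l j u I = 0 by move=> /lj0[].
have lj2 I : size I = m -> polarize j l u I = 0 by move=> /lj0[].
move=> K szK; split.
  have := @polarize_commutator n rat i l j u K ij'.
  by rewrite (pol0 _ _ _ il1 K szK) (pol0 _ _ _ lj1 K szK) add0r.
rewrite eq_sym in ij'; have := @polarize_commutator n rat j l i u K ij'.
by rewrite (pol0 _ _ _ lj2 K szK) (pol0 _ _ _ il2 K szK) add0r.
Qed.

(** Rescaling gives a nonzero rational tensor [u] at q = 1. On a word where [u] is nonzero, the
    descent along the block of the first letter gives a contradiction. *)
Lemma orthogonal_eq0 v : (0 < m)%N -> orthogonal v -> forall I, size I = m -> v I = 0.
Proof.
move=> m0 bv I0 szI0; apply/eqP/negPn/negP => vI0.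
have mI0 : I0 \in words n m by rewrite mem_words szI0.
have [c [u [_ vu [I mI uI]]]] := spec1_scale mI0 vI0.
have bu : orthogonal_spec u.
  exists (fun I => c * v I); first exact: orthogonalZ.
  by move=> J szJ; apply: vu; rewrite mem_words szJ.
move: mI uI; rewrite mem_words => /eqP szI /eqP; apply.
case: I szI => [|x I] szI; first by move: m0; rewrite -szI.
have [s xs] := block_exists hk x.
pose b := set_nth (card_block s hk).
have bb i : b i \in block s by rewrite -mem_enum -(map_set_nth (card_block s hk)) map_f // mem_enum.
have [j bj] : exists j, b j = x.
  move: xs; rewrite -mem_enum -(map_set_nth (card_block s hk)) => /mapP[j _ ->].
  by exists j.
have b_inj : injective b by apply: incr_inj; exact: set_nth_incr.
apply: (@alternate_descent_letter n rat m orthogonal_spec _ b _ b_inj _ _ u (x :: I) j bu szI).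
- by move=> w p; apply: orthogonal_spec_swap.
- by move=> w i1 i2 K bw szK i12; apply: (orthogonal_spec_polarize bw szK (bb _) (bb _)); rewrite (inj_eq b_inj).
- move=> w K [w' bw' w'w] szK; apply: (spec1_inj _ spec1_0).
  rewrite -(orthogonal_contract bw' szK); apply: spec1_contract => J szJ.
  by apply: w'w; rewrite szJ.
- by rewrite bj mem_head.
Qed.

End Degree.

(** The part of [v] orthogonal to the generating vectors vanishes in positive degree, so [v] is
    itself generating; in degree 0 the value of [phi] is a scalar. *)
Lemma invariant_phi_gen m v : invariant m v ->
  forall J, size J = m -> gen_subalg minors (phi J v).
Proof.
elim/ltn_ind: m v => m IHm v vi J szJ.
have [m0|m_gt0] := posnP m.
  have -> : J = [::] by apply/size0nil; rewrite szJ.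
  by rewrite /phi big_seq1; apply: gen_subalgZ; exact: gen_subalg_one.
have [z gz vz] := orthogonal_decomposition (words n m) (@sum_sq_eq0 _) (generating0 m)
  (@generating_linear m) v.
have bvz : orthogonal m (fun I => -1 * z I + v I).
  split; first by apply: invariant_linear vi; exact: gz.1.
  move=> y gy; apply: etrans (vz y gy); apply: eq_bigr => I _.
  by rewrite mulN1r addrC.
have vE I : size I = m -> v I = z I.
  move=> szI; have := orthogonal_eq0 IHm m_gt0 bvz szI.
  by rewrite mulN1r addrC => /eqP; rewrite subr_eq0 => /eqP.
rewrite (eq_phi (w := z)) => [|I szI]; first exact: gz.2.
by apply: vE; rewrite szI.
Qed.

End FundamentalTheorem.

(** * Lifting invariants to words *)

Section Spanning.
Variable n : nat.
Local Notation xword := (matrix_word (@xSL n)).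
Local Notation free := (freeAlg Qq ('I_n * 'I_n)%type).

(** [c] is defined on all pairs of words, of which [psi M] sees only those of equal length below
    [M]. *)
Definition psi M (c : seq 'I_n * seq 'I_n -> Qq) : OqSL n :=
  \sum_(0 <= m < M) \sum_(J <- words n m) phi J (fun I => c (I, J)).

Lemma psi_linear M a c d :
  psi M (fun p => a * c p + d p) = a *: psi M c + psi M d.
Proof.
rewrite /psi scaler_sumr -big_split; apply: eq_bigr => m _ /=.
rewrite scaler_sumr -big_split; apply: eq_bigr => J _ /=.
exact: phi_linear.
Qed.

Lemma psi_widen M M' c : (M <= M')%N ->
  psi M c = psi M' (fun p => if (size p.2 < M)%N then c p else 0).
Proof.
move=> MM'; rewrite /psi (big_cat_nat (leq0n M) MM') /= [X in _ = _ + X]big_nat_cond.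
rewrite [X in _ = _ + X]big1 ?addr0 => [|m /andP[/andP[Mm _] _]].
  rewrite big_nat_cond [RHS]big_nat_cond; apply: eq_bigr => m /andP[/andP[_ mM] _].
  by apply: eq_big_words => J szJ; apply: eq_phi => I szI; rewrite /= szJ mM.
rewrite (eq_big_words (h := fun=> 0)) ?big1 // => J szJ.
rewrite -(phi0 J); apply: eq_phi => I _ /=.
by rewrite szJ ltnNge Mm.
Qed.

Definition spanned (f : OqSL n) := exists M c, f = psi M c.

Lemma spanned_lin a f g : spanned f -> spanned g -> spanned (a *: f + g).
Proof.
move=> [M [c ->]] [M' [d ->]].
rewrite (psi_widen c (leq_maxl M M')) (psi_widen d (leq_maxr M M')) -psi_linear.
by exists (maxn M M'); eexists.
Qed.

Lemma spanned0 : spanned 0.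
Proof. by exists 0%N, (fun=> 0); rewrite /psi big_geq. Qed.

Lemma spanned_xword I J : size I = size J -> spanned (xword I J).
Proof.
move=> eqIJ; exists (size J).+1, (fun p => if I == p.1 then if J == p.2 then 1 else 0 else 0).
rewrite /psi big_nat_recr //= big_nat_cond big1 ?add0r => [|m /andP[/andP[_ mJ] _]].
  rewrite (eq_big_words (h := fun J' => if J == J' then xword I J' else 0)).
    exact: (esym (big_words_delta (fun J' => xword I J') (erefl (size J)))).
  move=> J' szJ'; rewrite /phi szJ'.
  rewrite (eq_big_words (h := fun I' => if I == I' then
     (if J == J' then xword I' J' else 0) else 0)).
    by rewrite (big_words_delta (fun I' => if J == J' then xword I' J' else 0)).
  move=> I' _; case: (I == I'); last by rewrite scale0r.
  by case: (J == J'); rewrite ?scale0r ?scale1r.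
rewrite (eq_big_words (h := fun=> 0)) ?big1 // => J' szJ'.
rewrite -(phi0 J'); apply: eq_phi => I' _ /=.
case: eqP => // _; case: eqP => // eJ; move: mJ; by rewrite eJ szJ' ltnn.
Qed.

Definition from_free (z : free) : OqSL n := T (quot_pi (@OqM_rel n) z).

Lemma from_freeM y z : from_free (y * z) = from_free y * from_free z.
Proof. by rewrite /from_free OqM_pi_mul T_mul. Qed.

Lemma from_free_linear : linear from_free.
Proof. by move=> c y z; rewrite /from_free OqM_pi_add OqM_pi_scale T_linear. Qed.

Lemma from_free_word (s : seq ('I_n * 'I_n)) :
  from_free (mkmalgU (FMonom s) 1) = xword (unzip1 s) (unzip2 s).
Proof.
elim: s => [|[i j] s IH] /=.
  have -> : mkmalgU (FMonom [::]) 1 = 1 :> free.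
    by congr mkmalgU; apply: val_inj; rewrite /= fm1.
  by [].
have -> : mkmalgU (FMonom ((i, j) :: s)) 1
    = fgen Qq (i, j) * mkmalgU (FMonom s) 1 :> free.
  apply: esym; apply: etrans (fgmulUU _ _ _ _) _; rewrite mulr1.
  by congr mkmalgU; apply: val_inj; rewrite /= fmM fmuE.
by rewrite from_freeM IH.
Qed.

Lemma OqSL_spanned f : spanned f.
Proof.
have [z ->] : exists z, f = from_free z.
  (* Two choices of representatives, one for each quotient: by the determinant relation, then by the
     relations of quantum matrices. *)
  exists (repr (repr f)); apply: esym; rewrite /from_free.
  by apply: etrans (quot_piK f); congr (T _); exact: quot_piK.
rewrite (monalgE z) (big_linear _ _ _ from_free_linear).
elim/big_rec: _ => [|k g _ sg]; first exact: spanned0.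
have -> : mkmalgU k z@_k = z@_k *: (mkmalgU k 1 : free).
  by apply/malgP => l; rewrite mcoeffZ !mcoeffU mulrnAr mulr1.
rewrite (scalable_linear from_free_linear); apply: spanned_lin => //.
case: k => s; rewrite from_free_word; apply: spanned_xword.
by rewrite !size_map.
Qed.

End Spanning.

(** * Lifting invariant functions to invariant coefficients *)

Section Lifting.
Variable n : nat.
Variables (HU : Uq_hopf n) (HO : OqSL_bialgebra n) (V : natural_rep n).
Variable P : hopf_pairing HU HO V.
Implicit Types (u : Uq n) (a : 'I_n.-1) (f g : OqSL n).
Local Notation wact := (wact P).
Local Notation Ract := (Ract P).
Local Notation xword := (matrix_word (@xSL n)).

Definition lact u (c : seq 'I_n * seq 'I_n -> Qq) (p : seq 'I_n * seq 'I_n) : Qq :=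
  wact u (fun I => c (I, p.2)) p.1.

Lemma Ract_psi u M c : Ract u (psi M c) = psi M (lact u c).
Proof.
rewrite /psi (big_linear _ _ _ (Ract_linear P u)); apply: eq_bigr => m _.
rewrite (big_linear _ _ _ (Ract_linear P u)); apply: eq_bigr => J _.
exact: Ract_phi.
Qed.

Lemma eq_psi M (c d : seq 'I_n * seq 'I_n -> Qq) : (forall I J, size I = size J -> c (I, J) = d (I, J)) ->
  psi M c = psi M d.
Proof.
move=> cd; apply: eq_bigr => m _; apply: eq_bigr => J _; apply: eq_phi => I szI.
exact: cd.
Qed.

Lemma wact1 v K : wact 1 v K = v K.
Proof.
rewrite (wact_diagonal (d := fun=> 1)) ?mulr1 // => I J szI.
by rewrite pword1 //; case: eqP.
Qed.

Lemma Ract1 f : Ract 1 f = f.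
Proof.
have [M [c ->]] := OqSL_spanned f; rewrite Ract_psi; apply: eq_psi => I J _.
by rewrite /lact wact1.
Qed.

(** The words span, and on them the action is given by the matrices [pword], which are
    multiplicative. *)
Lemma RactM u v f : Ract (u * v) f = Ract v (Ract u f).
Proof.
have [M [c ->]] := OqSL_spanned f; rewrite !Ract_psi; apply: eq_psi => I J _.
by rewrite /lact wactM.
Qed.

Lemma Ract_linear_l c u v f : Ract (c *: u + v) f = c *: Ract u f + Ract v f.
Proof.
rewrite /Ract /tens_lift scaler_sumr -big_split; apply: eq_bigr => p _ /=.
by rewrite pairing_linr scalerDl scalerA.
Qed.

Lemma RactN u f : Ract (- u) f = - Ract u f.
Proof.
have := Ract_linear_l (-1) u u f; rewrite !scaleN1r addNr => e.
have r0 : Ract 0 f = 0 by rewrite e addNr.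
by have := Ract_linear_l (-1) u 0 f; rewrite r0 !addr0 !scaleN1r.
Qed.

Lemma Ract_scale u c f : Ract u (c *: f) = c *: Ract u f.
Proof. exact: (scalable_linear (Ract_linear P u)). Qed.

Lemma Ract0 u : Ract u 0 = 0.
Proof. by rewrite -(scale0r (0 : OqSL n)) Ract_scale !scale0r. Qed.

Lemma Ract_one u : Ract u 1 = UqEps HU u *: 1.
Proof.
have := Ract_xword P u (erefl (size ([::] : seq 'I_n))).
by rewrite /= big_seq1 pword_nil.
Qed.

Lemma Ract_mul u f g : Ract u (f * g) =
  \sum_(p <- repr (OqDelta HO f)) \sum_(r <- repr (OqDelta HO g))
     pairing P (p.1 * r.1) u *: (p.2 * r.2).
Proof.
rewrite /Ract (OqDelta_morph HO).2 -{1}(tens_piK (OqDelta HO f)).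
rewrite -{1}(tens_piK (OqDelta HO g)).
apply: etrans (congr1 _ (tens_mulE _ _)) _.
rewrite tens_lift_pi; last exact: Ract_bilinear.
by rewrite big_allpairs_dep.
Qed.

Lemma Ract_mul_split u u1 u2 v1 v2 f g :
  (forall x y, pairing P (x * y) u
     = pairing P x u1 * pairing P y v1 + pairing P x u2 * pairing P y v2) ->
  Ract u (f * g) = Ract u1 f * Ract v1 g + Ract u2 f * Ract v2 g.
Proof.
move=> uE; rewrite Ract_mul /Ract /tens_lift !mulr_suml -big_split.
apply: eq_bigr => p _ /=; rewrite !mulr_sumr -big_split; apply: eq_bigr => r _ /=.
by rewrite uE scalerDl -!scalerAl -!scalerAr !scalerA.
Qed.

Lemma Ract_E_mul a f g : Ract (Egen a) (f * g)
  = Ract (Egen a) f * Ract 1 g + Ract (Kgen a ^+ 2) f * Ract (Egen a) g.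
Proof. by apply: Ract_mul_split => x y; exact: pairing_mulE. Qed.

Lemma Ract_F_mul a f g : Ract (Fgen a) (f * g)
  = Ract (Fgen a) f * Ract (KVgen a ^+ 2) g + Ract 1 f * Ract (Fgen a) g.
Proof. by apply: Ract_mul_split => x y; exact: pairing_mulF. Qed.

(* u' is, up to the scalar c, the transpose of u on tensor powers of the natural
   representation. *)
Definition transposed u c u' := forall m (v w : seq 'I_n -> Qq),
  \sum_(K <- words n m) wact u v K * w K
  = \sum_(I <- words n m) v I * (c * wact u' w I).

Lemma transposedP u c u' :
  (forall I J, size I = size J -> pword P u I J = c * pword P u' J I) ->
  transposed u c u'.
Proof.
move=> uu' m v w.
rewrite (eq_big_words (h := fun K => \sum_(I <- words n m) v I * (c * (w K * pword P u' K I)))).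
  rewrite exchange_big; apply: eq_big_words => I szI.
  by rewrite -mulr_sumr -mulr_sumr /wact szI.
move=> K szK; rewrite /wact szK mulr_suml; apply: eq_big_words => I szI.
rewrite uu' ?szI // -!mulrA; congr (_ * (_ * _)); exact: mulrC.
Qed.

Lemma pword_diagonal_mul u v d I J : diagonal P u d -> size I = size J ->
  pword P (u * v) I J = d I * pword P v I J.
Proof.
move=> ud szI; rewrite pword_mul //.
rewrite (eq_big_words (h := fun K => if I == K then d I * pword P v I J else 0)).
  by rewrite (big_words_delta (fun=> d I * pword P v I J)).
by move=> K szK; rewrite ud //; case: eqP => [<-|]; rewrite ?mul0r.
Qed.

Lemma pword_mul_diagonal u v d I J : diagonal P v d -> size I = size J ->
  pword P (u * v) I J = pword P u I J * d J.
Proof.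
move=> vd szI; rewrite pword_mul //.
rewrite (eq_big_words (h := fun K => if J == K then pword P u I J * d J else 0)).
  by rewrite (big_words_delta (fun=> pword P u I J * d J)).
move=> K szK; rewrite vd ?szK // eq_sym; case: eqP => [->|]; rewrite ?mulr0 //.
Qed.

Lemma transposed_E a : transposed (Egen a) (q ^+ 2) (Kgen a ^+ 2 * Fgen a).
Proof.
apply: transposedP => I J szI; rewrite (pword_E_tr P a szI); congr (_ * _).
rewrite (pword_diagonal_mul _ (diagonalM (@pword_K _ _ _ _ P a) (@pword_K _ _ _ _ P a))) //.
Qed.

Lemma transposed_F a : transposed (Fgen a) (q ^- 2) (Egen a * KVgen a ^+ 2).
Proof.
apply: transposedP => I J szI.
have szJ := esym szI.
rewrite (pword_mul_diagonal _ (diagonalM (@pword_KV _ _ _ _ P a) (@pword_KV _ _ _ _ P a)) szJ).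
have k2 : kappaw a I ^+ 2 != 0 by apply: expf_neq0; exact: kappaw_neq0.
rewrite (pword_E_tr P a szJ) -invfM -expr2 -mulrA (mulKf q2_neq0).
by rewrite mulrAC (mulfV k2) mul1r.
Qed.

Lemma transposed_K a : transposed (Kgen a) 1 (Kgen a).
Proof.
apply: transposedP => I J szI; rewrite mul1r !pword_K // eq_sym.
by case: eqP => // ->.
Qed.

Fixpoint word_pairs M : seq (seq 'I_n * seq 'I_n) :=
  if M is m.+1 then word_pairs m ++ [seq (K, J) | J <- words n m, K <- words n m]
  else [::].

Lemma big_word_pairs (W : nmodType) M (h : seq 'I_n * seq 'I_n -> W) :
  \sum_(p <- word_pairs M) h p
  = \sum_(0 <= m < M) \sum_(J <- words n m) \sum_(K <- words n m) h (K, J).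
Proof.
elim: M => [|M IH]; first by rewrite big_nil big_geq.
by rewrite /= big_cat IH big_nat_recr //= big_allpairs_dep.
Qed.

Lemma mem_word_pairs M I J : size I = size J -> (size J < M)%N ->
  (I, J) \in word_pairs M.
Proof.
move=> eqIJ; elim: M => // M IH; rewrite ltnS leq_eqVlt mem_cat.
case/orP => [/eqP szJ|/IH -> //]; apply/orP; right; apply/allpairsP.
by exists (J, I); rewrite /= !mem_words eqIJ szJ eqxx.
Qed.

(* A coefficient family orthogonal to all the relations between words is invariant
   as soon as its image is, because the relations form a subrepresentation and so
   does their orthogonal. *)
Lemma invariant_lift f : exists M (c : seq 'I_n * seq 'I_n -> Qq), f = psi M c /\
  forall u c0 u' e, transposed u c0 u' -> Ract u f = e *: f ->
  forall I J, size I = size J -> (size J < M)%N -> lact u c (I, J) = e * c (I, J).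
Proof.
have [M [c0 fE]] := OqSL_spanned f.
pose Z (c : seq 'I_n * seq 'I_n -> Qq) := psi M c = 0.
have Z0 : Z (fun=> 0) by rewrite /Z /psi big1 // => m _; rewrite big1 // => J _; rewrite phi0.
have ZD (b : Qq) c d : Z c -> Z d -> Z (fun p => b * c p + d p).
  by rewrite /Z psi_linear => -> ->; rewrite scaler0 addr0.
have [z Zz cz] := orthogonal_decomposition (word_pairs M) (@sum_sq_eq0 _) Z0 ZD c0.
pose c p := -1 * z p + c0 p.
have cE p : c0 p - z p = c p by rewrite /c mulN1r addrC.
have c_orth y : Z y -> \sum_(p <- word_pairs M) c p * y p = 0.
  by move=> Zy; apply: etrans (cz y Zy); apply: eq_bigr => p _; rewrite cE.
have psic : psi M c = f by rewrite psi_linear Zz scaler0 add0r fE.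
exists M, c; split=> // u s u' e tu uf I J szI szJ.
(* [d] is (u - e) applied to [c]. It lies in the kernel [Z] since [f] is an eigenvector, and it is
   shown orthogonal to [Z], hence is zero. *)
pose d p := - e * c p + lact u c p.
have Zd : Z d.
  by rewrite /Z psi_linear -Ract_psi psic uf scaleNr addNr.
have d_orth y : Z y -> \sum_(p <- word_pairs M) d p * y p = 0.
  (* [y'] is the transpose of u - e applied to [y]; it stays in [Z], as [psi] intertwines the
     actions. *)
  move=> Zy; pose y' p := s * lact u' y p + (- e * y p + 0).
  have Zy' : Z y'.
    apply: (ZD s); last by apply: (ZD (- e)) Zy Z0.
    by rewrite /Z -Ract_psi (Zy : psi M y = 0) Ract0.
  apply: etrans (c_orth y' Zy'); rewrite !big_word_pairs; apply: eq_bigr => m _.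
  apply: eq_bigr => J' _.
  have := tu m (fun K => c (K, J')) (fun K => y (K, J')) => tm.
  rewrite (eq_bigr (fun K => - e * (c (K, J') * y (K, J'))
      + wact u (fun K => c (K, J')) K * y (K, J'))) => [|K _]; last first.
    by rewrite /d /lact /= mulrDl mulrA.
  rewrite big_split /= tm -big_split; apply: eq_bigr => K _ /=.
  rewrite /y' /lact /= addr0 [RHS]mulrDr addrC; congr (_ + _).
  exact: mulrCA.
have d0 := sum_sq_eq0 (d_orth d Zd) (mem_word_pairs szI szJ).
by move/eqP: d0; rewrite /d addrC mulNr subr_eq0 => /eqP.
Qed.

End Lifting.

(** * Antipode and counit on the inverses of the torus generators *)

Section Antipode.
Variables (n : nat) (HU : Uq_hopf n).

Lemma UqS_KV a : UqS HU (KVgen a) = Kgen a.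
Proof.
have := UqS_mul HU (KVgen a) (Kgen a); rewrite KVgen_Kgen UqS_one UqS_K => e.
by rewrite -[LHS]mul1r -(Kgen_KVgen a) -mulrA -e mulr1.
Qed.

Lemma UqEpsM u v : UqEps HU (u * v) = UqEps HU u * UqEps HU v.
Proof. exact: (rmorphM (UqEps HU)). Qed.

Lemma UqEps_KV a : UqEps HU (KVgen a) = 1.
Proof.
have := UqEpsM (KVgen a) (Kgen a).
by rewrite KVgen_Kgen UqEps_K mulr1 => <-; exact: (rmorph1 (UqEps HU)).
Qed.

End Antipode.

(** * Levi invariants and the algebra of block minors *)

Section Invariants.
Variables (n t : nat) (k : 'I_t -> nat).
Hypotheses (hk1 : forall s, (1 <= k s)%N) (hk : (\sum_(r < t) k r = n)%N).
Variables (HU : Uq_hopf n) (HO : OqSL_bialgebra n) (V : natural_rep n).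
Variable P : hopf_pairing HU HO V.
Local Notation Theta := (Theta n k).
Local Notation Ract := (Ract P).
Local Notation minors := (block_minors hk).

(** For the lifted coefficients, each fixed column word leaves an invariant tensor in the row word,
    to which the first fundamental theorem applies. *)
Lemma Levi_invariant_gen f :
  (forall a, a \in Theta ->
     [/\ Ract (Egen a) f = 0, Ract (Fgen a) f = 0 & Ract (Kgen a) f = f]) ->
  gen_subalg minors f.
Proof.
move=> finv; have [M [c [f_psi cinv]]] := invariant_lift P f.
rewrite f_psi /psi big_nat_cond; apply: (big_ind (gen_subalg minors)).
- exact: gen_subalg0.
- by move=> x y; exact: gen_subalgD.
move=> m /andP[/andP[_ mM] _]; apply: gen_subalg_sum => J; rewrite mem_words => /eqP szJ.
have szJM : (size J < M)%N by rewrite szJ.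
apply: (@invariant_phi_gen n t k hk1 hk HU HO V P m _ _ J szJ) => a aT K szK.
have [fE fF fK] := finv a aT.
have szKJ : size K = size J by rewrite szK szJ.
have Ef : Ract (Egen a) f = 0 *: f by rewrite scale0r.
have Ff : Ract (Fgen a) f = 0 *: f by rewrite scale0r.
have Kf : Ract (Kgen a) f = 1 *: f by rewrite scale1r.
split.
- exact: etrans (cinv _ _ _ _ (transposed_E P a) Ef K J szKJ szJM) (mul0r _).
- exact: etrans (cinv _ _ _ _ (transposed_F P a) Ff K J szKJ szJM) (mul0r _).
- exact: etrans (cinv _ _ _ _ (transposed_K P a) Kf K J szKJ szJM) (mul1r _).
Qed.

(** E_a and F_a act as skew derivations, so what they kill is closed under products; the minors are
    killed because the wedge of a block is invariant. *)
Lemma Ract_gen_subalg f a : gen_subalg minors f -> a \in Theta ->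
  Ract (Egen a) f = 0 /\ Ract (Fgen a) f = 0.
Proof.
move=> + aT; elim=> {f} [f [s [J [hJ ->]]]||c f g _ [fE fF] _ [gE gF]|f g _ [fE fF] _ [gE gF]].
- rewrite -(phi_wedge_qminor (card_block s hk) hJ) !Ract_phi.
  have inv := @wedge_invariant n t k hk HU HO V P s a aT.
  by split; rewrite -(phi0 (enum J)); apply: eq_phi => I szI;
    have [wE wF _] := inv I (etrans szI (etrans (esym (cardE J)) hJ)); rewrite ?wE ?wF.
- by rewrite !Ract_one UqEps_E UqEps_F scale0r.
- have lin u := Ract_linear P u c f g; rewrite !lin fE fF gE gF.
  by rewrite scaler0 addr0.
- by rewrite Ract_E_mul Ract_F_mul fE fF gE gF !mul0r !mulr0 addr0.
Qed.

(** The antipode turns K_a into its inverse, which fixes the same elements. *)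
Lemma Ract_Kgen a f : Lact P (Kgen a) f = f <-> Ract (Kgen a) f = f.
Proof.
rewrite LactE UqS_K; split=> e.
  by rewrite -{1}e -RactM KVgen_Kgen Ract1.
by rewrite -{1}e -RactM Kgen_KVgen Ract1.
Qed.

End Invariants.

(** The torus condition stays on the right-hand side: the block minors are in general only
    semi-invariant under the torus, so membership in the algebra they generate does not by itself
    give invariance. *)
Theorem lemma4p9 (n t : nat) (k : 'I_t -> nat)
    (hn : (2 <= n)%N) (hk1 : forall s : 'I_t, (1 <= k s)%N)
    (hk : (\sum_(r < t) k r = n)%N)
    (HU : Uq_hopf n) (HO : OqSL_bialgebra n) (V : natural_rep n)
    (P : hopf_pairing HU HO V) (f : OqSL n) :
  OqKG k P f <->
    gen_subalg (block_minors hk) f /\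
    (forall j : 'I_n.-1, Lact P (Kgen j) f = f).
Proof.
split=> [finv|[fgen fK]].
  have LK j : Lact P (Kgen j) f = f.
    by rewrite finv ?UqEps_K ?scale1r //; apply: gen_subalg_base; exact: Uqk_K.
  split=> //; apply: (@Levi_invariant_gen n t k hk1 hk HU HO V P) => a aT.
  have RK : Ract P (Kgen a) f = f by apply/Ract_Kgen.
  have RKV : Ract P (KVgen a) f = f by rewrite -[in LHS]RK -RactM Kgen_KVgen Ract1.
  have genE : Uqk k (Egen a) by apply: gen_subalg_base; exact: Uqk_E.
  have genF : Uqk k (Fgen a) by apply: gen_subalg_base; exact: Uqk_F.
  split=> //.
    (* The antipode of E_a is -K_a^-2 E_a; in a right action the factor K_a^-2 is applied first, and
       it fixes [f]. *)
    have := finv _ genE; rewrite UqEps_E scale0r LactE UqS_E RactN expr2 !RactM !RKV.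
    by move/eqP; rewrite oppr_eq0 => /eqP.
  have := finv _ genF; rewrite UqEps_F scale0r LactE UqS_F RactN RactM.
  (* For F_a the factor K_a^2 is applied last, and acting with K_a^-2 cancels it. *)
  move=> /(congr1 (fun g => Ract P (KVgen a ^+ 2) (- g))); rewrite opprK oppr0 Ract0.
  by rewrite -RactM !expr2 mulrA -[Kgen a * _ * _]mulrA Kgen_KVgen mulr1 Kgen_KVgen Ract1.
have RK a : Ract P (Kgen a) f = f by apply/Ract_Kgen.
have RKV a : Ract P (KVgen a) f = f by rewrite -[in LHS](RK a) -RactM Kgen_KVgen Ract1.
move=> u; elim=> {u} [u [a aT|a aT|a|a]||c u v _ IHu _ IHv|u v _ IHu _ IHv].
- have [fE _] := Ract_gen_subalg P fgen aT.
  by rewrite LactE UqS_E UqEps_E RactN expr2 !RactM !RKV fE oppr0 scale0r.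
- have [_ fF] := Ract_gen_subalg P fgen aT.
  by rewrite LactE UqS_F UqEps_F RactN RactM fF Ract0 oppr0 scale0r.
- by rewrite fK UqEps_K scale1r.
- by rewrite LactE UqS_KV UqEps_KV scale1r RK.
- by rewrite LactE UqS_one Ract1 (rmorph1 (UqEps HU)) scale1r.
- rewrite LactE linearP Ract_linear_l -!LactE IHu IHv.
  by rewrite (linearP (UqEps HU)) scalerDl scalerA.
- rewrite LactE UqS_mul RactM -[Ract P (UqS HU v) f]LactE IHv Ract_scale -LactE IHu.
  by rewrite scalerA UqEpsM mulrC.
Qed.
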